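(* Let $M$ be a Riemann surface. A superconformal harmonic map $\varphi:M\to\mathbb CP^{n-1}$ is never of finite uniton number. In fact, $\mathcal S_{jn}(T)=\lambda^{-2j}\underline{\mathcal H}_+$, equivalently, $W_{(jn)}=\lambda^{-2j}W$, for all $j\in\mathbb N$.
   Context: Riemann surfaces are connected, as usual; $z$ is a local complex coordinate. $\mathcal H_+$ is the Hardy space of functions in $L^2(S^1,\mathbb C^n)$ whose negative Fourier coefficients vanish, and $\underline{\mathcal H}_+=M\times\mathcal H_+$. Harmonic maps and finite uniton number. A smooth map $\varphi:M\to\mathrm U(n)$ is harmonic iff, with $A^\varphi_z=\frac12\varphi^{-1}\partial_z\varphi$, $A^\varphi_{\bar z}=\frac12\varphi^{-1}\partial_{\bar z}\varphi$, one has $\partial_{\bar z}A^\varphi_z+\partial_zA^\varphi_{\bar z}=0$. An extended solution associated to $\varphi$ is a smooth $\Phi:S^1\times M\to\mathrm U(n)$ with $\Phi(1,\cdot)=I$ and $\Phi^{-1}d\Phi=(1-\lambda^{-1})A^\varphi_z\,dz+(1-\lambda)A^\varphi_{\bar z}\,d\bar z$ (it exists at least locally). $\varphi$ is of finite uniton number if there is an associated extended solution defined on all of $M$ that is a trigonometric polynomial $\sum_{k=-r}^sC_k(z)\lambda^k$ ($C_k$ smooth) in $\lambda\in S^1$. Projective space. $\mathbb CP^{n-1}=G_1(\mathbb C^n)$ is embedded in $\mathrm U(n)$ by the totally geodesic Cartan embedding $\alpha\mapsto\pi_\alpha-\pi_\alpha^\perp$ ($\pi_\alpha$ the Hermitian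 projection onto $\alpha$, $\pi_\alpha^\perp=\pi_{\alpha^\perp}$); harmonicity, $A^\varphi_z$ and finiteness of the uniton number for a map into $\mathbb CP^{n-1}$ are those of its composition with this embedding. Such a map is identified with a line subbundle $\varphi$ of $M\times\mathbb C^n$. Superconformal maps. For harmonic $\varphi$, the Gauss bundle $G'(\varphi)$ is the image of $s\mapsto\pi_\varphi^\perp\partial_zs$ ($s$ a section of $\varphi$), extended over the isolated points where its rank drops; it is again harmonic. $G^{(0)}(\varphi)=\varphi$, $G^{(i+1)}(\varphi)=G'(G^{(i)}(\varphi))$. The isotropy order of $\varphi$ is the greatest $t\in\{1,2,\dots,\infty\}$ such that $\varphi\perp G^{(i)}(\varphi)$ for all $1\le i\le t$. A harmonic map $\varphi:M\to\mathbb CP^{n-1}$ is superconformal if it has the maximum possible finite isotropy order, which is $n-1$. $\mathcal S_i$ and $W_{(i)}$. $T=\partial_z+(1-\lambda^{-1})A^\varphi_z$, acting on sections of $M\times L^2(S^1,\mathbb C^n)$ (for each fixed $\lambda$). $\mathcal S_0=\underline{\mathcal H}_+$, $\mathcal S_i=\mathcal S_i(T)=T(\mathcal S_{i-1})+\mathcal S_{i-1}$, extended to a smooth subbundle over the isolated points where the rank drops. For an extended solution $\Phi$ associated to $\varphi$, $W=\Phi\underline{\mathcal H}_+$, $W_{(0)}=W$, and $W_{(i)}=\partial_zW_{(i-1)}+W_{(i-1)}$ off a discrete set, extended to a smooth subbundle (the Gauss sequence of $W$); one has $W_{(i)}=\Phi\mathcal S_i$. *)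

(* Defs.v *)
From HB Require Import structures.
From mathcomp Require Import all_boot all_order all_algebra.
From mathcomp Require Import spectral complex.
From mathcomp Require Import all_classical all_reals all_analysis.

Set Implicit Arguments.
Unset Strict Implicit.
Unset Printing Implicit Defensive.

Import Order.TTheory GRing.Theory Num.Theory.
Import numFieldNormedType.Exports.

Local Open Scope classical_set_scope.
Local Open Scope sesquilinear_scope.
Local Open Scope ring_scope.

(* The complex numbers, as a numClosedFieldType so that the topology and the
   complex derivative of the library apply to them. *)
Definition Cx (R : realType) : numClosedFieldType := R[i].

Section Coordinates.
Variable R : realType.
Local Notation C := (Cx R).

Definition cplx (p : R * R) : C := (p.1 +i* p.2)%C.
Definition rcst (t : R) : C := cplx (t, 0).
Definition imC : C := cplx (0, 1).

Definition S1 : Type := {l : C | `|l| == 1}.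

Definition cis (t : R) : C := cplx (cos t, sin t).

Lemma norm_cis t : `|cis t| == 1.
Proof. by rewrite /Num.norm /= cos2Dsin2 sqrtr1. Qed.

Definition circle (t : R) : S1 := exist _ (cis t) (norm_cis t).

Lemma norm_one : `|1 : C| == 1.
Proof. by rewrite normr1. Qed.

Definition one_S1 : S1 := exist _ 1 norm_one.

(* N is a norm on E, or a norm extended by +oo off a subspace of E on which
   it is finite (this is how L^2 is handled below). *)
Section Smooth.
Variables (E : lmodType C) (N : E -> \bar R) (V : normedModType R).

Definition is_dirderiv (f : V -> E) (p v : V) (d : E) : Prop :=
  N (rcst t^-1 *: (f (p + t *: v) - f p) - d) @[t --> (0 : R)^'] --> 0%E.

(* D w is the iterated derivative of f along the directions listed in w. *)
Definition smooth_coord (U : set V) (f : V -> E) : Prop :=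
  exists D : seq V -> V -> E,
    (forall p, U p -> D [::] p = f p) /\
    (forall w p, U p ->
       (N (D w q - D w p) @[q --> p] --> 0%E) /\
       (forall v, is_dirderiv (D w) p v (D (v :: w) p))).

End Smooth.

End Coordinates.

Section Charts.
Variables (R : realType) (M : topologicalType).
Local Notation C := (Cx R).

(* A homeomorphism from the open set cdom onto an open subset of C; cmap and
   cinv are irrelevant outside cdom and its image. *)
Record chart := Chart {
  cdom : set M;
  cmap : M -> C;
  cinv : C -> M;
  chart_open : open cdom;
  chart_open_image : open (cmap @` cdom);
  chart_invK : forall x, cdom x -> cinv (cmap x) = x;
  chart_cont : forall x, cdom x -> {for x, continuous cmap};
  chart_inv_cont : forall z, (cmap @` cdom) z -> {for z, continuous cinv} }.

Definition holomorphic_transition (a b : chart) : Prop :=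
  forall x, cdom a x -> cdom b x ->
    derivable (fun z : C => cmap b (cinv a z) : C) (cmap a x) 1.

End Charts.

(* Second countability is automatic (Rado). *)
Record riemann_surface (R : realType) := RiemannSurface {
  rs_space :> topologicalType;
  rs_hausdorff : hausdorff_space rs_space;
  rs_nonempty : [set: rs_space] !=set0;
  rs_connected : connected [set: rs_space];
  rs_atlas : set (chart R rs_space);
  rs_cover : forall x, exists2 c, rs_atlas c & cdom c x;
  rs_holomorphic : forall a b, rs_atlas a -> rs_atlas b ->
    holomorphic_transition a b }.

Section Calculus.
Variables (R : realType) (M : riemann_surface R).
Local Notation C := (Cx R).
Local Notation chart := (chart R M).

Definition coord_set (c : chart) (U : set M) : set (R * R) :=
  [set p | (cmap c @` (cdom c `&` U)) (cplx p)].

Definition from_coord (c : chart) (p : R * R) : M := cinv c (cplx p).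

Section Derivatives.
Variables (E : lmodType C) (N : E -> \bar R).

Definition smooth_on (U : set M) (f : M -> E) : Prop :=
  forall c, rs_atlas c ->
    smooth_coord N (coord_set c U) (fun p => f (from_coord c p)).

(* d = (d/dz) f at x, resp. d = (d/dzbar) f at x, where z is the coordinate
   of the chart c. *)
Definition is_dz (c : chart) (f : M -> E) (x : M) (d : E) : Prop :=
  exists p dx dy, [/\ cplx p = cmap c x,
    is_dirderiv N (fun q => f (from_coord c q)) p (1, 0) dx,
    is_dirderiv N (fun q => f (from_coord c q)) p (0, 1) dy &
    d = 2^-1 *: (dx - imC R *: dy)].

Definition is_dzbar (c : chart) (f : M -> E) (x : M) (d : E) : Prop :=
  exists p dx dy, [/\ cplx p = cmap c x,
    is_dirderiv N (fun q => f (from_coord c q)) p (1, 0) dx,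
    is_dirderiv N (fun q => f (from_coord c q)) p (0, 1) dy &
    d = 2^-1 *: (dx + imC R *: dy)].

End Derivatives.

Section Matrices.
Variables (m k : nat).

Definition frobenius (A : 'M[C]_(m, k)) : R :=
  Num.sqrt (\sum_i \sum_j (complex.Re (A i j) ^+ 2 + complex.Im (A i j) ^+ 2)).

Definition mxnorm (A : 'M[C]_(m, k)) : \bar R := (frobenius A)%:E.

Definition dz (c : chart) (f : M -> 'M[C]_(m, k)) (x : M) : 'M[C]_(m, k) :=
  xget 0 [set d | is_dz mxnorm c f x d].

Definition dzbar (c : chart) (f : M -> 'M[C]_(m, k)) (x : M) : 'M[C]_(m, k) :=
  xget 0 [set d | is_dzbar mxnorm c f x d].

End Matrices.

End Calculus.

Section HarmonicMaps.
Variables (R : realType) (M : riemann_surface R) (n : nat).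
Local Notation C := (Cx R).
Local Notation chart := (chart R M).
Local Notation mxnorm := (@mxnorm R _ _).

Definition Az (c : chart) (u : M -> 'M[C]_n) (x : M) : 'M[C]_n :=
  2^-1 *: (invmx (u x) *m dz c u x).

Definition Azbar (c : chart) (u : M -> 'M[C]_n) (x : M) : 'M[C]_n :=
  2^-1 *: (invmx (u x) *m dzbar c u x).

Definition harmonic_map (u : M -> 'M[C]_n) : Prop :=
  [/\ smooth_on mxnorm setT u,
      (forall x, u x \is unitarymx) &
      (forall c x, rs_atlas c -> cdom c x ->
         dzbar c (Az c u) x + dz c (Azbar c u) x = 0)].

Definition smooth_loops (U : set M) (Phi : S1 R -> M -> 'M[C]_n) : Prop :=
  forall c, rs_atlas c ->
    smooth_coord mxnorm
      [set q : R * (R * R) | coord_set c U q.2]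
      (fun q : R * (R * R) => Phi (circle q.1) (from_coord c q.2)).

Definition extended_solution (U : set M) (u : M -> 'M[C]_n)
    (Phi : S1 R -> M -> 'M[C]_n) : Prop :=
  [/\ (forall l x, U x -> Phi l x \is unitarymx),
      smooth_loops U Phi,
      (forall x, U x -> Phi (one_S1 R) x = 1%:M) &
      (forall c x l, rs_atlas c -> cdom c x -> U x ->
         invmx (Phi l x) *m dz c (Phi l) x =
           (1 - (sval l)^-1) *: Az c u x /\
         invmx (Phi l x) *m dzbar c (Phi l) x =
           (1 - sval l) *: Azbar c u x)].

Definition finite_uniton_number (u : M -> 'M[C]_n) : Prop :=
  exists2 Phi, extended_solution setT u Phi &
    exists (r s : nat) (coef : int -> M -> 'M[C]_n),
      (forall k, smooth_on mxnorm setT (coef k)) /\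
      (forall l x, Phi l x =
         \sum_(i < (r + s).+1)
            sval l ^ (i%:Z - r%:Z) *: coef (i%:Z - r%:Z) x).

(* A subspace of C^n is represented by the Hermitian projection onto it. *)
Definition is_proj (P : 'M[C]_n) : Prop := P *m P = P /\ P^t* = P.

Definition fibre (P : 'M[C]_n) : set 'cV[C]_n := [set v | P *m v = v].

Definition subbundle (P : M -> 'M[C]_n) : Prop :=
  smooth_on mxnorm setT P /\ forall x, is_proj (P x).

Definition map_to_CP (P : M -> 'M[C]_n) : Prop :=
  subbundle P /\ forall x, \rank (P x) = 1%N.

(* The Cartan embedding. *)
Definition cartan (P : M -> 'M[C]_n) (x : M) : 'M[C]_n := P x - (1%:M - P x).

Definition gauss_image (c : chart) (P : M -> 'M[C]_n) (x : M) :
    set 'cV[C]_n :=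
  [set v | exists O (s : M -> 'cV[C]_n),
     [/\ open O /\ O x, smooth_on mxnorm O s,
         (forall y, O y -> fibre (P y) (s y)) &
         v = (1%:M - P x) *m dz c s x]].

(* Q = G'(P); the set of exceptional points has no accumulation point. *)
Definition gauss_bundle (P Q : M -> 'M[C]_n) : Prop :=
  subbundle Q /\
  forall x, \forall y \near x^', forall c, rs_atlas c -> cdom c y ->
    fibre (Q y) = gauss_image c P y.

Definition gauss_bundles (P : M -> 'M[C]_n) (G : nat -> M -> 'M[C]_n) : Prop :=
  G 0%N = P /\ forall i, gauss_bundle (G i) (G i.+1).

Definition orthogonal_bundles (P Q : M -> 'M[C]_n) : Prop :=
  forall x v w, fibre (P x) v -> fibre (Q x) w -> v^t* *m w = 0.

Definition isotropy_order (P : M -> 'M[C]_n) (t : nat) : Prop :=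
  exists2 G, gauss_bundles P G &
    [/\ (0 < t)%N,
        (forall i, (0 < i <= t)%N -> orthogonal_bundles P (G i)) &
        (forall t', (forall i, (0 < i <= t')%N -> orthogonal_bundles P (G i)) ->
           (t' <= t)%N)].

Definition superconformal (P : M -> 'M[C]_n) : Prop := isotropy_order P n.-1.

End HarmonicMaps.

(* Elements of L^2(S^1, C^n) are represented by functions S^1 -> C^n, equal
   almost everywhere when the L^2 norm of the difference is 0. *)
Section HardySpace.
Variables (R : realType) (n : nat).
Local Notation C := (Cx R).
Local Notation mu := (@lebesgue_measure R).
Local Notation arc := (`[0, 2 * pi]%classic : set R).

Definition loop := S1 R -> 'cV[C]_n.

Definition loop_measurable (f : loop) : Prop :=
  forall i, measurable_fun arc (fun t => complex.Re (f (circle t) i 0)) /\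
            measurable_fun arc (fun t => complex.Im (f (circle t) i 0)).

Definition l2norm (f : loop) : \bar R :=
  if `[< loop_measurable f >] then
    sqrte (\int[mu]_(t in arc) (frobenius (f (circle t)) ^+ 2)%:E)%E
  else +oo%E.

Definition L2 : set loop := [set f | (l2norm f < +oo)%E].

Definition l2eq (f g : loop) : Prop := l2norm (f - g) = 0%E.

Definition cintegral (h : R -> C) : C :=
  cplx (Rintegral mu arc (fun t => complex.Re (h t)),
        Rintegral mu arc (fun t => complex.Im (h t))).

Definition fourier (f : loop) (k : int) : 'cV[C]_n :=
  \col_i (rcst (2 * pi)^-1 * cintegral (fun t => f (circle t) i 0 * cis t ^ (- k))).

Definition hardy : set loop :=
  [set f | L2 f /\ forall k : int, k < 0 -> fourier f k = 0].

(* lambda^(-k) V *)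
Definition lambda_shift (k : nat) (V : set loop) : set loop :=
  [set f | exists2 h, V h & f = fun l => (sval l) ^- k *: h l].

Definition loop_mul (A : S1 R -> 'M[C]_n) (V : set loop) : set loop :=
  [set f | exists2 h, V h & f = fun l => A l *m h l].

Definition closed_subspace (V : set loop) : Prop :=
  [/\ V `<=` L2, V 0, (forall (a : C) f g, V f -> V g -> V (a *: f + g)) &
      (forall f, L2 f ->
         (forall e : R, 0 < e -> exists2 g, V g & (l2norm (f - g)%R < e%:E)%E) ->
         V f)].

Definition opnorm (A : loop -> loop) : \bar R :=
  ereal_inf [set m%:E | m in [set m : R | 0 <= m /\
    forall f, L2 f -> (l2norm (A f) <= m%:E * l2norm f)%E]].

Definition bounded_operator (A : loop -> loop) : Prop :=
  (opnorm A < +oo)%E /\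
  forall (a : C) f g, L2 f -> L2 g -> l2eq (A (a *: f + g)) (a *: A f + A g).

Definition mutually_inverse (A B : loop -> loop) : Prop :=
  forall f, L2 f -> l2eq (A (B f)) f /\ l2eq (B (A f)) f.

End HardySpace.
Arguments hardy R n : clear implicits.

Section GaussSequences.
Variables (R : realType) (M : riemann_surface R) (n : nat).
Local Notation C := (Cx R).
Local Notation chart := (chart R M).
Local Notation loop := (loop R n).
Local Notation l2norm := (@l2norm R n).
Local Notation opnorm := (@opnorm R n).

(* Locally W is the image of a constant closed subspace under a smooth family
   of invertible bounded operators, smooth meaning smooth in operator norm. *)
Definition smooth_subbundle (U : set M) (W : M -> set loop) : Prop :=
  forall x, U x ->
    exists (O : set M) (V : set loop) (g h : M -> loop -> loop),
      [/\ open O /\ O x, closed_subspace V,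
          smooth_on opnorm O g /\ smooth_on opnorm O h,
          (forall y, O y -> [/\ bounded_operator (g y),
             bounded_operator (h y) & mutually_inverse (g y) (h y)]) &
          (forall y, O y -> W y = [set f | exists2 v, V v & l2eq f (g y v)])].

(* The fibre at x of D(W) + W, for the operator D = d/dz + K. *)
Definition derived_fibre (c : chart) (K : S1 R -> M -> 'M[C]_n)
    (W : M -> set loop) (x : M) : set loop :=
  [set f | exists (O : set M) (s : M -> loop) (d g : loop),
     [/\ open O /\ O x, smooth_on l2norm O s,
         (forall y, O y -> W y (s y)), is_dz l2norm c s x d /\ W x g &
         l2eq f ((fun l => d l + K l x *m s x l) + g)]].

(* W' = D(W) + W on U, extended over a set without accumulation points in U. *)
Definition derived_bundle (U : set M) (K : chart -> S1 R -> M -> 'M[C]_n)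
    (W W' : M -> set loop) : Prop :=
  smooth_subbundle U W' /\
  forall x, U x -> \forall y \near x^', forall c, rs_atlas c -> cdom c y ->
    W' y = derived_fibre c (K c) W y.

Definition T_potential (u : M -> 'M[C]_n) (c : chart) (l : S1 R) (x : M) :
    'M[C]_n :=
  (1 - (sval l)^-1) *: Az c u x.

(* S i is the bundle S_i(T), for T = d/dz + (1 - 1/lambda) A_z^u. *)
Definition S_sequence (u : M -> 'M[C]_n) (S : nat -> M -> set loop) : Prop :=
  (forall x, S 0%N x = hardy R n) /\
  forall i, derived_bundle setT (T_potential u) (S i) (S i.+1).

(* W i is the bundle W_(i) over U, for W = Phi H_+. *)
Definition W_sequence (U : set M) (Phi : S1 R -> M -> 'M[C]_n)
    (W : nat -> M -> set loop) : Prop :=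
  (forall x, U x -> W 0%N x = loop_mul (Phi^~ x) (hardy R n)) /\
  forall i, derived_bundle U (fun _ _ _ => 0) (W i) (W i.+1).

End GaussSequences.

(* Main.v *)
Require Import Defs.
From mathcomp Require Import all_boot all_order all_algebra.
From mathcomp Require Import spectral complex ring lra zify.
From mathcomp Require Import all_classical all_reals all_analysis measurable_realfun.

Set Implicit Arguments.
Unset Strict Implicit.
Unset Printing Implicit Defensive.

Import Order.TTheory GRing.Theory Num.Theory.
Import numFieldNormedType.Exports.

Local Open Scope classical_set_scope.
Local Open Scope sesquilinear_scope.
Local Open Scope ring_scope.

(** Why the theorem is true.

    Let G 0 = phi, G 1, G 2, ... be the Gauss sequence of a superconformal
    harmonic map into CP^(n-1), let P_a be the projection onto G a, and let
    M_a = (d/dz P_a) P_a, which maps G a to G (a + 1). Harmonicity makes d/dzbar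
    map each G (a + 1) back to G a, and this propagates the orthogonality of
    phi to its successors: G 0, ..., G (n-1) are orthogonal lines
    ([gauss_orth]), none of them vanishes because the isotropy order is finite
    ([G_neq0]), so they split C^n ([sum_gauss]), and the sequence closes up,
    G n = G 0 ([gauss_periodic]). In this cyclic frame
    d/dz P_a = M_a - M_(a-1) ([frenet]) and A_z = -(M_0 + M_(n-1))
    ([Az_shift]). Hence T = d/dz + (1 - 1/lambda) A_z sends a section
    lambda^k s of lambda^k G b, modulo lambda^k G b itself, to lambda^k M_b s,
    except that for the two steps b = 0 and b = n-1 of the cycle it sends it
    to lambda^(k-1) M_b s. After n steps the line is the same and k has dropped
    by 2.

    This is recorded by a level: for k < 0, [lev n k a] is the number of steps
    that lead from H_+ to lambda^k G a. One step of T raises the level by one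
    ([lev_step]), k - 2 has the level of k plus n ([lev_shift]), and the levels
    of H_+ are those that are not positive ([lev_pos]). The bundle [Slev] i of
    the loops whose frequencies all have level at most i therefore satisfies
    Slev (j n) = lambda^(-2j) H_+ by inspection of Fourier coefficients
    ([Slev_periodic]), and what remains is that it is the sequence S_i.

    For that, one treats S and W together, as the bundles Phi Slev i for a
    unitary family Phi of loops that conjugates d/dz + K to T. They are smooth
    subbundles ([Wlev_smooth]). Differentiation raises i by at most one
    ([derived_sub]), and at points where every M_b is onto G (b + 1) it
    produces everything of level i + 1 ([derived_sup]); the other points have
    no accumulation point. A smooth subbundle is determined by its fibres off
    such a set ([subbundle_limit]), so no other sequence satisfies the same
    conditions ([derived_sequence_unique]).

    Finally, if Phi is a trigonometric polynomial then the frequencies of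
    Phi H_+ are bounded below, and differentiation in z does not enlarge the
    set of frequencies ([bounded_below_derived]); this contradicts
    W_(jn) = lambda^(-2j) W for large j ([not_finite_uniton]).

    The analysis rests on one remark: a matrix function that is jointly smooth
    on circle and surface is smooth on the surface as a function with values in
    the loops under the sup norm ([sm_joint]), hence also as a family of
    operators on L^2 and, applied to a vector, as a section of L^2. *)

(** * Quasi-norms and directional derivatives *)

Section Null.
Variable R : realType.
Local Notation C := (Cx R).

Definition null (T : Type) (F : set_system T) (g : T -> \bar R) :=
  forall e : R, 0 < e -> \forall t \near F, (g t <= e%:E)%E.

Lemma cvg_null (T : Type) (F : set_system T) {FF : Filter F} (g : T -> \bar R) :
  (forall t, 0 <= g t)%E -> (g t @[t --> F] --> 0%E) <-> null F g.
Proof.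
move=> g0; split.
  move=> /fine_cvgP [fin /cvgrPdist_le h] e e0.
  near=> t.
  have ft : g t \is a fin_num by near: t.
  rewrite -(fineK ft) lee_fin.
  have : `|0 - fine (g t)| <= e by near: t; apply: h.
  by rewrite sub0r normrN ger0_norm // fine_ge0.
move=> h; apply/fine_cvgP; split.
  near=> t; rewrite ge0_fin_numE //.
  apply: (@le_lt_trans _ _ 1%:E); last exact: ltry.
  by near: t; apply: h.
apply/cvgrPdist_le => e e0; near=> t.
rewrite sub0r normrN ger0_norm ?fine_ge0 //.
have : (g t <= e%:E)%E by near: t; apply: h.
by move: (g0 t) => /=; case: (g t).
Unshelve. all: by end_near. Qed.

Lemma null_le (T : Type) (F : set_system T) {FF : Filter F} (g h : T -> \bar R) :
  (\forall t \near F, (g t <= h t)%E) -> null F h -> null F g.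
Proof.
move=> gh nh e e0; near=> t; apply: (@le_trans _ _ (h t)); near: t => //.
exact: nh.
Unshelve. all: by end_near. Qed.

Definition cmod (c : C) : R := Num.sqrt (complex.Re c ^+ 2 + complex.Im c ^+ 2).

Lemma normCE (c : C) : `|c| = (cmod c)%:C%C.
Proof. by case: c. Qed.

Lemma cmod_ge0 c : 0 <= cmod c. Proof. exact: sqrtr_ge0. Qed.

Lemma cmodM a b : cmod (a * b) = cmod a * cmod b.
Proof.
have := normrM a b; rewrite !normCE => /eqP; rewrite eq_complex /= => /andP [/eqP -> _].
by rewrite mulr0 subr0.
Qed.

Lemma cmod0 : cmod 0 = 0. Proof. by rewrite /cmod /= expr0n addr0 sqrtr0. Qed.

Lemma cmod_eq0 c : cmod c = 0 -> c = 0.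
Proof. by move=> h; apply/eqP; rewrite -normr_eq0 normCE h. Qed.

Lemma rcstE t : rcst t = (t%:C)%C :> C. Proof. by []. Qed.
Lemma rcstM s t : rcst (s * t) = rcst s * rcst t :> C.
Proof. by rewrite !rcstE rmorphM. Qed.
Lemma rcst1 : rcst 1 = 1 :> C. Proof. by []. Qed.

Lemma cmod_rcst t : cmod (rcst t) = `|t|.
Proof. by rewrite /cmod /= expr0n addr0 sqrtr_sqr. Qed.
Lemma cmodN c : cmod (- c) = cmod c.
Proof. by rewrite /cmod; case: c => a b /=; rewrite !sqrrN. Qed.

(** The factor 2 covers the Frobenius norm, the L^2 norm and the sup norm at
    once without Minkowski's inequality; N may take the value +oo. *)
Record quasi_norm (E : lmodType C) (N : E -> \bar R) : Prop := QuasiNorm {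
  qn_ge0 : forall a, (0 <= N a)%E;
  qn_0 : N 0%R = 0%E;
  qn_D : forall a b (x y : R), (N a <= x%:E)%E -> (N b <= y%:E)%E ->
    (N (a + b)%R <= (2 * (x + y))%:E)%E;
  qn_Z : forall c a (x : R), (N a <= x%:E)%E -> (N (c *: a)%R <= (cmod c * x)%:E)%E }.

Section QN.
Variables (E : lmodType C) (N : E -> \bar R) (qN : quasi_norm N).

Lemma qn_N a : N (- a) = N a.
Proof.
have h b : (N (- b)%R <= N b)%E.
  have := qn_ge0 qN b; case e : (N b) => [x| |] // _.
    have /(qn_Z qN (-1)) : (N b <= x%:E)%E by rewrite e.
    by rewrite scaleN1r cmodN (cmod_rcst 1) normr1 mul1r.
  by rewrite leey.
by apply/eqP; rewrite eq_le h /= -{1}(opprK a) h.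
Qed.

Lemma qn_D2 a b (e : R) : (N a <= (e / 4)%:E)%E -> (N b <= (e / 4)%:E)%E -> (N (a + b)%R <= e%:E)%E.
Proof.
move=> ha hb; apply: (le_trans (qn_D qN ha hb)); rewrite lee_fin.
by lra.
Qed.

Lemma qn_fin a b : (N a < +oo)%E -> (N b < +oo)%E -> (N (a + b)%R < +oo)%E.
Proof.
have := qn_ge0 qN a; case ea : (N a) => [x| |] // _ _.
have := qn_ge0 qN b; case eb : (N b) => [y| |] // _ _.
have ha : (N a <= x%:E)%E by rewrite ea.
have hb : (N b <= y%:E)%E by rewrite eb.
by apply: (le_lt_trans (qn_D qN ha hb)); exact: ltry.
Qed.

Lemma qn_finZ c a : (N a < +oo)%E -> (N (c *: a)%R < +oo)%E.
Proof.
have := qn_ge0 qN a; case ea : (N a) => [x| |] // _ _.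
have ha : (N a <= x%:E)%E by rewrite ea.
by apply: (le_lt_trans (qn_Z qN c ha)); exact: ltry.
Qed.

Lemma qn_finP a : (N a < +oo)%E -> exists2 M, 0 < M & (N a <= M%:E)%E.
Proof.
have := qn_ge0 qN a; case ea : (N a) => [x| |] // x0 _.
by exists (x + 1); rewrite ?ltr_wpDl // lee_fin lerDl.
Qed.

Lemma qn_small0 a : (forall e : R, 0 < e -> (N a <= e%:E)%E) -> N a = 0%E.
Proof.
move=> h; apply/eqP; rewrite eq_le (qn_ge0 qN) andbT.
apply/lee_addgt0Pr => e e0; rewrite add0e; exact: h.
Qed.

Section Lim.
Variables (T : Type) (F : set_system T).
Context {FF : Filter F}.
Implicit Types h k : T -> E.

Lemma null_qnD h k : null F (fun t => N (h t)) -> null F (fun t => N (k t)) ->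
  null F (fun t => N (h t + k t)).
Proof.
move=> nh nk e e0; near=> t; apply: qn_D2; near: t; [apply: nh|apply: nk]; exact: divr_gt0.
Unshelve. all: by end_near. Qed.

Lemma null_qnN h : null F (fun t => N (h t)) -> null F (fun t => N (- h t)).
Proof. by move=> nh e e0; have := nh e e0; apply: filterS => t; rewrite qn_N. Qed.

Lemma null_qnZ c h : null F (fun t => N (h t)) -> null F (fun t => N (c *: h t)).
Proof.
move=> nh e e0; near=> t.
apply: (@le_trans _ _ (cmod c * (e / (cmod c + 1)))%:E).
  apply: (qn_Z qN); near: t; apply: nh; apply: divr_gt0 => //.
  by have := cmod_ge0 c; lra.
rewrite lee_fin mulrCA ger_pMr // ler_pdivrMr ?mul1r; have := cmod_ge0 c; lra.
Unshelve. all: by end_near. Qed.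

Lemma null_near h k : (\forall t \near F, h t = k t) -> null F (fun t => N (k t)) ->
  null F (fun t => N (h t)).
Proof. by move=> hk nk; apply: (null_le _ nk); move: hk; apply: filterS => t ->. Qed.

Lemma null_qn0 : null F (fun=> N 0).
Proof. by move=> e e0; apply: nearW => t; rewrite (qn_0 qN) lee_fin ltW. Qed.

Lemma null_bd h k : null F (fun t => N (h t - k t)) ->
  (exists M : R, \forall t \near F, (N (k t) <= M%:E)%E) ->
  (exists M : R, \forall t \near F, (N (h t) <= M%:E)%E).
Proof.
move=> n [M bk]; exists (2 * (1 + M)); near=> t.
rewrite -(subrK (k t) (h t)); apply: (qn_D qN); near: t => //.
exact: n.
Unshelve. all: by end_near. Qed.
End Lim.
End QN.

Section Bilin.
Variables (E1 E2 E3 : lmodType C) (N1 : E1 -> \bar R) (N2 : E2 -> \bar R) (N3 : E3 -> \bar R).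
Variables (q1 : quasi_norm N1) (q2 : quasi_norm N2) (q3 : quasi_norm N3).
Variable B : E1 -> E2 -> E3.
Definition bounded_by (K : R) := forall a b (x y : R), (N1 a <= x%:E)%E -> (N2 b <= y%:E)%E ->
  (N3 (B a b) <= (K * (x * y))%:E)%E.
Variables (K : R) (K0 : 0 <= K) (BK : bounded_by K).
Variables (T : Type) (F : set_system T).
Context {FF : Filter F}.

Lemma null_bil_l (f : T -> E1) (g : T -> E2) : null F (fun t => N1 (f t)) ->
  (exists M : R, \forall t \near F, (N2 (g t) <= M%:E)%E) ->
  null F (fun t => N3 (B (f t) (g t))).
Proof.
move=> nf [M bg] e e0.
have d0 : 0 < K * (`|M| + 1) + 1.
  have : 0 <= K * (`|M| + 1) by rewrite mulr_ge0 // addr_ge0.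
  lra.
near=> t.
have h1 : (N1 (f t) <= (e / (K * (`|M| + 1) + 1))%:E)%E.
  by near: t; apply: nf; rewrite divr_gt0.
have h2 : (N2 (g t) <= (`|M| + 1)%:E)%E.
  apply: (@le_trans _ _ M%:E); first by near: t.
  by rewrite lee_fin; have := ler_norm M; lra.
apply: (le_trans (BK h1 h2)); rewrite lee_fin mulrAC mulrA.
by rewrite ler_pdivrMr // mulrCA ler_pM2l //; lra.
Unshelve. all: by end_near. Qed.

Lemma null_bil_r (f : T -> E1) (g : T -> E2) : null F (fun t => N2 (g t)) ->
  (exists M : R, \forall t \near F, (N1 (f t) <= M%:E)%E) ->
  null F (fun t => N3 (B (f t) (g t))).
Proof.
move=> nf [M bg] e e0.
have d0 : 0 < K * (`|M| + 1) + 1.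
  have : 0 <= K * (`|M| + 1) by rewrite mulr_ge0 // addr_ge0.
  lra.
near=> t.
have h1 : (N2 (g t) <= (e / (K * (`|M| + 1) + 1))%:E)%E.
  by near: t; apply: nf; rewrite divr_gt0.
have h2 : (N1 (f t) <= (`|M| + 1)%:E)%E.
  apply: (@le_trans _ _ M%:E); first by near: t.
  by rewrite lee_fin; have := ler_norm M; lra.
apply: (le_trans (BK h2 h1)); rewrite lee_fin mulrA.
rewrite mulrCA ger_pMr // ler_pdivrMr // mul1r; lra.
Unshelve. all: by end_near. Qed.
End Bilin.
End Null.

Section Deriv.
Variable R : realType.
Local Notation C := (Cx R).
Variable V : normedModType R.

Section One.
Variables (E : lmodType C) (N : E -> \bar R) (qN : quasi_norm N).
Implicit Types (f g : V -> E) (p v : V) (a b d : E).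

Definition diffq f p v (t : R) : E := rcst t^-1 *: (f (p + t *: v) - f p).

Lemma dderivP f p v d :
  is_dirderiv N f p v d <-> null (0 : R)^' (fun t => N (diffq f p v t - d)).
Proof. by rewrite /is_dirderiv; apply: cvg_null => t; exact: qn_ge0. Qed.

Lemma dderiv_uniq f p v a b : is_dirderiv N f p v a -> is_dirderiv N f p v b ->
  N (a - b) = 0%E.
Proof.
move=> /dderivP ha /dderivP hb; apply: (qn_small0 qN) => e e0.
have h : null (0 : R)^' (fun t => N ((diffq f p v t - b)  - (diffq f p v t - a))).
  by apply: (null_qnD qN) => //; apply: (null_qnN qN).
have [t] := @filter_ex _ _ _ _ (h e e0).
by rewrite opprB addrC subrKA.
Qed.

Lemma near_line (p v : V) (P : V -> Prop) : (\forall q \near p, P q) ->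
  \forall t \near (0 : R)^', P (p + t *: v).
Proof.
move=> h; apply: nbhs_dnbhs.
have : (fun t : R => p + t *: v) @ 0 --> p + (0 : R) *: v.
  by apply: cvgD; [exact: cvg_cst|exact: scalel_continuous].
by rewrite scale0r addr0 => /(_ _ h).
Qed.

Lemma dderiv_near f g p v d : (\forall q \near p, f q = g q) ->
  is_dirderiv N f p v d -> is_dirderiv N g p v d.
Proof.
move=> fg /dderivP h; apply/dderivP.
apply: (null_near _ h); have := near_line v fg; apply: filterS => t e.
by rewrite /diffq e (nbhs_singleton fg).
Qed.

Lemma dderiv_cst a p v : is_dirderiv N (fun=> a) p v 0.
Proof.
apply/dderivP; rewrite /diffq; apply: (null_near (k := fun=> 0)); last exact: null_qn0.
by apply: nearW => t; rewrite subrr scaler0 subrr.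
Qed.

Lemma dderivD f g p v a b : is_dirderiv N f p v a -> is_dirderiv N g p v b ->
  is_dirderiv N (fun q => f q + g q) p v (a + b).
Proof.
move=> /dderivP ha /dderivP hb; apply/dderivP.
apply: (null_near _ (null_qnD qN ha hb)); apply: nearW => t.
by rewrite /diffq opprD addrACA scalerDr opprD addrACA.
Qed.

Lemma dderivZ c f p v a : is_dirderiv N f p v a ->
  is_dirderiv N (fun q => c *: f q) p v (c *: a).
Proof.
move=> /dderivP ha; apply/dderivP.
apply: (null_near _ (null_qnZ qN c ha)); apply: nearW => t.
by rewrite /diffq -scalerBr !scalerA mulrC -!scalerA -scalerBr.
Qed.

Lemma dderiv_cont f p v d : is_dirderiv N f p v d -> (N d < +oo)%E ->
  null (0 : R)^' (fun t => N (f (p + t *: v) - f p)).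
Proof.
move=> /dderivP h /(qn_finP qN) [M M0 dM].
have [M' hM'] : exists M' : R, \forall t \near (0:R)^', (N (diffq f p v t) <= M'%:E)%E.
  apply: (@null_bd _ _ _ qN _ _ _ _ (fun=> d)) => //; exists M; exact: nearW.
move=> e e0; near=> t.
have t0 : t != 0 by near: t; exact: nbhs_dnbhs_neq.
have -> : f (p + t *: v) - f p = rcst t *: diffq f p v t.
  by rewrite /diffq scalerA -rcstM divff // rcst1 scale1r.
have h2 : (N (diffq f p v t) <= (`|M'| + 1)%:E)%E.
  apply: (@le_trans _ _ M'%:E); first by near: t.
  by rewrite lee_fin; have := ler_norm M'; lra.
apply: (le_trans (qn_Z qN _ h2)); rewrite lee_fin cmod_rcst -ler_pdivlMr; last first.
  by have := normr_ge0 M'; lra.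
near: t; apply: dnbhs0_le; rewrite divr_gt0 //.
Unshelve. all: by end_near. Qed.
End One.

Section Bilinear.
Variables (E1 E2 E3 : lmodType C) (N1 : E1 -> \bar R) (N2 : E2 -> \bar R) (N3 : E3 -> \bar R).
Variables (q1 : quasi_norm N1) (q2 : quasi_norm N2) (q3 : quasi_norm N3).
Variable B : E1 -> E2 -> E3.
Hypothesis BDl : forall a a' b, B (a + a') b = B a b + B a' b.
Hypothesis BDr : forall a b b', B a (b + b') = B a b + B a b'.
Hypothesis BZl : forall c a b, B (c *: a) b = c *: B a b.
Hypothesis BZr : forall c a b, B a (c *: b) = c *: B a b.
Variables (K : R) (K0 : 0 <= K) (BK : bounded_by N1 N2 N3 B K).

Lemma bilNl a b : B (- a) b = - B a b.
Proof. by rewrite -scaleN1r BZl scaleN1r. Qed.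
Lemma bilNr a b : B a (- b) = - B a b.
Proof. by rewrite -scaleN1r BZr scaleN1r. Qed.

(** The Leibniz rule in the form needed both for products of matrices and for
    matrix loops acting on L^2 loops. *)
Lemma dderiv_bil (f : V -> E1) (g : V -> E2) p v a b :
  (N1 (f p) < +oo)%E -> (N2 (g p) < +oo)%E -> (N1 a < +oo)%E -> (N2 b < +oo)%E ->
  is_dirderiv N1 f p v a -> is_dirderiv N2 g p v b ->
  is_dirderiv N3 (fun q => B (f q) (g q)) p v (B a (g p) + B (f p) b).
Proof.
move=> fp gp af bf ha hb; apply/(dderivP q3).
have ng := dderiv_cont q2 hb bf.
move/(dderivP q1): ha => ha; move/(dderivP q2): hb => hb.
have [M1 _ hM1] := qn_finP q1 fp; have [M2 _ hM2] := qn_finP q2 gp.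
have [M3 _ hM3] := qn_finP q1 af.
have n1 : null (0:R)^' (fun t => N3 (B (diffq f p v t - a) (g (p + t *: v)))).
  apply: (null_bil_l K0 BK ha); apply: (@null_bd _ _ _ q2 _ _ _ _ (fun=> g p) ng).
  by exists M2; exact: nearW.
have n2 : null (0:R)^' (fun t => N3 (B a (g (p + t *: v) - g p))).
  by apply: (null_bil_r K0 BK ng); exists M3; exact: nearW.
have n3 : null (0:R)^' (fun t => N3 (B (f p) (diffq g p v t - b))).
  by apply: (null_bil_r K0 BK hb); exists M1; exact: nearW.
apply: (null_near _ (null_qnD q3 n1 (null_qnD q3 n2 n3))).
apply: nearW => t; rewrite /diffq !(BDl, BDr, BZl, BZr, bilNl, bilNr).
rewrite !scalerDr !scalerN opprD.
set X := B a (g (p + t *: v)).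
rewrite -!addrA; congr (_ + _).
set Y := _ *: B (f p) (g (p + t *: v)).
set Z := _ *: B (f p) (g p).
by rewrite addKr [RHS]addrCA addKr addrCA.
Qed.
End Bilinear.

Section Maps.
Variables (E E' : lmodType C) (N : E -> \bar R) (N' : E' -> \bar R).
Variables (qN : quasi_norm N) (qN' : quasi_norm N') (L : E -> E').
Hypothesis LP : forall c a b, (N a < +oo)%E -> (N b < +oo)%E -> L (c *: a + b) = c *: L a + L b.
Variables (K : R) (K0 : 0 <= K).
Hypothesis LK : forall a (x : R), (N a <= x%:E)%E -> (N' (L a) <= (K * x)%:E)%E.

(** Linearity is asked for at arguments of finite norm only, because Fourier
    coefficients are linear only on L^2. *)
Lemma null_lin (T : Type) (F : set_system T) {FF : Filter F} (h : T -> E) :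
  null F (fun t => N (h t)) -> null F (fun t => N' (L (h t))).
Proof.
move=> nh e e0.
have d0 : 0 < K + 1 by rewrite ltr_wpDl.
near=> t.
have h1 : (N (h t) <= (e / (K + 1))%:E)%E by near: t; apply: nh; rewrite divr_gt0.
by apply: (le_trans (LK h1)); rewrite lee_fin mulrA ler_pdivrMr // mulrC ler_pM2l //; lra.
Unshelve. all: by end_near. Qed.

Lemma dderiv_lin (f : V -> E) p v a :
  (\forall q \near p, (N (f q) < +oo)%E) -> (N a < +oo)%E ->
  is_dirderiv N f p v a -> is_dirderiv N' (fun q => L (f q)) p v (L a).
Proof.
move=> fn af /(dderivP qN) ha; apply/(dderivP qN').
apply: (null_near _ (null_lin ha)).
have := near_line v fn; apply: filterS => t ft.
have fp := nbhs_singleton fn.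
have LZ c b : (N b < +oo)%E -> L (c *: b) = c *: L b.
  move=> hb; rewrite -[c *: b]addr0 LP ?(qn_0 qN) ?ltry //.
  have h0 : (N 0%R < +oo)%E by rewrite (qn_0 qN) ltry.
  have := LP 1 h0 h0; rewrite !scale1r addr0 => /eqP.
  by rewrite -subr_eq0 opprD addrA subrr add0r oppr_eq0 => /eqP ->; rewrite addr0.
have LB b b' : (N b < +oo)%E -> (N b' < +oo)%E -> L (b - b') = L b - L b'.
  by move=> hb hb'; rewrite addrC -scaleN1r LP // scaleN1r addrC.
have fB : (N (f (p + t *: v) - f p)%R < +oo)%E.
  by apply: (qn_fin qN) => //; rewrite (qn_N qN).
by rewrite /diffq LB ?LZ ?LB //; exact: qn_finZ.
Qed.

End Maps.
End Deriv.

(** * The Frobenius norm *)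

Section Frobenius.
Variable R : realType.
Local Notation C := (Cx R).

Lemma cmod2E (c : C) : cmod c ^+ 2 = complex.Re c ^+ 2 + complex.Im c ^+ 2.
Proof. by rewrite sqr_sqrtr // addr_ge0 // sqr_ge0. Qed.

Lemma frobeniusE m k (A : 'M[C]_(m, k)) :
  frobenius A = Num.sqrt (\sum_i \sum_j cmod (A i j) ^+ 2).
Proof. by rewrite /frobenius; congr Num.sqrt; do 2!apply: eq_bigr => ? _; rewrite cmod2E. Qed.

Lemma frob_ge0 m k (A : 'M[C]_(m, k)) : 0 <= frobenius A.
Proof. exact: sqrtr_ge0. Qed.

Lemma frob2 m k (A : 'M[C]_(m, k)) : frobenius A ^+ 2 = \sum_i \sum_j cmod (A i j) ^+ 2.
Proof.
by rewrite frobeniusE sqr_sqrtr //; do 2!(apply: sumr_ge0 => ? _); exact: sqr_ge0.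
Qed.

Lemma cmod_le_frob m k (A : 'M[C]_(m, k)) i j : cmod (A i j) <= frobenius A.
Proof.
rewrite -(@ler_pXn2r _ 2) ?nnegrE ?cmod_ge0 ?frob_ge0 // frob2 (bigD1 i) //= (bigD1 j) //=.
rewrite -addrA lerDl addr_ge0 //; [|apply: sumr_ge0 => ? _]; apply: sumr_ge0 => ? _; exact: sqr_ge0.
Qed.

Lemma frob_le_sum m k (A : 'M[C]_(m, k)) (x : R) : 0 <= x ->
  (forall i j, cmod (A i j) <= x) -> frobenius A <= (m * k)%:R * x.
Proof.
move=> x0 h; rewrite -(@ler_pXn2r _ 2) ?nnegrE ?frob_ge0 ?mulr_ge0 // frob2.
apply: (@le_trans _ _ (\sum_(i < m) \sum_(j < k) x ^+ 2)).
  apply: ler_sum => i _; apply: ler_sum => j _.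
  by rewrite ler_pXn2r ?nnegrE ?cmod_ge0.
rewrite !sumr_const !card_ord -mulrnA mulnC exprMn -[x ^+ 2 *+ _]mulr_natl.
rewrite ler_wpM2r ?sqr_ge0 // -natrX ler_nat.
by case: (m * k)%N => // l; rewrite expnS expn1 leq_pmulr.
Qed.

Lemma cmodD2 (a b : C) : cmod (a + b) ^+ 2 <= 2 * (cmod a ^+ 2 + cmod b ^+ 2).
Proof.
rewrite !cmod2E; case: a => a1 a2; case: b => b1 b2 /=.
have := sqr_ge0 (a1 - b1); have := sqr_ge0 (a2 - b2); nra.
Qed.

Lemma frobD m k (A B : 'M[C]_(m, k)) : frobenius (A + B) <= 2 * (frobenius A + frobenius B).
Proof.
rewrite -(@ler_pXn2r _ 2) ?nnegrE ?frob_ge0 ?mulr_ge0 ?addr_ge0 ?frob_ge0 //.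
apply: (@le_trans _ _ (2 * (frobenius A ^+ 2 + frobenius B ^+ 2))).
  rewrite !frob2 -big_split /= mulr_sumr; apply: ler_sum => i _.
  rewrite -big_split /= mulr_sumr; apply: ler_sum => j _.
  by rewrite mxE cmodD2.
have := frob_ge0 A; have := frob_ge0 B; nra.
Qed.

Lemma frobZ m k c (A : 'M[C]_(m, k)) : frobenius (c *: A) = cmod c * frobenius A.
Proof.
apply: (@pexpIrn _ 2) => //; rewrite ?nnegrE ?frob_ge0 ?mulr_ge0 ?cmod_ge0 ?frob_ge0 //.
rewrite exprMn !frob2 mulr_sumr; apply: eq_bigr => i _; rewrite mulr_sumr; apply: eq_bigr => j _.
by rewrite mxE cmodM exprMn.
Qed.

Lemma frob0 m k : frobenius (0 : 'M[C]_(m, k)) = 0.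
Proof. by rewrite -(scale0r 0) frobZ cmod0 mul0r. Qed.

Lemma frob_eq0 m k (A : 'M[C]_(m, k)) : frobenius A <= 0 -> A = 0.
Proof.
move=> h; apply/matrixP => i j; rewrite mxE; apply: cmod_eq0; apply/eqP.
by rewrite eq_le cmod_ge0 andbT (le_trans (cmod_le_frob A i j)).
Qed.

Lemma frobC m k (A : 'M[C]_(m, k)) : frobenius (A^t* ) = frobenius A.
Proof.
rewrite !frobeniusE exchange_big /=; congr Num.sqrt; do 2!(apply: eq_bigr => ? _).
by rewrite !mxE !cmod2E; case: (A _ _) => a b /=; rewrite sqrrN.
Qed.

Lemma cmod_sum (I : finType) (F : I -> C) : cmod (\sum_i F i) <= \sum_i cmod (F i).
Proof.
have h := ler_norm_sum (index_enum I) F xpredT.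
by move: h; rewrite normCE (eq_bigr _ (fun i _ => normCE (F i))) -rmorph_sum /= lecR.
Qed.

Lemma frobM m k l (A : 'M[C]_(m, k)) (B : 'M[C]_(k, l)) :
  frobenius (A *m B) <= (m * l * k)%:R * (frobenius A * frobenius B).
Proof.
have h0 : 0 <= k%:R * (frobenius A * frobenius B) by rewrite !mulr_ge0 ?frob_ge0.
rewrite natrM -mulrA; apply: frob_le_sum => // i j; rewrite mxE.
apply: (le_trans (cmod_sum _)).
have -> : k%:R * (frobenius A * frobenius B) = \sum_(r < k) (frobenius A * frobenius B).
  by rewrite sumr_const card_ord mulr_natl.
apply: ler_sum => r _; rewrite cmodM ler_pM ?cmod_ge0 ?cmod_le_frob //.
Qed.

Lemma mxnorm_qn m k : quasi_norm (@mxnorm R m k).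
Proof.
split => [a||a b x y|c a x]; rewrite /mxnorm ?lee_fin ?frob0 ?frob_ge0 //.
- move=> ax byy; apply: (le_trans (frobD _ _)); rewrite ler_pM2l // lerD //.
- by move=> ax; rewrite frobZ ler_wpM2l ?cmod_ge0.
Qed.

Lemma mxnorm_fin m k (A : 'M[C]_(m, k)) : (mxnorm A < +oo)%E.
Proof. exact: ltry. Qed.

Lemma mxnorm_mul m k l : bounded_by (@mxnorm R m k) (@mxnorm R k l) (@mxnorm R m l)
  (fun A B => A *m B) (m * l * k)%:R.
Proof.
move=> a b x y; rewrite /mxnorm !lee_fin => ax byy; apply: (le_trans (frobM _ _)).
by rewrite ler_wpM2l // ler_pM ?frob_ge0.
Qed.

Lemma mxnorm_uniq (V : normedModType R) m k (f : V -> 'M[C]_(m, k)) p v a b :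
  is_dirderiv (@mxnorm R m k) f p v a -> is_dirderiv (@mxnorm R m k) f p v b -> a = b.
Proof.
move=> ha hb; have [] := dderiv_uniq (mxnorm_qn m k) ha hb.
by move=> /eqP; rewrite eq_le => /andP [/frob_eq0 /eqP]; rewrite subr_eq0 => /eqP.
Qed.
End Frobenius.

(** * Smooth matrix functions *)

Section Ck.
Variables (R : realType) (V : normedModType R) (U : set V).
Local Notation C := (Cx R).
Local Notation mxn := (@mxnorm R _ _).
Hypothesis oU : open U.

Definition cont_on m l (f : V -> 'M[C]_(m, l)) :=
  forall p, U p -> null (nbhs p) (fun q => mxn (f q - f p)).

(** Products and inverses are shown to be smooth by induction on the order of
    differentiability; their derivatives along a list of directions have no
    convenient closed form. *)
Fixpoint Ck k m l (f : V -> 'M[C]_(m, l)) : Prop :=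
  cont_on f /\ if k is k'.+1 then
    exists f' : V -> V -> 'M[C]_(m, l),
      (forall v p, U p -> is_dirderiv mxn f p v (f' v p)) /\ forall v, Ck k' (f' v)
  else True.
Arguments Ck : simpl never.

Lemma CkS k m l (f : V -> 'M[C]_(m, l)) : Ck k.+1 f <-> (cont_on f /\
    exists f' : V -> V -> 'M[C]_(m, l),
      (forall v p, U p -> is_dirderiv mxn f p v (f' v p)) /\ forall v, Ck k (f' v)).
Proof. by []. Qed.

Lemma Ck0 m l (f : V -> 'M[C]_(m, l)) : Ck 0 f <-> cont_on f.
Proof. by split=> [[]|cf]. Qed.

Lemma Ck_cont k m l (f : V -> 'M[C]_(m, l)) : Ck k f -> cont_on f.
Proof. by case: k => [|k] []. Qed.

Lemma near_open p : U p -> \forall q \near p, U q.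
Proof. by move=> Up; exact: open_nbhs_nbhs. Qed.

Lemma Ck_ext k m l (f g : V -> 'M[C]_(m, l)) : (forall p, U p -> f p = g p) -> Ck k f -> Ck k g.
Proof.
move=> fg; have ct : cont_on f -> cont_on g.
  move=> cf p Up; apply: (null_near _ (cf p Up)).
  by have := near_open Up; apply: filterS => q Uq; rewrite !fg.
case: k => [|k]; first by rewrite !Ck0.
move=> /CkS [cf [f' [h1 h2]]]; apply/CkS; split; first exact: ct.
exists f'; split => [v p Up|v]; last exact: h2.
apply: (dderiv_near (mxnorm_qn R m l) _ (h1 v p Up)).
by have := near_open Up; apply: filterS => q; exact: fg.
Qed.

Lemma CkW k m l (f : V -> 'M[C]_(m, l)) : Ck k.+1 f -> Ck k f.
Proof.
elim: k m l f => [|k IH] m l f; first by move=> /CkS []; rewrite Ck0.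
move=> /CkS [cf [f' [h1 h2]]]; apply/CkS; split; first exact: cf.
by exists f'; split; [exact: h1|move=> v; exact/IH/h2].
Qed.

Lemma Ck_smooth k m l (f : V -> 'M[C]_(m, l)) : smooth_coord mxn U f -> Ck k f.
Proof.
move=> [D [D0 hD]]; apply: (Ck_ext D0).
have ct w : cont_on (D w).
  move=> p Up; have [h _] := hD w p Up.
  by apply: (iffLR (cvg_null _) h) => q; rewrite lee_fin frob_ge0.
elim: k [::] => [|k IH] w; first exact/Ck0.
by apply/CkS; split; first exact: ct; exists (fun v => D (v :: w)); split => // v p Up; have [_] := hD w p Up; exact.
Qed.

(** Directional derivatives are unique, so the chosen ones agree with those
    provided at each finite order. *)
Lemma smooth_Ck m l (f : V -> 'M[C]_(m, l)) : (forall k, Ck k f) -> smooth_coord mxn U f.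
Proof.
move=> hf.
pose D := fix D (w : seq V) : V -> 'M[C]_(m, l) :=
  if w is v :: w' then fun p => xget 0 [set d | is_dirderiv mxn (D w') p v d] else f.
have hD w : forall k, Ck k (D w).
  elim: w => [|v w IH] k //.
  have /CkS [_ [f' [h1 h2]]] := IH k.+1; apply: (Ck_ext _ (h2 v)) => p Up.
  by apply: esym; apply: xget_unique => [|y hy]; [exact: h1|exact: mxnorm_uniq hy (h1 v p Up)].
exists D; split => // w p Up; split.
  have /(_ p Up) := Ck_cont (hD w 0%N).
  by move/(cvg_null (fun q => qn_ge0 (mxnorm_qn R m l) _)).
move=> v; have /CkS [_ [f' [h1 _]]] := hD w 1%N.
by apply: (xgetPex 0); exists (f' v p); exact: h1.
Qed.

Lemma cont_on_bd m l (f : V -> 'M[C]_(m, l)) p : cont_on f -> U p ->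
  exists M : R, \forall q \near p, (mxn (f q) <= M%:E)%E.
Proof.
move=> cf Up; apply: (@null_bd _ _ _ (mxnorm_qn R m l) _ _ _ _ (fun=> f p) (cf p Up)).
by exists (frobenius (f p)); apply: nearW.
Qed.

Lemma Ck_cst k m l (a : 'M[C]_(m, l)) : Ck k (fun=> a).
Proof.
have ct (b : 'M[C]_(m, l)) : cont_on (fun=> b).
  move=> p Up; rewrite subrr; exact: (null_qn0 (mxnorm_qn R m l)).
elim: k a => [|k IH] a; first exact/Ck0.
apply/CkS; split; first exact: ct.
exists (fun _ _ => 0); split => [v p Up|v]; last exact: IH.
exact: (dderiv_cst (mxnorm_qn R m l)).
Qed.

Lemma Ck_add k m l (f g : V -> 'M[C]_(m, l)) : Ck k f -> Ck k g -> Ck k (fun q => f q + g q).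
Proof.
have ct (f1 g1 : V -> 'M[C]_(m, l)) : cont_on f1 -> cont_on g1 -> cont_on (fun q => f1 q + g1 q).
  move=> cf cg p Up; apply: (null_near _ (null_qnD (mxnorm_qn R m l) (cf p Up) (cg p Up))).
  by apply: nearW => q; rewrite opprD addrACA.
elim: k f g => [|k IH] f g; first by rewrite !Ck0; exact: ct.
move=> /CkS [cf [f' [f1 f2]]] /CkS [cg [g' [g1 g2]]].
apply/CkS; split; first exact: ct.
exists (fun v q => f' v q + g' v q); split => [v p Up|v]; last exact: IH.
by apply: (dderivD (mxnorm_qn R m l)); auto.
Qed.

Lemma cont_on_mul m l r (f : V -> 'M[C]_(m, l)) (g : V -> 'M[C]_(l, r)) :
  cont_on f -> cont_on g -> cont_on (fun q => f q *m g q).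
Proof.
move=> cf cg p Up; have K0 : 0 <= (m * r * l)%:R :> R by [].
have n1 : null (nbhs p) (fun q => mxn ((f q - f p) *m g q)).
  exact: (null_bil_l K0 (@mxnorm_mul R m l r) (cf p Up) (cont_on_bd cg Up)).
have n2 : null (nbhs p) (fun q => mxn (f p *m (g q - g p))).
  apply: (null_bil_r K0 (@mxnorm_mul R m l r) (f := fun=> f p) (cg p Up)).
  by exists (frobenius (f p)); apply: nearW.
apply: (null_near _ (null_qnD (mxnorm_qn R m r) n1 n2)).
by apply: nearW => q; rewrite mulmxBl mulmxBr addrA subrK.
Qed.

Lemma mxdderiv_mul m l r (f : V -> 'M[C]_(m, l)) (g : V -> 'M[C]_(l, r)) p v a b :
  is_dirderiv mxn f p v a -> is_dirderiv mxn g p v b ->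
  is_dirderiv mxn (fun q => f q *m g q) p v (a *m g p + f p *m b).
Proof.
have K0 : 0 <= (m * r * l)%:R :> R by [].
apply: (dderiv_bil (mxnorm_qn R m l) (mxnorm_qn R l r) (mxnorm_qn R m r) _ _ _ _ K0
  (@mxnorm_mul R m l r)); rewrite ?ltry //; move=> *;
  by rewrite ?mulmxDl ?mulmxDr -?scalemxAl -?scalemxAr.
Qed.

Lemma Ck_mul k m l r (f : V -> 'M[C]_(m, l)) (g : V -> 'M[C]_(l, r)) :
  Ck k f -> Ck k g -> Ck k (fun q => f q *m g q).
Proof.
elim: k m l r f g => [|k IH] m l r f g.
  by rewrite !Ck0; exact: cont_on_mul.
move=> cf cg; have cf' := CkW cf; have cg' := CkW cg.
move: cf cg => /CkS [cf [f' [f1 f2]]] /CkS [cg [g' [g1 g2]]].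
apply/CkS; split; first exact: cont_on_mul.
exists (fun v q => f' v q *m g q + f q *m g' v q); split => [v p Up|v]; last by apply: Ck_add; apply: IH.
by apply: mxdderiv_mul; auto.
Qed.

Lemma frob_adj_null (T : Type) (F : set_system T) m l (h : T -> 'M[C]_(m, l)) :
  null F (fun q => mxn (h q)) -> null F (fun q => mxn ((h q)^t* )).
Proof. by move=> nh e e0; have := nh e e0; congr (F _); apply/funext => t; rewrite /mxnorm frobC. Qed.

Lemma adjB m l (a b : 'M[C]_(m, l)) : (a - b)^t* = a^t* - b^t*.
Proof. by apply/matrixP => i j; rewrite !mxE rmorphB. Qed.
Lemma adjD m l (a b : 'M[C]_(m, l)) : (a + b)^t* = a^t* + b^t*.
Proof. by apply/matrixP => i j; rewrite !mxE rmorphD. Qed.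
Lemma adjZr m l (t : R) (a : 'M[C]_(m, l)) : (rcst t *: a)^t* = rcst t *: a^t*.
Proof.
by apply/matrixP => i j; rewrite !mxE rmorphM; congr (_ * _); apply/eqP; rewrite eq_complex /= oppr0 !eqxx.
Qed.

Lemma mxdderiv_adj m l (f : V -> 'M[C]_(m, l)) p v a :
  is_dirderiv mxn f p v a -> is_dirderiv mxn (fun q => (f q)^t* ) p v (a^t* ).
Proof.
move=> /(dderivP (mxnorm_qn R m l)) h; apply/(dderivP (mxnorm_qn R l m)).
apply: (null_near _ (frob_adj_null h)); apply: nearW => t.
by rewrite /diffq adjB adjZr adjB.
Qed.

Lemma Ck_adj k m l (f : V -> 'M[C]_(m, l)) : Ck k f -> Ck k (fun q => (f q)^t* ).
Proof.
have ct (f1 : V -> 'M[C]_(m, l)) : cont_on f1 -> cont_on (fun q => (f1 q)^t* ).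
  by move=> cf p Up; apply: (null_near _ (frob_adj_null (cf p Up))); apply: nearW => q; rewrite adjB.
elim: k f => [|k IH] f; first by rewrite !Ck0; exact: ct.
move=> /CkS [cf [f' [f1 f2]]]; apply/CkS; split; first exact: ct.
exists (fun v q => (f' v q)^t* ); split => [v p Up|v]; last exact: IH.
by apply: mxdderiv_adj; auto.
Qed.
End Ck.

Section Inverse.
Variables (R : realType) (V : normedModType R) (U : set V) (n : nat).
Local Notation C := (Cx R).
Local Notation mxn := (@mxnorm R _ _).
Hypothesis oU : open U.
Variable f : V -> 'M[C]_n.
Hypothesis fU : forall p, U p -> f p \in unitmx.
Local Notation g := (fun p => invmx (f p)).

Lemma invB p q : U p -> U q -> g q - g p = g q *m (f p - f q) *m g p.
Proof.
move=> Up Uq; rewrite mulmxBr mulmxBl mulVmx ?fU // mul1mx.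
by rewrite -mulmxA mulmxV ?fU // mulmx1.
Qed.

(** The product in [invB] has norm at most a quarter of the norm of g q once
    f q is close to f p, and the triangle inequality then absorbs g q. *)
Lemma inv_bd p : cont_on U f -> U p ->
  exists M : R, \forall q \near p, (mxn (g q) <= M%:E)%E.
Proof.
move=> cf Up.
have : 0 <= (n * n * n)%:R :> R by []; have X0 := frob_ge0 (g p).
have fM (A B : 'M[C]_n) := frobM A B.
set X := frobenius (g p) in X0 *; move: fM; set K : R := _%:R; clearbody K => fM K0.
(* chosen so that K^2 X d <= 1/4 *)
set d := (4 * ((K + 1) * (K + 1) * (X + 1)))^-1.
have d0 : 0 < d by rewrite invr_gt0 !mulr_gt0 // ltr_wpDl.
exists (4 * X); have := cf p Up d d0; have := near_open oU Up.
apply: filterS2 => q Uq; rewrite /mxnorm !lee_fin => fd.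
set Y := frobenius (g q).
have Y0 : 0 <= Y by exact: frob_ge0.
have h1 : Y <= 2 * (frobenius (g q *m (f p - f q) *m g p) + X).
  by have := frobD (g q - g p) (g p); rewrite subrK (invB Up Uq).
have h2 : frobenius (g q *m (f p - f q) *m g p) <= K * ((K * (Y * d)) * X).
  apply: (le_trans (fM _ _)); rewrite ler_wpM2l // ler_wpM2r //.
  apply: (le_trans (fM _ _)); rewrite ler_wpM2l // ler_wpM2l //.
  by rewrite -opprB -scaleN1r frobZ cmodN (cmod_rcst 1) normr1 mul1r.
have h3 : K * ((K * (Y * d)) * X) <= Y / 4.
  have -> : K * (K * (Y * d) * X) = Y * (K * K * X * d) by ring.
  rewrite ler_wpM2l // /d invfM mulrCA ler_piMr // ler_pdivrMr ?mul1r.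
    by apply: ler_pM; rewrite ?mulr_ge0 //; [apply: ler_pM => //|]; rewrite lerDl.
  by rewrite !mulr_gt0 // ltr_wpDl.
by lra.
Qed.

Lemma cont_on_inv : cont_on U f -> cont_on U g.
Proof.
move=> cf p Up; have K0 : 0 <= (n * n * n)%:R :> R by [].
have h : null (nbhs p) (fun q => mxn (f p - f q)).
  by apply: (null_near _ (null_qnN (mxnorm_qn R n n) (cf p Up))); apply: nearW => q; rewrite opprB.
have n1 : null (nbhs p) (fun q => mxn (g q *m (f p - f q))).
  exact: (null_bil_r K0 (@mxnorm_mul R n n n) h (inv_bd cf Up)).
have n2 : null (nbhs p) (fun q => mxn (g q *m (f p - f q) *m g p)).
  apply: (null_bil_l K0 (@mxnorm_mul R n n n) (g := fun=> g p) n1).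
  by exists (frobenius (g p)); apply: nearW.
apply: (null_near _ n2); have := near_open oU Up; apply: filterS => q Uq.
exact: invB.
Qed.

Lemma mxdderiv_inv p v a : U p -> cont_on U f -> is_dirderiv mxn f p v a ->
  is_dirderiv mxn g p v (- (g p *m a *m g p)).
Proof.
move=> Up cf ha; have K0 : 0 <= (n * n * n)%:R :> R by [].
have q := mxnorm_qn R n n.
have ng : null (0 : R)^' (fun t => mxn (g (p + t *: v) - g p)).
  by move=> e e0; have := near_line v (cont_on_inv cf Up e0).
have bg : exists M : R, \forall t \near (0 : R)^', (mxn (g (p + t *: v)%R) <= M%:E)%E.
  by have [M hM] := inv_bd cf Up; exists M; have := near_line v hM.
move/(dderivP q): ha => ha; apply/(dderivP q).
have n1 : null (0 : R)^' (fun t => mxn (g (p + t *: v) *m (- (diffq f p v t - a)) *m g p)).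
  apply: (null_bil_l K0 (@mxnorm_mul R n n n) (g := fun=> g p)); last first.
    by exists (frobenius (g p)); apply: nearW.
  by apply: (null_bil_r K0 (@mxnorm_mul R n n n) _ bg); exact: null_qnN.
have n2 : null (0 : R)^' (fun t => mxn ((g (p + t *: v) - g p) *m (- a *m g p))).
  apply: (null_bil_l K0 (@mxnorm_mul R n n n) (g := fun=> - a *m g p) ng).
  by exists (frobenius (- a *m g p)); apply: nearW.
apply: (null_near _ (null_qnD q n1 n2)).
have := near_line v (near_open oU Up); apply: filterS => t Ut.
rewrite /diffq [X in rcst _ *: X](invB Up Ut) -(opprB (f (p + t *: v)) (f p)).
set D := f (p + t *: v) - f p; set s := rcst _; set gt := invmx (f (p + _)).
have -> : gt *m (- (s *: D - a)) *m g p = - (s *: (gt *m D *m g p)) + gt *m a *m g p.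
  by rewrite mulmxN mulNmx mulmxBr mulmxBl opprB addrC -scalemxAr -scalemxAl.
have -> : (gt - g p) *m (- a *m g p) = - (gt *m a *m g p) + g p *m a *m g p.
  by rewrite mulNmx mulmxN mulmxBl opprB addrC !mulmxA.
by rewrite addrA addrK mulmxN mulNmx scalerN opprK.
Qed.

Lemma Ck_inv k : Ck U k f -> Ck U k g.
Proof.
elim: k => [|k IH]; first by rewrite !Ck0; exact: cont_on_inv.
move=> cf; have cg := IH (CkW cf).
move: cf => /CkS [cf [f' [h1 h2]]]; apply/CkS; split; first exact: cont_on_inv.
exists (fun v p => - (g p *m f' v p *m g p)); split => [v p Up|v].
  exact: mxdderiv_inv (h1 v p Up).
have := Ck_mul (Ck_cst U k (- 1%:M)) (Ck_mul (Ck_mul cg (h2 v)) cg).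
by apply: (Ck_ext oU) => p Up; rewrite mulNmx mul1mx.
Qed.

End Inverse.

Section Smooth.
Variables (R : realType) (V : normedModType R).
Local Notation C := (Cx R).
Local Notation mxn := (@mxnorm R _ _).
Implicit Types U : set V.

Lemma sm_sub (E : lmodType C) (N : E -> \bar R) U U' (f : V -> E) :
  U' `<=` U -> smooth_coord N U f -> smooth_coord N U' f.
Proof.
by move=> UU [D [h1 h2]]; exists D; split => [p /UU/h1|w p /UU/h2].
Qed.

(** This passes smoothness from the sup norm of loops to the L^2 norm and to
    operators on L^2. *)
Lemma sm_lin (E E' : lmodType C) (N : E -> \bar R) (N' : E' -> \bar R) (L : E -> E') (K : R) U (f : V -> E) :
  quasi_norm N -> (forall a, 0 <= N' a)%E -> 
  (forall c a b, L (c *: a + b) = c *: L a + L b) -> 0 <= K ->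
  (forall a (x : R), (N a <= x%:E)%E -> (N' (L a) <= (K * x)%:E)%E) ->
  smooth_coord N U f -> smooth_coord N' U (fun q => L (f q)).
Proof.
move=> qN N'0 LP K0 LK [D [h1 h2]]; exists (fun w q => L (D w q)).
have LB a b : L (a - b) = L a - L b by rewrite addrC -scaleN1r LP scaleN1r addrC.
have LZ c a : L (c *: a) = c *: L a.
  have := LP c a 0; rewrite addr0 => ->.
  have := LB 0 0; rewrite !subrr => ->; by rewrite addr0.
split=> [p /h1 -> //|w p /(h2 w) [hc hd]]; split => [|v].
  have /(cvg_null (fun q => qn_ge0 qN _)) h := hc.
  apply/(cvg_null (fun q => N'0 _)).
  have h' : null (nbhs p) (fun q => N' (L (D w q - D w p))) by apply: (null_lin K0 LK h).
  by move=> e e0; have := h' e e0; apply: filterS => q; rewrite LB.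
have := hd v; rewrite /is_dirderiv => /(cvg_null (fun q => qn_ge0 qN _)) h.
apply/(cvg_null (fun q => N'0 _)).
have h' : null (0 : R)^' (fun t => N' (L (rcst t^-1 *: (D w (p + t *: v) - D w p) - D (v :: w) p))).
  by apply: (null_lin K0 LK h).
by move=> e e0; have := h' e e0; apply: filterS => t; rewrite LB LZ LB.
Qed.

Lemma sm_add (E : lmodType C) (N : E -> \bar R) U (f g : V -> E) : quasi_norm N ->
  smooth_coord N U f -> smooth_coord N U g -> smooth_coord N U (fun q => f q + g q).
Proof.
move=> qN [D [h1 h2]] [D' [h1' h2']]; exists (fun w q => D w q + D' w q).
split => [p Up|w p Up]; first by rewrite h1 ?h1'.
have [/(cvg_null (fun q => qn_ge0 qN _)) hc hd] := h2 w p Up.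
have [/(cvg_null (fun q => qn_ge0 qN _)) hc' hd'] := h2' w p Up.
split => [|v]; last exact: dderivD.
apply/(cvg_null (fun q => qn_ge0 qN _)).
by apply: (null_near _ (null_qnD qN hc hc')); apply: nearW => q; rewrite opprD addrACA.
Qed.

Lemma sm_cst (E : lmodType C) (N : E -> \bar R) U (a : E) : quasi_norm N ->
  smooth_coord N U (fun=> a).
Proof.
move=> qN; exists (fun w q => if w is [::] then a else 0); split => // w p Up; split => [|v].
  apply/(cvg_null (fun q => qn_ge0 qN _)).
  by case: w => [|x w]; rewrite subrr; exact: null_qn0.
by case: w => [|x w]; exact: dderiv_cst.
Qed.

Lemma sm_ext (E : lmodType C) (N : E -> \bar R) U (f g : V -> E) : (forall p, U p -> f p = g p) ->
  smooth_coord N U f -> smooth_coord N U g.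
Proof. by move=> fg [D [h1 h2]]; exists D; split => // p Up; rewrite h1 // fg. Qed.

Lemma sm_mul U m l r (f : V -> 'M[C]_(m, l)) (g : V -> 'M[C]_(l, r)) : open U ->
  smooth_coord mxn U f -> smooth_coord mxn U g -> smooth_coord mxn U (fun q => f q *m g q).
Proof.
move=> oU hf hg; apply: (smooth_Ck oU) => k.
by apply: (Ck_mul); exact: (Ck_smooth oU).
Qed.

Lemma sm_adj U m l (f : V -> 'M[C]_(m, l)) : open U ->
  smooth_coord mxn U f -> smooth_coord mxn U (fun q => (f q)^t* ).
Proof.
by move=> oU hf; apply: (smooth_Ck oU) => k; apply: Ck_adj; exact: (Ck_smooth oU).
Qed.

Lemma sm_inv U n (f : V -> 'M[C]_n) : open U -> (forall p, U p -> f p \in unitmx) ->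
  smooth_coord mxn U f -> smooth_coord mxn U (fun q => invmx (f q)).
Proof.
move=> oU fU hf; apply: (smooth_Ck oU) => k; apply: (Ck_inv oU fU); exact: (Ck_smooth oU).
Qed.

Lemma sm_sum U (I : finType) (E : lmodType C) (N : E -> \bar R) (f : I -> V -> E) : quasi_norm N ->
  (forall i, smooth_coord N U (f i)) -> smooth_coord N U (fun q => \sum_i f i q).
Proof.
move=> qN h; elim: (index_enum I) => [|i s IH].
  by apply: (sm_ext (f := fun=> 0)) => [p _|]; [rewrite big_nil|exact: sm_cst].
by apply: (sm_ext (f := fun q => f i q + \sum_(j <- s) f j q)) => [p _|]; [rewrite big_cons|exact: sm_add].
Qed.

Lemma sm_snd (V' : normedModType R) (E : lmodType C) (N : E -> \bar R) U (f : V -> E) : quasi_norm N ->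
  smooth_coord N U f -> smooth_coord N [set q : V' * V | U q.2] (fun q : V' * V => f q.2).
Proof.
move=> qN [D [h1 h2]]; exists (fun w q => D (map snd w) q.2).
split => [p Up|w p Up]; first exact: h1.
have [/(cvg_null (fun q => qn_ge0 qN _)) hc hd] := h2 (map snd w) p.2 Up.
split => [|v]; last exact: hd.
apply/(cvg_null (fun q => qn_ge0 qN _)) => e e0.
exact: (cvg_snd (hc e e0)).
Qed.

Lemma sm_dd (E : lmodType C) (N : E -> \bar R) U (f : V -> E) v : quasi_norm N -> open U ->
  smooth_coord N U f -> exists df, smooth_coord N U df /\ forall p, U p -> is_dirderiv N f p v (df p).
Proof.
move=> qN oU [D [h1 h2]]; exists (D [:: v]); split.
  exists (fun w => D (w ++ [:: v])); split => // w p Up.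
  by have [a b] := h2 (w ++ [:: v]) p Up.
move=> p Up; have [_ /(_ v)] := h2 [::] p Up.
apply: dderiv_near => //; have := near_open oU Up; apply: filterS => q; exact: h1.
Qed.

Lemma sm_cont (E : lmodType C) (N : E -> \bar R) U (f : V -> E) p : quasi_norm N -> open U ->
  smooth_coord N U f -> U p -> null (nbhs p) (fun q => N (f q - f p)).
Proof.
move=> qN oU [D [h1 h2]] Up.
have [/(cvg_null (fun q => qn_ge0 qN _)) hc _] := h2 [::] p Up.
apply: (null_near _ hc); have := near_open oU Up; apply: filterS => q Uq.
by rewrite !h1.
Qed.
End Smooth.

(** * The mean value theorem and mixed derivatives *)

Section MeanValue.
Variables (R : realType) (V : normedModType R).
Local Notation C := (Cx R).
Local Notation mxn := (@mxnorm R _ _).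

(** The mean value theorem is about real functions; these functionals, among
    them the real and imaginary parts of the entries, reduce matrices to it. *)
Definition rlin m l (rho : 'M[C]_(m, l) -> R) :=
  [/\ forall A B, rho (A - B) = rho A - rho B,
      forall t A, rho (rcst t *: A) = t * rho A &
      forall A, `|rho A| <= frobenius A].

Lemma Re_le_cmod (c : C) : `|complex.Re c| <= cmod c.
Proof. by rewrite -sqrtr_sqr ler_wsqrtr // lerDl sqr_ge0. Qed.
Lemma Im_le_cmod (c : C) : `|complex.Im c| <= cmod c.
Proof. by rewrite -sqrtr_sqr ler_wsqrtr // lerDr sqr_ge0. Qed.
Lemma cmod_le_ReIm (c : C) : cmod c <= `|complex.Re c| + `|complex.Im c|.
Proof.
rewrite -(@ler_pXn2r _ 2) ?nnegrE ?cmod_ge0 ?addr_ge0 // cmod2E sqrrD.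
rewrite !real_normK ?num_real // lerD2r lerDl.
by rewrite mulrn_wge0 // mulr_ge0.
Qed.

Lemma rlin_Re m l i j : rlin (fun A : 'M[C]_(m, l) => complex.Re (A i j)).
Proof.
split => [A B|t A|A]; rewrite ?mxE.
- by case: (A i j) => a b; case: (B i j).
- by case: (A i j) => a b /=; rewrite mul0r subr0.
- exact: le_trans (Re_le_cmod _) (cmod_le_frob A i j).
Qed.
Lemma rlin_Im m l i j : rlin (fun A : 'M[C]_(m, l) => complex.Im (A i j)).
Proof.
split => [A B|t A|A]; rewrite ?mxE.
- by case: (A i j) => a b; case: (B i j).
- by case: (A i j) => a b /=; rewrite mul0r addr0.
- exact: le_trans (Im_le_cmod _) (cmod_le_frob A i j).
Qed.

Lemma frob_rlin m l (A : 'M[C]_(m, l)) x : 0 <= x -> (forall rho, rlin rho -> `|rho A| <= x) ->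
  frobenius A <= (m * l)%:R * (2 * x).
Proof.
move=> x0 h; apply: frob_le_sum => [|i j]; first by rewrite mulr_ge0.
apply: (le_trans (cmod_le_ReIm _)).
have := h _ (rlin_Re i j); have := h _ (rlin_Im i j); lra.
Qed.

Section Mean.
Variables (m l : nat) (rho : 'M[C]_(m, l) -> R) (rl : rlin rho).
Variables (f : V -> 'M[C]_(m, l)) (p v : V).

Lemma rlin_derive d s : is_dirderiv mxn f (p + s *: v) v d ->
  is_derive s 1 (fun t : R => rho (f (p + t *: v))) (rho d).
Proof.
have [rB rZ rM] := rl.
move=> /(dderivP (mxnorm_qn R m l)) h.
have hc : (fun t : R => t^-1 *: (rho (f (p + (t *: 1 + s) *: v)) - rho (f (p + s *: v)))) @ 0^' --> rho d.
  apply/cvgrPdist_le => e e0; have := h e e0; apply: filterS => t.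
  rewrite /mxnorm lee_fin => ht; rewrite distrC; apply: le_trans ht.
  apply: le_trans (rM _); rewrite rB /diffq rZ rB.
  by rewrite -[t *: 1]/(t * 1) mulr1 [t + s]addrC scalerDl addrA.
by apply: DeriveDef; [exact: cvgP hc|exact: cvg_lim hc].
Qed.

Lemma mean_value (d : R -> 'M[C]_(m, l)) t :
  (forall s, `|s| <= `|t| -> is_dirderiv mxn f (p + s *: v) v (d s)) ->
  exists2 s, `|s| <= `|t| & rho (f (p + t *: v) - f p) = t * rho (d s).
Proof.
have [rB rZ rM] := rl.
move=> h; pose g s := rho (f (p + s *: v)).
have dg (s : R) : `|s| <= `|t| -> is_derive s 1 g (rho (d s)) by move=> hs; exact: rlin_derive (h _ hs).
have cg (s : R) : `|s| <= `|t| -> {for s, continuous g}.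
  move=> hs; have [dv _] := dg s hs; apply: differentiable_continuous.
  by apply/derivable1_diffP.
have -> : rho (f (p + t *: v) - f p) = g t - g 0 by rewrite rB /g scale0r addr0.
have [t0|t0] := leP 0 t.
  have [||c ct ->] := @MVT_segment R g (rho \o d) 0 t t0.
  - move=> x; rewrite in_itv /= => /andP [x0 xt]; apply: dg.
    by rewrite !ger0_norm // ltW.
  - apply: continuous_in_subspaceT => x /[!inE] /=; rewrite in_itv /= => /andP [x0 xt].
    by apply: cg; rewrite !ger0_norm.
  - exists c; last by rewrite subr0 mulrC.
    by move: ct; rewrite in_itv /= => /andP [c0 ct]; rewrite !ger0_norm.
have [||c ct e] := @MVT_segment R g (rho \o d) t 0 (ltW t0).
- move=> x; rewrite in_itv /= => /andP [x0 xt]; apply: dg.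
  by rewrite !ltr0_norm // lerN2 ltW.
- apply: continuous_in_subspaceT => x /[!inE] /=; rewrite in_itv /= => /andP [x0 xt].
  by apply: cg; rewrite !ler0_norm ?lerN2 // ltW.
- exists c; last by rewrite -opprB e sub0r mulrN opprK mulrC.
  by move: ct; rewrite in_itv /= => /andP [c0 ct]; rewrite !ler0_norm ?lerN2 // ltW.
Qed.
End Mean.
End MeanValue.

Section MeanUse.
Variables (R : realType) (V : normedModType R).
Local Notation C := (Cx R).
Local Notation mxn := (@mxnorm R _ _).
Implicit Types U : set V.

Lemma diffq_bound m l (f : V -> 'M[C]_(m, l)) (p v : V) (d : R -> 'M[C]_(m, l)) (t e : R) :
  t != 0 -> 0 <= e ->
  (forall s, `|s| <= `|t| -> is_dirderiv mxn f (p + s *: v) v (d s)) ->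
  (forall s, `|s| <= `|t| -> frobenius (d s - d 0) <= e) ->
  frobenius (diffq f p v t - d 0) <= (m * l)%:R * (2 * e).
Proof.
move=> t0 e0 hd he; apply: frob_rlin => // rho rl; have [rB rZ rM] := rl.
have [s st h] := mean_value rl hd.
rewrite rB /diffq rZ h mulKf // -rB; exact: le_trans (rM _) (he s st).
Qed.

Lemma near_plane (p a b : V) (P : V -> Prop) : (\forall q \near p, P q) ->
  exists2 d : R, 0 < d & forall s t : R, `|s| <= d -> `|t| <= d -> P (p + s *: a + t *: b).
Proof.
move=> /nbhs_ballP [e /= e0 he].
have k0 : 0 < `|a| + `|b| + 1 by rewrite ltr_wpDl // addr_ge0.
exists (e / 2 / (`|a| + `|b| + 1)) => [|s t hs ht]; first by rewrite !divr_gt0.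
apply: he; rewrite -ball_normE /= -addrA opprD addrA subrr sub0r normrN.
apply: (le_lt_trans (ler_normD _ _)); rewrite !normrZ.
apply: (@le_lt_trans _ _ (e / 2 / (`|a| + `|b| + 1) * (`|a| + `|b|))).
  by rewrite mulrDr lerD // ler_wpM2r.
rewrite mulrAC ltr_pdivrMr //.
have -> : e / 2 * (`|a| + `|b|) = e * ((`|a| + `|b|) / 2) by rewrite -!mulrA [2^-1 * _]mulrC.
rewrite ltr_pM2l //; have := normr_ge0 a; have := normr_ge0 b; lra.
Qed.

(** A second difference over a small parallelogram equals, by the mean value
    theorem used twice, each of the mixed derivatives at some nearby point. *)
Lemma schwarz_sym U m l (f fa fb fab fba : V -> 'M[C]_(m, l)) (a b p : V) :
  open U -> U p ->
  (forall q, U q -> [/\ is_dirderiv mxn f q a (fa q), is_dirderiv mxn f q b (fb q),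
     is_dirderiv mxn fa q b (fab q) & is_dirderiv mxn fb q a (fba q)]) ->
  null (nbhs p) (fun q => mxn (fab q - fab p)) -> null (nbhs p) (fun q => mxn (fba q - fba p)) ->
  fab p = fba p.
Proof.
move=> oU Up h cab cba; apply/eqP; rewrite -subr_eq0; apply/eqP; apply: frob_eq0.
apply/ler_addgt0Pr => e e0; rewrite add0r.
(* frob_rlin costs 2 m l, and two values are compared to within e1 each *)
set e1 := e / (((m * l)%:R + 1) * 4).
have ml : 0 < (m * l)%:R + 1 :> R by rewrite ltr_wpDl.
have e10 : 0 < e1 by rewrite divr_gt0 // mulr_gt0.
have {cab cba} [d d0 hd] := near_plane a b (filterI (near_open oU Up) (filterI (cab _ e10) (cba _ e10))).
have dn s : `|s| <= `|d| -> `|s| <= d by rewrite (gtr0_norm d0).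
have d00 : `|0 : R| <= d by rewrite normr0 ltW.
have ddn : `|d| <= d by rewrite gtr0_norm.
apply: (@le_trans _ _ ((m * l)%:R * (2 * (2 * e1)))); last first.
  rewrite /e1; have -> : (m * l)%:R * (2 * (2 * (e / (((m * l)%:R + 1) * 4)))) = e * ((m * l)%:R / ((m * l)%:R + 1)) :> R.
    by field; rewrite ?lt0r_neq0 //.
  by rewrite ler_piMr // ?ler_pdivrMr ?mul1r ?lerDl // ltW.
apply: frob_rlin => [|rho rl]; first by rewrite mulr_ge0 // ltW.
have [rB rZ rM] := rl.
(* the second difference is F1 (p + d a) - F1 p = F2 (p + d b) - F2 p *)
pose F1 q := f (q + d *: b) - f q.
pose F2 q := f (q + d *: a) - f q.
have qn := mxnorm_qn R m l.
have shift (g : V -> 'M[C]_(m, l)) (w v q : V) x : is_dirderiv mxn g (q + w) v x ->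
    is_dirderiv mxn (fun q => g (q + w)) q v x.
  move=> /(dderivP qn) hx; apply/(dderivP qn).
  by apply: (null_near _ hx); apply: nearW => t; rewrite /diffq addrAC.
have subd (g g' : V -> 'M[C]_(m, l)) (q v : V) x x' : is_dirderiv mxn g q v x -> is_dirderiv mxn g' q v x' ->
    is_dirderiv mxn (fun q => g q - g' q) q v (x - x').
  move=> h1 /(dderivZ qn (-1)) h2; have := dderivD qn h1 h2; rewrite scaleN1r.
  by apply: dderiv_near => //; apply: nearW => r; rewrite scaleN1r.
have [s1 s1d e1E] : exists2 s, `|s| <= d &
    rho (F1 (p + d *: a) - F1 p) = d * rho (fa (p + s *: a + d *: b) - fa (p + s *: a)).
  have [|s hs ->] := @mean_value _ _ _ _ rho rl F1 p a
      (fun s => fa (p + s *: a + d *: b) - fa (p + s *: a)) d.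
    move=> s /dn sd; apply: subd; last first.
      by have [] := h _ (hd s 0 sd d00).1; rewrite scale0r addr0.
    by apply: shift; have [] := h _ (hd s d sd ddn).1.
  by exists s => //; exact: dn.
have [s2 s2d e2E] : exists2 t, `|t| <= d &
    rho (fa (p + s1 *: a + d *: b) - fa (p + s1 *: a)) = d * rho (fab (p + s1 *: a + t *: b)).
  have [|s hs ->] := @mean_value _ _ _ _ rho rl fa (p + s1 *: a) b
      (fun t => fab (p + s1 *: a + t *: b)) d.
    by move=> s /dn sd; have [] := h _ (hd s1 s s1d sd).1.
  by exists s => //; exact: dn.
have [s3 s3d e3E] : exists2 s, `|s| <= d &
    rho (F2 (p + d *: b) - F2 p) = d * rho (fb (p + s *: b + d *: a) - fb (p + s *: b)).
  have [|s hs ->] := @mean_value _ _ _ _ rho rl F2 p b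
      (fun s => fb (p + s *: b + d *: a) - fb (p + s *: b)) d.
    move=> s /dn sd; apply: subd; last first.
      by have [] := h _ (hd 0 s d00 sd).1; rewrite scale0r addr0.
    by apply: shift; have [] := h _ (hd d s ddn sd).1; rewrite addrAC.
  by exists s => //; exact: dn.
have [s4 s4d e4E] : exists2 t, `|t| <= d &
    rho (fb (p + s3 *: b + d *: a) - fb (p + s3 *: b)) = d * rho (fba (p + t *: a + s3 *: b)).
  have [|s hs ->] := @mean_value _ _ _ _ rho rl fb (p + s3 *: b) a
      (fun t => fba (p + t *: a + s3 *: b)) d.
    by move=> s /dn sd; have [] := h _ (hd s s3 sd s3d).1; rewrite addrAC.
  by exists s => //; exact: dn.
have key : rho (fab (p + s1 *: a + s2 *: b)) = rho (fba (p + s4 *: a + s3 *: b)).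
  have : d * (d * rho (fab (p + s1 *: a + s2 *: b))) = d * (d * rho (fba (p + s4 *: a + s3 *: b))).
    rewrite -e2E -e1E -e4E -e3E; congr rho.
    by rewrite /F1 /F2 !opprB addrACA [- f (p + d *: a) - _]addrC addrACA [p + d *: a + _]addrAC.
  by move=> /(mulfI (lt0r_neq0 d0)) /(mulfI (lt0r_neq0 d0)).
have k1 := (hd _ _ s1d s2d).2.1; have k2 := (hd _ _ s4d s3d).2.2.
have l1 := le_trans (rM _) k1; have l2 := le_trans (rM _) k2.
move: l1 l2; rewrite !rB key => l1 l2.
have -> : rho (fab p) - rho (fba p) = (rho (fba (p + s4 *: a + s3 *: b)) - rho (fba p)) -
   (rho (fba (p + s4 *: a + s3 *: b)) - rho (fab p)) by ring.
apply: (le_trans (ler_normB _ _)); move: l1 l2.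
set x := `|_|; set y := `|_|; lra.
Qed.
End MeanUse.

(** * Loops, the sup norm and joint smoothness *)

Section Circle.
Variable R : realType.
Local Notation C := (Cx R).

Lemma cisD s t : cis (s + t) = cis s * cis t :> C.
Proof. by rewrite /cis /cplx cosD sinD; apply/eqP; rewrite eq_complex /= !eqxx addrC eqxx. Qed.

Lemma circle_eq s t : (circle s = circle t :> S1 R) <-> cis s = cis t.
Proof.
split => [/(congr1 (@sval _ _)) //|h]; rewrite /circle; move: (norm_cis s) (norm_cis t); rewrite h => a b.
by congr exist; exact: bool_irrelevance.
Qed.

Lemma circle_surj (l : S1 R) : exists2 t, t \in `[0, 2 * pi] & circle t = l.
Proof.
case: l => -[x y] hl; have xy : x ^+ 2 + y ^+ 2 = 1.
  move: (hl); rewrite normCE /cmod /= => /eqP/(congr1 (@complex.Re R)) /= h.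
  by rewrite -[LHS]sqr_sqrtr ?h ?expr1n // addr_ge0 // sqr_ge0.
have x1 : -1 <= x <= 1.
  rewrite -ler_norml -(@ler_pXn2r _ 2) ?nnegrE // expr1n real_normK ?num_real //.
  by have := sqr_ge0 y; lra.
have pi0 : 0 < pi :> R by exact: pi_gt0.
have a0 : 0 <= acos x by exact: acos_ge0.
have api : acos x <= pi by exact: acos_lepi.
have cx : cos (acos x) = x by rewrite acosK // in_itv.
have sx : sin (acos x) = `|y|.
  by rewrite sin_acos // -sqrtr_sqr; congr Num.sqrt; rewrite -xy addrC addKr.
have [y0|y0] := leP 0 y.
  exists (acos x); first by rewrite in_itv /=; apply/andP; split => //; lra.
  by apply: eq_exist; rewrite /cis /cplx /= cx sx ger0_norm.
exists (2 * pi - acos x); first by rewrite in_itv /=; apply/andP; split => //; lra.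
apply: eq_exist; rewrite /cis /cplx /=.
have -> : 2 * pi - acos x = - acos x + pi *+ 2 by rewrite -[pi *+ 2]mulr_natl addrC.
by rewrite cosD2pi sinD2pi cosN sinN cx sx ltr0_norm // opprK.
Qed.

Definition arg (l : S1 R) : R := sval (cid2 (circle_surj l)).
Lemma arg_itv l : arg l \in `[0, 2 * pi].
Proof. by rewrite /arg; case: cid2. Qed.
Lemma argK l : circle (arg l) = l.
Proof. by rewrite /arg; case: cid2. Qed.

End Circle.

Section ReIm.
Variable R : realType.
Local Notation C := (Cx R).
Lemma ReD (a b : C) : complex.Re (a + b) = complex.Re a + complex.Re b.
Proof. by case: a; case: b. Qed.
Lemma ImD (a b : C) : complex.Im (a + b) = complex.Im a + complex.Im b.
Proof. by case: a; case: b. Qed.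
Lemma ReM (a b : C) : complex.Re (a * b) = complex.Re a * complex.Re b - complex.Im a * complex.Im b.
Proof. by case: a; case: b. Qed.
Lemma ImM (a b : C) : complex.Im (a * b) = complex.Re a * complex.Im b + complex.Im a * complex.Re b.
Proof. by case: a; case: b. Qed.
End ReIm.

Section SupNorm.
Variables (R : realType) (m k : nat).
Local Notation C := (Cx R).
Local Notation arc := (`[0, 2 * pi]%classic : set R).
Implicit Types A B : S1 R -> 'M[C]_(m, k).

Definition loop_meas A := forall i j,
  measurable_fun arc (fun t => complex.Re (A (circle t) i j)) /\
  measurable_fun arc (fun t => complex.Im (A (circle t) i j)).

(** Non-measurable loops have norm +oo, so that a finite sup norm implies a
    finite L^2 norm. *)
Definition supnorm A : \bar R :=
  ereal_inf [set x%:E | x in [set x : R | [/\ 0 <= x, loop_meas A &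
    forall l, frobenius (A l) <= x]]].

Lemma supnormP A (x : R) : (supnorm A <= x%:E)%E <->
  [/\ 0 <= x, loop_meas A & forall l, frobenius (A l) <= x].
Proof.
split => [h|[x0 mA hA]]; last by apply: ereal_inf_lbound; exists x.
have [y [y0 mA hA]] : [set x : R | [/\ 0 <= x, loop_meas A & forall l, frobenius (A l) <= x]] !=set0.
  apply/set0P/eqP => e; move: h; rewrite /supnorm e image_set0 ereal_inf0.
  by rewrite leye_eq.
have lb (z : R) : (forall y, 0 <= y -> (forall l, frobenius (A l) <= y) -> z <= y) -> z <= x.
  move=> hz; rewrite -lee_fin; apply: le_trans h; apply: le_ereal_inf_tmp => _ [w [w0 _ hw] <-].
  by rewrite lee_fin hz.
by split => [|//|l]; apply: lb.
Qed.

Lemma loop_measD A B : loop_meas A -> loop_meas B -> loop_meas (A + B).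
Proof.
move=> hA hB i j; have [a1 a2] := hA i j; have [b1 b2] := hB i j.
split; [have := measurable_funD a1 b1|have := measurable_funD a2 b2];
  congr (measurable_fun _ _); apply/funext => t; by rewrite !mxE ?ReD ?ImD.
Qed.

Lemma loop_measZ c A : loop_meas A -> loop_meas (c *: A).
Proof.
move=> hA i j; have [a1 a2] := hA i j.
have ct (z : R) : measurable_fun arc (fun=> z) by exact: measurable_cst.
split.
- have := measurable_funB (measurable_funM (ct (complex.Re c)) a1) (measurable_funM (ct (complex.Im c)) a2).
  by congr (measurable_fun _ _); apply/funext => t; rewrite !mxE ReM.
- have := measurable_funD (measurable_funM (ct (complex.Re c)) a2) (measurable_funM (ct (complex.Im c)) a1).
  by congr (measurable_fun _ _); apply/funext => t; rewrite !mxE ImM.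
Qed.

Lemma loop_meas0 : loop_meas 0.
Proof.
move=> i j; have ct : measurable_fun arc (fun=> 0 : R) by exact: measurable_cst.
by split; move: ct; apply: eq_measurable_fun => t _; rewrite mxE.
Qed.

Lemma supnorm_qn : quasi_norm supnorm.
Proof.
have ge0 A : (0 <= supnorm A)%E.
  by apply: le_ereal_inf_tmp => _ [w [w0 _ hw] <-]; rewrite lee_fin.
split => [//||A B x y|c A x].
- apply/eqP; rewrite eq_le ge0 andbT; apply/supnormP; split => [//||l].
    exact: loop_meas0.
  by rewrite (_ : (0 : S1 R -> 'M[C]_(m, k)) l = 0) // frob0.
- move=> /supnormP [x0 mA hA] /supnormP [y0 mB hB]; apply/supnormP; split => [||l].
  + by rewrite mulr_ge0 // addr_ge0.
  + exact: loop_measD.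
  + by apply: (le_trans (frobD _ _)); rewrite ler_pM2l // lerD.
- move=> /supnormP [x0 mA hA]; apply/supnormP; split => [||l].
  + by rewrite mulr_ge0 ?cmod_ge0.
  + exact: loop_measZ.
  + by rewrite frobZ ler_wpM2l ?cmod_ge0.
Qed.

Lemma supnorm_eval (V : normedModType R) (f : V -> S1 R -> 'M[C]_(m, k)) p v d l :
  is_dirderiv supnorm f p v d -> is_dirderiv (@mxnorm R m k) (fun q => f q l) p v (d l).
Proof.
move=> /(dderivP supnorm_qn) h; apply/(dderivP (mxnorm_qn R m k)) => e e0.
have := h e e0; apply: filterS => t /supnormP [_ _ /(_ l)].
by rewrite /mxnorm lee_fin.
Qed.

End SupNorm.

Section Joint.
Variables (R : realType) (V : normedModType R) (m k : nat) (U : set V).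
Local Notation C := (Cx R).
Local Notation mxn := (@mxnorm R _ _).
Local Notation arc := (`[0, 2 * pi]%classic : set R).
Variable Psi : S1 R -> V -> 'M[C]_(m, k).
Hypothesis oU : open U.

(** Compactness of the circle makes continuity uniform in the loop parameter,
    and [diffq_bound] does the same for difference quotients. The derivatives
    in the directions of V are periodic in that parameter, so they descend to
    the circle. *)
Lemma sm_joint :
  smooth_coord mxn [set q : R * V | U q.2] (fun q : R * V => Psi (circle q.1) q.2) ->
  smooth_coord (@supnorm R m k) U (fun p l => Psi l p).
Proof.
have qn := mxnorm_qn R m k; have qs := supnorm_qn R m k.
move=> [D [D0 hD]].
have dD w q v : U q.2 -> is_dirderiv mxn (D w) q v (D (v :: w) q).
  by move=> Uq; have [_] := hD w q Uq; exact.
have cD w q : U q.2 -> null (nbhs q) (fun q' => mxn (D w q' - D w q)).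
  move=> Uq; have [h _] := hD w q Uq.
  by apply: (iffLR (cvg_null _) h) => q'; rewrite lee_fin frob_ge0.
have nV t p : U p -> \forall q \near ((t, p) : R * V), U q.2.
  by move=> Up; exact: (@cvg_snd _ _ (nbhs t) (nbhs p) _ _ (near_open oU Up)).
have per w s t p : U p -> circle s = circle t :> S1 R -> D w (s, p) = D w (t, p).
  move=> Up st; elim: w s t p Up st => [|v w IH] s t p Up st.
    by rewrite !D0 //= st.
  apply: (mxnorm_uniq (f := fun q : R * V => D w (s + (q.1 - t), q.2)) (p := (t, p)) (v := v)).
    have := dD w (s, p) v Up => /(dderivP qn) h; apply/(dderivP qn).
    apply: (null_near _ h); apply: nearW => r; rewrite /diffq /=.
    by rewrite [t + r *: v.1]addrC addrK subrr addr0.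
  apply: (dderiv_near qn _ (dD w (t, p) v Up)).
  have := nV t p Up; apply: filterS => -[r q] /= Uq; apply: esym; apply: IH => //.
  apply/circle_eq; rewrite cisD ((circle_eq _ _).1 st) -cisD.
  by rewrite addrC subrK.
pose z (v : V) : R * V := (0, v).
pose D' (w : seq V) p : S1 R -> 'M[C]_(m, k) := fun l => D (map z w) (arg l, p).
have D'E w p t : U p -> D' w p (circle t) = D (map z w) (t, p).
  by move=> Up; apply: per => //; exact: argK.
have mD w p : U p -> loop_meas (D' w p).
  move=> Up i j.
  have ct (rho : 'M[C]_(m, k) -> R) : rlin rho -> measurable_fun arc (fun t => rho (D' w p (circle t))).
    move=> [rB _ rM]; apply: measurable_funTS; apply: continuous_measurable_fun => t.
    apply/cvgrPdist_le => e e0; have [[A B] /= [hA hB] hAB] := cD (map z w) (t, p) Up e e0.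
    move: hA; apply: filterS => t' At; have := hAB (t', p) (conj At (nbhs_singleton hB)).
    rewrite /mxnorm /= lee_fin => ht.
    by rewrite distrC !D'E // -rB; exact: le_trans (rM _) ht.
  by split; apply: (ct (fun A => _ (A i j))); [exact: rlin_Re|exact: rlin_Im].
have cD' w p : U p -> null (nbhs p) (fun q => supnorm (D' w q - D' w p)).
  move=> Up e e0.
  have /compact_near_coveringP cov : compact arc by exact: segment_compact.
  have hc (t : R) : arc t -> \forall t' \near t & q \near p, frobenius (D (map z w) (t', q) - D (map z w) (t', p)) <= e.
    move=> _; have e4 : 0 < e / 4 by rewrite divr_gt0.
    have [[A B] /= [hA hB] hAB] := cD (map z w) (t, p) Up _ e4.
    exists (A, B) => // -[t' q] /= [At Bq].
    have h1 := hAB (t', q) (conj At Bq); have h2 := hAB (t', p) (conj At (nbhs_singleton hB)).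
    rewrite -lee_fin -(subrKA (D (map z w) (t, p))); apply: (qn_D2 qn) => //.
    by rewrite -(qn_N qn) opprB.
  have h : \forall q \near p, arc `<=` (fun t => frobenius (D (map z w) (t, q) - D (map z w) (t, p)) <= e).
    exact: (cov V (nbhs p) (fun q t => frobenius (D (map z w) (t, q) - D (map z w) (t, p)) <= e) _ hc).
  have := near_open oU Up; move: h; apply: filterS2 => q hq Uq.
  apply/supnormP; split => [||l]; first exact: ltW.
  - rewrite -scaleN1r; apply: loop_measD; first exact: mD.
    by apply: loop_measZ; exact: mD.
  - by apply: hq; exact: arg_itv.
exists D'; split => [p Up|w p Up].
  by apply/funext => l; rewrite /D' /= D0 //= argK.
split => [|v]; first by apply/(cvg_null (fun q => qn_ge0 qs _)); exact: cD'.
apply/(dderivP qs) => e e0.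
(* compensates the constant of diffq_bound *)
set e1 := e / ((m * k)%:R + 1) / 2.
have mk : 0 < (m * k)%:R + 1 :> R by rewrite ltr_wpDl.
have e10 : 0 < e1 by rewrite !divr_gt0.
have [d d0 hd] := near_plane v v (filterI (near_open oU Up) (cD' (v :: w) p Up e1 e10)).
have dz : `|0 : R| <= d by rewrite normr0 ltW.
near=> t.
have t0 : t != 0 by near: t; exact: nbhs_dnbhs_neq.
have td : `|t| <= d by near: t; exact: dnbhs0_le.
have hs s : `|s| <= `|t| -> U (p + s *: v) /\ (supnorm (D' (v :: w) (p + s *: v) - D' (v :: w) p)%R <= e1%:E)%E.
  by move=> hs; have := hd s 0 (le_trans hs td) dz; rewrite scale0r addr0.
apply/supnormP; split => [||l]; first exact: ltW.
- have Ut := (hs t (lexx _)).1.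
  rewrite -scaleN1r; apply: loop_measD; last by apply: loop_measZ; exact: mD.
  apply: loop_measZ; rewrite -scaleN1r; apply: loop_measD; first exact: mD.
  by apply: loop_measZ; exact: mD.
- have zE s : (arg l, p) + s *: z v = (arg l, p + s *: v).
    by rewrite /z; congr (_, _); rewrite /= scaler0 addr0.
  have key : frobenius (diffq (D (map z w)) (arg l, p) (z v) t -
      D (map z (v :: w)) (arg l, p + 0 *: v)) <= (m * k)%:R * (2 * e1).
    apply: (@diffq_bound _ _ _ _ _ _ _ (fun s => D (map z (v :: w)) (arg l, p + s *: v))) => //.
    - exact: ltW.
    - by move=> s st; rewrite zE; apply: dD; exact: (hs s st).1.
    - by move=> s st; rewrite scale0r addr0; have /supnormP [_ _ /(_ l)] := (hs s st).2.
  move: key; rewrite scale0r addr0 /diffq zE => key.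
  rewrite [X in frobenius X](_ : _ = rcst t^-1 *: (D (map z w) (arg l, p + t *: v) -
     D (map z w) (arg l, p)) - D (map z (v :: w)) (arg l, p)) //.
  apply: (le_trans key); rewrite /e1 (_ : _ * _ = e * ((m * k)%:R / ((m * k)%:R + 1))).
    by rewrite ler_piMr ?(ltW e0) // ler_pdivrMr // mul1r lerDl.
  by field; rewrite lt0r_neq0.
Unshelve. all: by end_near. Qed.
End Joint.

(** * The L2 norm and Fourier coefficients *)

Section L2norm.
Variables (R : realType) (n : nat).
Local Notation C := (Cx R).
Local Notation mu := (@lebesgue_measure R).
Local Notation arc := (`[0, 2 * pi]%classic : set R).
Implicit Types f g : loop R n.

Lemma loop_measP f : loop_measurable f <-> loop_meas f.
Proof.
split => [h i j|h i]; last exact: h.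
by rewrite ord1; exact: h.
Qed.

Lemma measurable_arc : @measurable _ (g_sigma_algebraType R.-ocitv.-measurable) arc.
Proof. exact: measurable_itv. Qed.

Lemma measure_arc : mu arc = (2 * pi)%:E.
Proof.
rewrite lebesgue_measure_itv /= lte_fin mulr_gt0 ?pi_gt0 //.
by rewrite -EFinD subr0.
Qed.

Definition frob_sq f (t : R) : R := frobenius (f (circle t)) ^+ 2.

Lemma frob_sq_ge0 f t : 0 <= frob_sq f t. Proof. exact: sqr_ge0. Qed.

Lemma frob_sq_meas f : loop_meas f -> measurable_fun arc (frob_sq f).
Proof.
move=> h; rewrite (_ : frob_sq f = fun t => \sum_i \sum_j
   (complex.Re (f (circle t) i j) ^+ 2 + complex.Im (f (circle t) i j) ^+ 2)).
  apply: measurable_sum => i; apply: measurable_sum => j; have [h1 h2] := h i j.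
  by apply: measurable_funD; exact: measurable_funX.
apply/funext => t; rewrite /frob_sq frob2; do 2!(apply: eq_bigr => ? _).
exact: cmod2E.
Qed.

Lemma frob_meas f : loop_meas f -> measurable_fun arc (fun t => frobenius (f (circle t))).
Proof.
move=> h; rewrite (_ : (fun t => _) = Num.sqrt \o frob_sq f).
  apply: measurableT_comp; last exact: frob_sq_meas.
  by apply: continuous_measurable_fun; exact: sqrt_continuous.
by apply/funext => t /=; rewrite /frob_sq sqrtr_sqr ger0_norm // frob_ge0.
Qed.

Definition sqint f : \bar R := (\int[mu]_(t in arc) (frob_sq f t)%:E)%E.

Lemma sqint_ge0 f : (0 <= sqint f)%E.
Proof. by apply: integral_ge0 => t _; rewrite lee_fin frob_sq_ge0. Qed.

Lemma l2normP f (x : R) : (l2norm f <= x%:E)%E <->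
  [/\ 0 <= x, loop_meas f & (sqint f <= (x ^+ 2)%:E)%E].
Proof.
rewrite /l2norm; case: asboolP => [/loop_measP mf|nf]; last first.
  by rewrite leye_eq; split => // -[_ /loop_measP].
rewrite -/(sqint f); have J0 := sqint_ge0 f.
have e (y : R) : 0 <= y -> (sqrte (sqint f) <= y%:E)%E = (sqint f <= (y ^+ 2)%:E)%E.
  move=> y0; rewrite -[in RHS]lee_sqrt; last by rewrite lee_fin sqr_ge0.
  by rewrite /= sqrtr_sqr ger0_norm.
split => [h|[x0 _ h]]; last by rewrite e.
have x0 : 0 <= x by rewrite -lee_fin; apply: le_trans h; exact: sqrte_ge0.
by split => //; rewrite -e.
Qed.

Lemma l2norm_ge0 f : (0 <= l2norm f)%E.
Proof. by rewrite /l2norm; case: asboolP => // _; exact: sqrte_ge0. Qed.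

Lemma l2norm_qn : quasi_norm (@l2norm R n).
Proof.
split => [|||c f x].
- exact: l2norm_ge0.
- apply/eqP; rewrite eq_le l2norm_ge0 andbT; apply/l2normP; split => //.
  rewrite /sqint (_ : (fun t => _) = cst 0%E) ?integral_cst ?mul0e ?expr0n //.
  by apply/funext => t; rewrite /frob_sq (_ : (0 : loop R n) _ = 0) // frob0 expr0n.
- move=> f g x y /l2normP [x0 mf hf] /l2normP [y0 mg hg]; apply/l2normP; split.
  + by rewrite mulr_ge0 // addr_ge0.
  + exact: loop_measD.
  + have mfg := loop_measD mf mg.
    have m1 := frob_sq_meas mf; have m2 := frob_sq_meas mg; have m3 := frob_sq_meas mfg.
    apply: (@le_trans _ _ (\int[mu]_(t in arc) (2%:E * ((frob_sq f t)%:E + (frob_sq g t)%:E)))%E).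
      apply: ge0_le_integral => //.
      * by move=> t _; rewrite lee_fin frob_sq_ge0.
      * exact/measurable_EFinP.
      * rewrite (_ : (fun t => _) = EFin \o (fun t => 2 * (frob_sq f t + frob_sq g t))).
          apply/measurable_EFinP; apply: measurable_funM; first exact: measurable_cst.
          exact: measurable_funD.
        by apply/funext => t; rewrite /= EFinM EFinD.
      * move=> t _; rewrite -EFinD -EFinM lee_fin /frob_sq.
        rewrite !frob2 -big_split /= mulr_sumr; apply: ler_sum => i _.
        rewrite -big_split /= mulr_sumr; apply: ler_sum => j _.
        by rewrite mxE cmodD2.
    rewrite ge0_integralZl_EFin //; last 2 first.
    * by move=> t _; rewrite -EFinD lee_fin addr_ge0 // frob_sq_ge0.
    * rewrite (_ : (fun t => _) = EFin \o (fun t => frob_sq f t + frob_sq g t)).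
        by apply/measurable_EFinP; exact: measurable_funD.
      by apply/funext => t; rewrite /= EFinD.
    rewrite ge0_integralD //; last 4 first.
    * by move=> t _; rewrite lee_fin frob_sq_ge0.
    * exact/measurable_EFinP.
    * by move=> t _; rewrite lee_fin frob_sq_ge0.
    * exact/measurable_EFinP.
    apply: (@le_trans _ _ (2%:E * ((x ^+ 2)%:E + (y ^+ 2)%:E))%E).
      by rewrite lee_pmul2l // leeD.
    by rewrite -EFinD -EFinM lee_fin; nra.
- move=> /l2normP [x0 mf hf]; apply/l2normP; split.
  + by rewrite mulr_ge0 ?cmod_ge0.
  + exact: loop_measZ.
  + have m1 := frob_sq_meas mf.
    rewrite /sqint (_ : (fun t => _) = fun t => ((cmod c ^+ 2)%:E * (frob_sq f t)%:E)%E).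
      rewrite ge0_integralZl_EFin ?sqr_ge0 //; last 2 first.
      * by move=> t _; rewrite lee_fin frob_sq_ge0.
      * exact/measurable_EFinP.
      by rewrite exprMn [leRHS]EFinM lee_wpmul2l // lee_fin sqr_ge0.
    by apply/funext => t; rewrite -EFinM /frob_sq -exprMn -frobZ.
Qed.

Lemma l2norm_pointwise f g (K x : R) : loop_meas g -> 0 <= K ->
  (forall l, frobenius (g l) <= K * frobenius (f l)) ->
  (l2norm f <= x%:E)%E -> (l2norm g <= (K * x)%:E)%E.
Proof.
move=> mg K0 fg /l2normP [x0 mf hf]; apply/l2normP; split => //; first exact: mulr_ge0.
have m1 := frob_sq_meas mf; have m2 := frob_sq_meas mg.
apply: (@le_trans _ _ (\int[mu]_(t in arc) ((K ^+ 2)%:E * (frob_sq f t)%:E))%E).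
  apply: ge0_le_integral => //.
  - by move=> t _; rewrite lee_fin frob_sq_ge0.
  - exact/measurable_EFinP.
  - rewrite (_ : (fun t => _) = EFin \o (fun t => K ^+ 2 * frob_sq f t)).
      by apply/measurable_EFinP; apply: measurable_funM => //; exact: measurable_cst.
    by apply/funext => t; rewrite /= EFinM.
  - move=> t _; rewrite -EFinM lee_fin /frob_sq -exprMn ler_pXn2r ?nnegrE ?mulr_ge0 ?frob_ge0 //.
rewrite ge0_integralZl_EFin ?sqr_ge0 //; last 2 first.
- by move=> t _; rewrite lee_fin frob_sq_ge0.
- exact/measurable_EFinP.
by rewrite exprMn [leRHS]EFinM lee_wpmul2l // lee_fin sqr_ge0.
Qed.

Lemma l2norm_sup f (x : R) : (supnorm f <= x%:E)%E -> (l2norm f <= ((2 * pi + 1) * x)%:E)%E.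
Proof.
move=> /supnormP [x0 mf hf]; apply/l2normP.
have p0 := pi_gt0 R; split => //.
  by rewrite mulr_ge0 // addr_ge0 // mulr_ge0 // ltW.
have m1 := frob_sq_meas mf.
apply: (@le_trans _ _ (\int[mu]_(t in arc) (cst (x ^+ 2)%:E t))%E).
  apply: ge0_le_integral => //.
  - by move=> t _; rewrite lee_fin frob_sq_ge0.
  - exact/measurable_EFinP.
  - by move=> t _; rewrite lee_fin /frob_sq ler_pXn2r ?nnegrE ?frob_ge0.
rewrite integral_cst //= [X in (_ * X)%E]measure_arc -EFinM lee_fin exprMn mulrC ler_wpM2r ?sqr_ge0 //.
nra.
Qed.

Lemma loop_meas_mul m k r (A : S1 R -> 'M[C]_(m, k)) (B : S1 R -> 'M[C]_(k, r)) :
  loop_meas A -> loop_meas B -> loop_meas (fun l => A l *m B l).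
Proof.
move=> mA mB i j; split.
- rewrite (_ : (fun t => _) = fun t => \sum_s
    (complex.Re (A (circle t) i s) * complex.Re (B (circle t) s j) -
     complex.Im (A (circle t) i s) * complex.Im (B (circle t) s j))).
    apply: measurable_sum => s; have [a1 a2] := mA i s; have [b1 b2] := mB s j.
    by apply: measurable_funB; exact: measurable_funM.
  apply/funext => t; rewrite mxE (big_morph _ (@ReD _) (erefl _)).
  by apply: eq_bigr => s _; rewrite ReM.
- rewrite (_ : (fun t => _) = fun t => \sum_s
    (complex.Re (A (circle t) i s) * complex.Im (B (circle t) s j) +
     complex.Im (A (circle t) i s) * complex.Re (B (circle t) s j))).
    apply: measurable_sum => s; have [a1 a2] := mA i s; have [b1 b2] := mB s j.
    by apply: measurable_funD; exact: measurable_funM.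
  apply/funext => t; rewrite mxE (big_morph _ (@ImD _) (erefl _)).
  by apply: eq_bigr => s _; rewrite ImM.
Qed.

Lemma l2norm_mul : bounded_by (@supnorm R n n) (@l2norm R n) (@l2norm R n)
  (fun A f l => A l *m f l) (n * 1 * n)%:R.
Proof.
move=> A f x y /supnormP [x0 mA hA] hf; rewrite mulrA.
have [y0 mf _] := (l2normP _ _).1 hf.
apply: l2norm_pointwise hf => [||l].
- exact: loop_meas_mul.
- by rewrite mulr_ge0.
- apply: (le_trans (frobM _ _)); rewrite -mulrA ler_wpM2l // ler_wpM2r ?frob_ge0 //.
Qed.

End L2norm.

Section Fourier.
Variable R : realType.
Local Notation C := (Cx R).
Local Notation mu := (@lebesgue_measure R).
Local Notation arc := (`[0, 2 * pi]%classic : set R).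

Lemma cisX (t : R) (j : nat) : cis t ^+ j = cis (j%:R * t) :> C.
Proof.
elim: j => [|j IH]; first by rewrite expr0 mul0r /cis cos0 sin0.
by rewrite exprS IH -cisD -[j.+1%:R]natr1 mulrDl mul1r addrC.
Qed.

Lemma cis_neq0 t : cis t != 0 :> C.
Proof. by rewrite -normr_gt0 (eqP (norm_cis t)). Qed.

Lemma cisN t : cis (- t) = (cis t)^-1 :> C.
Proof.
apply: (mulfI (cis_neq0 t)); rewrite divff ?cis_neq0 // -cisD subrr.
by rewrite /cis cos0 sin0.
Qed.

Lemma cisz (t : R) (j : int) : cis t ^ j = cis (j%:~R * t) :> C.
Proof.
case: j => j; first by rewrite -exprnP cisX.
by rewrite NegzE -exprnN cisX -cisN -mulNr mulrNz.
Qed.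

Lemma cmod_cis t : cmod (cis t : C) = 1.
Proof. by rewrite /cmod /= cos2Dsin2 sqrtr1. Qed.

Definition cint (h : R -> C) :=
  mu.-integrable arc (EFin \o (fun t => complex.Re (h t))) /\
  mu.-integrable arc (EFin \o (fun t => complex.Im (h t))).

Lemma cintD h k : cint h -> cint k -> cint (fun t => h t + k t).
Proof.
move=> [h1 h2] [k1 k2]; split.
- rewrite (_ : _ \o _ = ((EFin \o (fun t => complex.Re (h t))) \+ (EFin \o (fun t => complex.Re (k t))))%E).
    exact: (integrableD (@measurable_arc R) h1 k1).
  by apply/funext => t; rewrite /= ReD.
- rewrite (_ : _ \o _ = ((EFin \o (fun t => complex.Im (h t))) \+ (EFin \o (fun t => complex.Im (k t))))%E).
    exact: (integrableD (@measurable_arc R) h2 k2).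
  by apply/funext => t; rewrite /= ImD.
Qed.

Lemma integrable_comb (a b : R) (u v : R -> R) :
  mu.-integrable arc (EFin \o u) -> mu.-integrable arc (EFin \o v) ->
  mu.-integrable arc (EFin \o (fun t => a * u t + b * v t)).
Proof.
move=> hu hv.
rewrite (_ : _ \o _ = ((fun t => a%:E * (EFin \o u) t) \+ (fun t => b%:E * (EFin \o v) t))%E).
  by apply: (integrableD (@measurable_arc R)); apply: (integrableZl (@measurable_arc R)).
by apply/funext => t.
Qed.

Lemma Rintegral_comb (a b : R) (u v : R -> R) :
  mu.-integrable arc (EFin \o u) -> mu.-integrable arc (EFin \o v) ->
  Rintegral mu arc (fun t => a * u t + b * v t) = a * Rintegral mu arc u + b * Rintegral mu arc v.
Proof.
move=> hu hv; have h1 : mu.-integrable arc (EFin \o (fun t => a * u t)).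
  by have := integrable_comb a 0 hu hv; congr (integrable _ _ _); apply/funext => t /=; rewrite mul0r addr0.
have h2 : mu.-integrable arc (EFin \o (fun t => b * v t)).
  by have := integrable_comb 0 b hu hv; congr (integrable _ _ _); apply/funext => t /=; rewrite mul0r add0r.
by rewrite (RintegralD (@measurable_arc R)) // !(RintegralZl _ (@measurable_arc R)).
Qed.

Lemma cintZ c h : cint h -> cint (fun t => c * h t).
Proof.
move=> [h1 h2]; split.
- have := integrable_comb (complex.Re c) (- complex.Im c) h1 h2.
  by congr (integrable _ _ _); apply/funext => t /=; rewrite ReM mulNr.
- have := integrable_comb (complex.Re c) (complex.Im c) h2 h1.
  by congr (integrable _ _ _); apply/funext => t /=; rewrite ImM.
Qed.

Lemma cintegralD h k : cint h -> cint k -> cintegral (fun t => h t + k t) = cintegral h + cintegral k.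
Proof.
move=> [h1 h2] [k1 k2]; apply/eqP; rewrite eq_complex ReD ImD /=; apply/andP; split; apply/eqP.
- rewrite -(mul1r (Rintegral mu _ (fun t => complex.Re (h t)))) -(mul1r (Rintegral mu _ (fun t => complex.Re (k t)))).
  rewrite -Rintegral_comb //; congr Rintegral; apply/funext => t; by rewrite !mul1r ReD.
- rewrite -(mul1r (Rintegral mu _ (fun t => complex.Im (h t)))) -(mul1r (Rintegral mu _ (fun t => complex.Im (k t)))).
  rewrite -Rintegral_comb //; congr Rintegral; apply/funext => t; by rewrite !mul1r ImD.
Qed.

Lemma cintegralZ c h : cint h -> cintegral (fun t => c * h t) = c * cintegral h.
Proof.
move=> [h1 h2]; apply/eqP; rewrite eq_complex ReM ImM /=; apply/andP; split; apply/eqP.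
- rewrite -mulNr -Rintegral_comb //; congr Rintegral; apply/funext => t; by rewrite ReM mulNr.
- rewrite -Rintegral_comb //; congr Rintegral; apply/funext => t; by rewrite ImM.
Qed.
End Fourier.

Section FourierL2.
Variables (R : realType) (n : nat).
Local Notation C := (Cx R).
Local Notation mu := (@lebesgue_measure R).
Local Notation arc := (`[0, 2 * pi]%classic : set R).
Implicit Types f g : loop R n.
Local Notation marc := (@measurable_arc R).

Lemma cis_meas (j : int) : measurable_fun arc (fun t => complex.Re (cis t ^ j : C)) /\
  measurable_fun arc (fun t => complex.Im (cis t ^ j : C)).
Proof.
have ct : continuous (fun t : R => j%:~R * t).
  by move=> t; apply: cvgM; [exact: cvg_cst|exact: cvg_id].
split; apply: measurable_funTS; apply: continuous_measurable_fun.
- rewrite (_ : (fun t => _) = cos \o (fun t : R => j%:~R * t)); last by apply/funext => t; rewrite cisz.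
  by move=> t; apply: continuous_comp; [exact: ct|exact: continuous_cos].
- rewrite (_ : (fun t => _) = sin \o (fun t : R => j%:~R * t)); last by apply/funext => t; rewrite cisz.
  by move=> t; apply: continuous_comp; [exact: ct|exact: continuous_sin].
Qed.

Lemma L2P f : L2 f <-> exists x : R, (l2norm f <= x%:E)%E.
Proof.
rewrite /L2 /=; split => [h|[x h]]; last by apply: le_lt_trans h (ltry _).
by have [M _ hM] := qn_finP (l2norm_qn R n) h; exists M.
Qed.

Lemma cst_integrable_arc (c : R) : mu.-integrable arc (EFin \o cst c).
Proof.
apply: (measurable_bounded_integrable marc); first by rewrite [X in (X < _)%E]measure_arc ltry.
  exact: measurable_cst.
exists `|c|; split; first exact: num_real.
by move=> x cx t _; apply: ltW; apply: le_lt_trans cx.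
Qed.

Lemma frob_integrable f : L2 f -> mu.-integrable arc (EFin \o (fun t => frobenius (f (circle t)))).
Proof.
move=> /L2P [x /l2normP [x0 mf hf]].
have h2 : mu.-integrable arc (EFin \o frob_sq f).
  apply/integrableP; split; first by apply/measurable_EFinP; exact: frob_sq_meas.
  under eq_integral do rewrite /= ger0_norm ?frob_sq_ge0 //.
  by apply: le_lt_trans hf (ltry _).
have h1 : mu.-integrable arc (EFin \o cst (1 : R)).
  exact: cst_integrable_arc.
apply: (le_integrable marc (g := EFin \o (fun t => 1 * cst (1 : R) t + 1 * frob_sq f t))).
- by apply/measurable_EFinP; exact: frob_meas.
- move=> t _; rewrite /= lee_fin !mul1r /frob_sq.
  have := frob_ge0 (f (circle t)); set a := frobenius _ => a0.
  rewrite !ger0_norm ?addr_ge0 ?sqr_ge0 //.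
  have := sqr_ge0 (a - 1); nra.
- exact: integrable_comb.
Qed.

Definition fint f (k : int) (i : 'I_n) (t : R) : C := f (circle t) i 0 * cis t ^ (- k).

Lemma cmod_fint f k i t : cmod (fint f k i t) <= frobenius (f (circle t)).
Proof. by rewrite /fint cisz cmodM cmod_cis mulr1 cmod_le_frob. Qed.

Lemma fint_cint f k i : L2 f -> cint (fint f k i).
Proof.
move=> hf; have [x /l2normP [x0 mf _]] := (L2P f).1 hf.
have hi := frob_integrable hf; have [m1 m2] := mf i 0; have [c1 c2] := cis_meas (- k).
have ge t : `|frobenius (f (circle t))| = frobenius (f (circle t)) by rewrite ger0_norm ?frob_ge0.
split; apply: (le_integrable marc _ _ hi) => /=.
- apply/measurable_EFinP; rewrite (_ : (fun t => _) = fun t =>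
     complex.Re (f (circle t) i 0) * complex.Re (cis t ^ (- k) : C) -
     complex.Im (f (circle t) i 0) * complex.Im (cis t ^ (- k) : C)).
    by apply: measurable_funB; exact: measurable_funM.
  by apply/funext => t; rewrite /fint ReM.
- move=> t _; rewrite /= lee_fin ge; exact: le_trans (Re_le_cmod _) (cmod_fint _ _ _ _).
- apply/measurable_EFinP; rewrite (_ : (fun t => _) = fun t =>
     complex.Re (f (circle t) i 0) * complex.Im (cis t ^ (- k) : C) +
     complex.Im (f (circle t) i 0) * complex.Re (cis t ^ (- k) : C)).
    by apply: measurable_funD; exact: measurable_funM.
  by apply/funext => t; rewrite /fint ImM.
- move=> t _; rewrite /= lee_fin ge; exact: le_trans (Im_le_cmod _) (cmod_fint _ _ _ _).
Qed.

Lemma fourierE f k i : fourier f k i 0 = rcst (2 * pi)^-1 * cintegral (fint f k i).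
Proof. by rewrite mxE. Qed.

Lemma fourierP (c : C) f g k : L2 f -> L2 g ->
  fourier (c *: f + g) k = c *: fourier f k + fourier g k.
Proof.
move=> hf hg; apply/matrixP => i j; rewrite ord1 !mxE mulrCA -mulrDr -(cintegralZ c (fint_cint k i hf)).
rewrite -cintegralD; [|by apply: cintZ; exact: (fint_cint k i hf)|exact: (fint_cint k i hg)].
congr (_ * cintegral _); apply/funext => t.
by rewrite /fint !mxE mulrDl mulrA.
Qed.

(** The inequality a <= x + a^2 / x replaces the Cauchy-Schwarz inequality. *)
Lemma int_frob_le f (x : R) : 0 < x -> (l2norm f <= x%:E)%E ->
  Rintegral mu arc (fun t => frobenius (f (circle t))) <= (2 * pi + 1) * x.
Proof.
move=> x0 hx; have hf : L2 f by apply/L2P; exists x.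
have /l2normP [_ mf hJ] := hx.
have h2 : mu.-integrable arc (EFin \o frob_sq f).
  apply/integrableP; split; first by apply/measurable_EFinP; exact: frob_sq_meas.
  under eq_integral do rewrite /= ger0_norm ?frob_sq_ge0 //.
  by apply: le_lt_trans hJ (ltry _).
have h1 : mu.-integrable arc (EFin \o cst (1 : R)).
  exact: cst_integrable_arc.
apply: (@le_trans _ _ (Rintegral mu arc (fun t => x * cst (1 : R) t + x^-1 * frob_sq f t))).
  apply: (le_Rintegral marc) => [||t _]; [exact: frob_integrable|exact: integrable_comb|].
  rewrite /frob_sq /= mulr1; set a := frobenius _.
  rewrite -(ler_pM2l x0) mulrDr mulVKf ?lt0r_neq0 //.
  have a0 : 0 <= a by exact: frob_ge0.
  have := sqr_ge0 (a - x); have := sqr_ge0 a; nra.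
rewrite Rintegral_comb // Rintegral_cst ?mul1r; last exact: marc.
have -> : (2 * pi + 1) * x = x * (2 * pi) + x by ring.
rewrite [X in fine X]measure_arc /= lerD2l mulrC ler_pdivrMr //.
rewrite -lee_fin /Rintegral fineK ?expr2 // ge0_fin_numE; first exact: le_lt_trans hJ (ltry _).
exact: sqint_ge0.
Qed.

Definition fourier_const : R := (n * 1)%:R * (2 * (2 * pi + 1)).
Lemma fourier_const_ge0 : 0 <= fourier_const.
Proof. by rewrite /fourier_const !mulr_ge0 // addr_ge0 // mulr_ge0 // pi_ge0. Qed.

Lemma fourier_bound f k (x : R) : (l2norm f <= x%:E)%E -> frobenius (fourier f k) <= fourier_const * x.
Proof.
have pos (y : R) : 0 < y -> (l2norm f <= y%:E)%E -> frobenius (fourier f k) <= fourier_const * y.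
  move=> y0 hy; have hf : L2 f by apply/L2P; exists y.
  rewrite /fourier_const -mulrA; apply: frob_le_sum => [|i j].
    by rewrite !mulr_ge0 ?(ltW y0) // addr_ge0 // mulr_ge0 // pi_ge0.
  rewrite ord1 fourierE cmodM cmod_rcst.
  have [i1 i2] := fint_cint k i hf.
  have hb : cmod (cintegral (fint f k i)) <= 2 * ((2 * pi + 1) * y).
    have b1 : `|Rintegral mu arc (fun t => complex.Re (fint f k i t))| <= (2 * pi + 1) * y.
      apply: (le_trans (le_normr_Rintegral marc i1)); apply: (le_trans _ (int_frob_le y0 hy)).
      apply: (le_Rintegral marc); [exact: (integrable_abse i1)|exact: frob_integrable|].
      by move=> t _; exact: le_trans (Re_le_cmod _) (cmod_fint _ _ _ _).
    have b2 : `|Rintegral mu arc (fun t => complex.Im (fint f k i t))| <= (2 * pi + 1) * y.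
      apply: (le_trans (le_normr_Rintegral marc i2)); apply: (le_trans _ (int_frob_le y0 hy)).
      apply: (le_Rintegral marc); [exact: (integrable_abse i2)|exact: frob_integrable|].
      by move=> t _; exact: le_trans (Im_le_cmod _) (cmod_fint _ _ _ _).
    apply: (le_trans (cmod_le_ReIm _)); apply: (le_trans (lerD b1 b2)).
    by set z := (2 * pi + 1) * y; lra.
  rewrite -mulrA; apply: le_trans hb; rewrite ler_piMl ?cmod_ge0 // ger0_norm ?invr_ge0 ?mulr_ge0 ?pi_ge0 //.
  rewrite invf_le1 ?mulr_gt0 ?pi_gt0 //; have := @pi_ge2 R; lra.
move=> hx; have /l2normP [x0 _ _] := hx.
move: x0; rewrite le_eqVlt => /orP [/eqP x0|x0]; last exact: pos.
rewrite -x0 mulr0; apply/ler_addgt0Pr => e e0; rewrite add0r.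
have d0 : 0 < fourier_const + 1 by rewrite ltr_wpDl // fourier_const_ge0.
apply: (le_trans (pos (e / (fourier_const + 1)) _ _)); first by rewrite divr_gt0.
  by apply: (le_trans hx); rewrite -x0 lee_fin divr_ge0 // ltW.
by rewrite mulrA ler_pdivrMr // mulrC ler_pM2l // lerDl.
Qed.

End FourierL2.

Section FourierRules.
Variables (R : realType) (n : nat).
Local Notation C := (Cx R).
Local Notation mu := (@lebesgue_measure R).
Local Notation arc := (`[0, 2 * pi]%classic : set R).
Implicit Types f g : loop R n.

Lemma L2_comb (c : C) f g : L2 f -> L2 g -> L2 (c *: f + g).
Proof.
move=> hf hg; apply: (qn_fin (l2norm_qn R n)) => //.
exact: (qn_finZ (l2norm_qn R n)).
Qed.

Lemma L2D f g : L2 f -> L2 g -> L2 (f + g).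
Proof. exact: (qn_fin (l2norm_qn R n)). Qed.
Lemma L2Z c f : L2 f -> L2 (c *: f).
Proof. exact: (qn_finZ (l2norm_qn R n)). Qed.
Lemma L2_0 : L2 (0 : loop R n).
Proof. by rewrite /L2 /= (qn_0 (l2norm_qn R n)) ltry. Qed.
Lemma L2N f : L2 f -> L2 (- f).
Proof. by rewrite -scaleN1r; exact: L2Z. Qed.
Lemma L2B f g : L2 f -> L2 g -> L2 (f - g).
Proof. by move=> hf /L2N; exact: L2D. Qed.
Lemma L2_eq f g : l2eq f g -> L2 g -> L2 f.
Proof.
move=> e hg; rewrite -(subrK g f); apply: L2D => //.
by rewrite /L2 /= e ltry.
Qed.
Lemma l2eq_sym f g : l2eq f g -> l2eq g f.
Proof. by rewrite /l2eq -(qn_N (l2norm_qn R n)) opprB. Qed.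
Lemma l2eq_refl f : l2eq f f.
Proof. by rewrite /l2eq subrr (qn_0 (l2norm_qn R n)). Qed.
Lemma l2norm0P f : l2norm f = 0%E <-> (l2norm f <= 0%:E)%E.
Proof.
split => [->//|h]; apply/eqP; rewrite eq_le h; exact: (qn_ge0 (l2norm_qn R n)).
Qed.
Lemma l2eq_trans f g h : l2eq f g -> l2eq g h -> l2eq f h.
Proof.
move=> /l2norm0P a /l2norm0P b; apply/l2norm0P.
by have := qn_D (l2norm_qn R n) a b; rewrite addr0 mulr0 subrKA.
Qed.

Lemma fourierD f g k : L2 f -> L2 g -> fourier (f + g) k = fourier f k + fourier g k.
Proof. by move=> hf hg; have := @fourierP R n 1 f g k hf hg; rewrite !scale1r. Qed.
Lemma fourier0 k : fourier (0 : loop R n) k = 0.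
Proof.
have := fourierD k L2_0 L2_0; rewrite addr0 => /eqP.
by rewrite -subr_eq0 opprD addrA subrr add0r oppr_eq0 => /eqP.
Qed.
Lemma fourierZ c f k : L2 f -> fourier (c *: f) k = c *: fourier f k.
Proof. by move=> hf; rewrite -[c *: f]addr0 fourierP ?fourier0 ?addr0 //; exact: L2_0. Qed.
Lemma fourierN f k : L2 f -> fourier (- f) k = - fourier f k.
Proof. by move=> hf; rewrite -scaleN1r fourierZ // scaleN1r. Qed.
Lemma fourierB f g k : L2 f -> L2 g -> fourier (f - g) k = fourier f k - fourier g k.
Proof. by move=> hf hg; rewrite fourierD ?fourierN //; exact: L2N. Qed.
Lemma fourier_sum (I : finType) (F : I -> loop R n) k : (forall i, L2 (F i)) ->
  L2 (\sum_i F i) /\ fourier (\sum_i F i) k = \sum_i fourier (F i) k.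
Proof.
move=> h; elim: (index_enum I) => [|i s [IH1 IH2]].
  by rewrite !big_nil; split; [exact: L2_0|exact: fourier0].
by rewrite !big_cons; split; [exact: L2D|rewrite fourierD // IH2].
Qed.

Lemma fourier_l2eq f g k : L2 g -> l2eq f g -> fourier f k = fourier g k.
Proof.
move=> hg e; have hf := L2_eq e hg.
apply/eqP; rewrite -subr_eq0 -fourierB //; apply/eqP; apply: frob_eq0.
have := @fourier_bound R n (f - g) k 0; rewrite mulr0; apply.
by rewrite (e : l2norm _ = 0%E).
Qed.

Lemma lpow_meas (m : int) : loop_meas (fun l : S1 R => (sval l ^ m)%:M : 'M[C]_n).
Proof.
move=> i j; have [c1 c2] := @cis_meas R m.
have z : measurable_fun arc (fun=> 0 : R) by exact: measurable_cst.
split.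
- rewrite (_ : (fun t => _) = if i == j then (fun t => complex.Re (cis t ^ m : C)) else fun=> 0).
    by case: ifP.
  by apply/funext => t; rewrite mxE; case: (i == j).
- rewrite (_ : (fun t => _) = if i == j then (fun t => complex.Im (cis t ^ m : C)) else fun=> 0).
    by case: ifP.
  by apply/funext => t; rewrite mxE; case: (i == j).
Qed.

Definition lshift (m : int) f : loop R n := fun l => (sval l) ^ m *: f l.

Lemma cmod_lpow (l : S1 R) (m : int) : cmod (sval l ^ m) = 1.
Proof. by rewrite -(argK l) /= cisz cmod_cis. Qed.

Lemma sval_neq0 (l : S1 R) : sval l != 0.
Proof. by rewrite -(argK l) /= cis_neq0. Qed.

Lemma lshift_meas m f : loop_meas f -> loop_meas (lshift m f).
Proof.
move=> mf; have := loop_meas_mul (lpow_meas m) mf.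
by congr loop_meas; apply/funext => l; rewrite /lshift mul_scalar_mx.
Qed.

Lemma l2norm_shift m f (x : R) : (l2norm f <= x%:E)%E -> (l2norm (lshift m f) <= x%:E)%E.
Proof.
move=> hf; rewrite -(mul1r x); have [_ mf _] := (l2normP _ _).1 hf.
apply: l2norm_pointwise hf => // [|l]; first exact: lshift_meas.
by rewrite /lshift frobZ cmod_lpow.
Qed.

Lemma L2_shift m f : L2 f -> L2 (lshift m f).
Proof. by move=> /L2P [x /(l2norm_shift m) h]; apply/L2P; exists x. Qed.

Lemma lshift0 f : lshift 0 f = f.
Proof. by apply/funext => l; rewrite /lshift expr0z scale1r. Qed.

Lemma fourier_shift m f k : fourier (lshift m f) k = fourier f (k - m).
Proof.
apply/matrixP => i j; rewrite !mxE; congr (_ * cintegral _); apply/funext => t.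
rewrite /lshift !mxE [_ * f _ _ _]mulrC -mulrA; congr (_ * _).
by rewrite -expfzDr ?cis_neq0 // opprB.
Qed.

Lemma lshift_lin m c f g : lshift m (c *: f + g) = c *: lshift m f + lshift m g.
Proof.
apply/funext => l; rewrite /lshift [(c *: f + g) l]/(c *: f l + g l).
by rewrite [RHS]/(c *: (_ *: f l) + _ *: g l) scalerDr !scalerA mulrC.
Qed.

Lemma cst_meas k (B : 'M[C]_(n, k)) : loop_meas (fun=> B).
Proof. by move=> i j; split; exact: measurable_cst. Qed.

Lemma cst_L2 (v : 'cV[C]_n) : L2 (fun=> v).
Proof.
apply/L2P; exists ((2 * pi + 1) * frobenius v); apply: l2norm_sup; apply/supnormP.
by split => [||_]; [exact: frob_ge0|exact: cst_meas|exact: lexx].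
Qed.

Lemma mx_L2 (B : 'M[C]_n) f : L2 f -> L2 (fun l => B *m f l).
Proof.
move=> /L2P [x hx]; apply/L2P; exists ((n * 1 * n)%:R * (frobenius B * x)).
apply: (l2norm_mul (a := fun=> B) _ hx); apply/supnormP.
by split => [||_]; [exact: frob_ge0|exact: cst_meas|exact: lexx].
Qed.

Lemma fourier_mx (B : 'M[C]_n) f k : L2 f -> fourier (fun l => B *m f l) k = B *m fourier f k.
Proof.
move=> hf; apply/matrixP => i j; rewrite ord1 mxE.
have h (s : seq 'I_n) : cint (fun t => \sum_(r <- s) B i r * fint f k r t) /\
    cintegral (fun t => \sum_(r <- s) B i r * fint f k r t) = \sum_(r <- s) B i r * cintegral (fint f k r).
  elim: s => [|r s [IH1 IH2]].
    have z : cint (fun=> 0 : C) by split; exact: (@cst_integrable_arc R 0).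
    have e : (fun=> 0 : C) = (fun t => \sum_(r <- [::]) B i r * fint f k r t).
      by apply/funext => t; rewrite big_nil.
    split; rewrite -e // big_nil.
    have -> : (fun=> 0 : C) = (fun _ : R => 0 * 0) by apply/funext => t; rewrite mulr0.
    by rewrite (cintegralZ 0 z) mul0r.
  have e : (fun t => B i r * fint f k r t + \sum_(r <- s) B i r * fint f k r t) =
     (fun t => \sum_(r <- r :: s) B i r * fint f k r t).
    by apply/funext => t; rewrite big_cons.
  have c1 := cintZ (B i r) (fint_cint k r hf).
  rewrite -e big_cons; split; first exact: cintD.
  by rewrite cintegralD // cintegralZ ?IH2 //; exact: (fint_cint k r hf).
rewrite mxE [RHS](eq_bigr (fun r => rcst (2 * pi)^-1 * (B i r * cintegral (fint f k r)))).
  rewrite -mulr_sumr -(h _).2; congr (_ * cintegral _); apply/funext => t.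
  by rewrite mxE mulr_suml; apply: eq_bigr => r _; rewrite /fint mulrA.
by move=> r _; rewrite !mxE mulrCA.
Qed.

Lemma cintegral_cis (j : int) : cintegral (fun t : R => cis t ^ j : C) = if j == 0 then rcst (2 * pi) else 0.
Proof.
have pi2 : (0 : R) < 2 * pi by rewrite mulr_gt0 // pi_gt0.
have c1 : (fun t : R => complex.Re (cis t ^ j : C)) = fun t => cos (j%:~R * t).
  by apply/funext => t; rewrite cisz.
have c2 : (fun t : R => complex.Im (cis t ^ j : C)) = fun t => sin (j%:~R * t).
  by apply/funext => t; rewrite cisz.
rewrite /cintegral c1 c2; case: eqP => [->|/eqP j0].
  rewrite (_ : (fun t => cos _) = cst 1); last by apply/funext => t; rewrite mul0r cos0.
  rewrite (_ : (fun t => sin _) = cst 0); last by apply/funext => t; rewrite mul0r sin0.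
  rewrite !Rintegral_cst; try exact: measurable_arc.
  by rewrite [X in fine X]measure_arc /= mul1r mul0r.
have jr : (j%:~R : R) != 0 by rewrite intr_eq0.
have mk (k : R) (g : R -> R) (t d : R) : is_derive t 1 g d -> is_derive t 1 (fun t => k * g t) (k * d).
  move=> hg; have hk : is_derive t 1 (cst k) 0 by exact: is_derive_cst.
  by have := is_deriveM hk hg; rewrite [_ *: 0]mulr0 addr0.
have dl (t : R) : is_derive t 1 (fun t : R => j%:~R * t) (j%:~R).
  by have := mk j%:~R id t 1 (is_derive_id _ _); rewrite mulr1.
have ds (t : R) : is_derive t 1 (fun t : R => j%:~R^-1 * sin (j%:~R * t)) (cos (j%:~R * t)).
  have := mk j%:~R^-1 _ t _ (is_derive1_comp (is_derive_sin (j%:~R * t)) (dl t)).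
  by rewrite mulrCA mulVf // mulr1.
have dc (t : R) : is_derive t 1 (fun t : R => - j%:~R^-1 * cos (j%:~R * t)) (sin (j%:~R * t)).
  have := mk (- j%:~R^-1) _ t _ (is_derive1_comp (is_derive_cos (j%:~R * t)) (dl t)).
  by rewrite mulNr mulNr mulrN opprK mulrCA mulVf // mulr1.
have per : cos (j%:~R * (2 * pi)) = 1 :> R /\ sin (j%:~R * (2 * pi)) = 0 :> R.
  have h := cisz (2 * pi : R) j; have p2 : cis (2 * pi) = 1 :> C.
    by rewrite /cis mulr_natl -[pi *+ 2]add0r cosD2pi sinD2pi cos0 sin0.
  by move: h; rewrite p2 exp1rz => /(congr1 (fun z : C => (complex.Re z, complex.Im z))) [<- <-].
have ftc (f F : R -> R) : (forall t : R, is_derive t 1 F (f t)) -> continuous f -> F (2 * pi) = F 0 ->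
    Rintegral mu arc f = 0.
  move=> dF cf e; have cF : continuous F.
    move=> t; apply: differentiable_continuous; apply/derivable1_diffP.
    by have [] := dF t.
  rewrite /Rintegral (continuous_FTC2 (F := F)) ?e ?subee //.
  - exact: continuous_subspaceT.
  - split => [t _||]; first by have [] := dF t.
      exact: cvg_at_right_filter (cF _).
    exact: cvg_at_left_filter (cF _).
  - by move=> t _; rewrite derive1E; have [_] := dF t.
have cl : continuous (fun t : R => j%:~R * t).
  by move=> t; apply: cvgM; [exact: cvg_cst|exact: cvg_id].
rewrite (ftc _ _ ds); last 2 first.
- by move=> t; apply: continuous_comp; [exact: cl|exact: continuous_cos].
- by rewrite per.2 !mulr0 sin0 mulr0.
rewrite (ftc _ _ dc) //.
- by move=> t; apply: continuous_comp; [exact: cl|exact: continuous_sin].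
- by rewrite per.1 mulr0 cos0.
Qed.

Lemma fourier_cst (v : 'cV[C]_n) m k :
  fourier (lshift m (fun=> v)) k = if k == m then v else 0.
Proof.
rewrite fourier_shift; apply/matrixP => i j; rewrite !mxE ord1.
rewrite cintegralZ; last first.
  have := fint_cint (k - m) i (cst_L2 (const_mx 1)).
  by congr cint; apply/funext => t; rewrite /fint mxE mul1r.
rewrite cintegral_cis oppr_eq0 subr_eq0; case: eqP => _; last by rewrite !mulr0 mxE.
rewrite mulrCA -rcstM mulVf ?mulr1 //.
by rewrite mulf_neq0 // lt0r_neq0 // pi_gt0.
Qed.
End FourierRules.

(** * Charts and Wirtinger derivatives *)

Section Coords.
Variable R : realType.
Local Notation C := (Cx R).

Lemma cgt0P (e : C) : 0 < e -> exists2 r : R, 0 < r & e = r%:C%C.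
Proof. by case: e => a b /=; rewrite ltcE /= => /andP [/eqP -> a0]; exists a. Qed.

Lemma cplx_cont : continuous (fun p : R * R => cplx p : C).
Proof.
move=> p; apply/cvgrPdist_lt => e /cgt0P [r r0 ->].
have r2 : 0 < r / 2 by rewrite divr_gt0.
have : \forall q \near p, ball p (r / 2) q by exact: nbhsx_ballx.
apply: filterS => q [] /=; rewrite -!ball_normE /= => h1 h2.
rewrite normCE ltcR; apply: le_lt_trans (cmod_le_ReIm _) _.
by rewrite /=; lra.
Qed.

Definition ccoord (z : C) : R * R := (complex.Re z, complex.Im z).

Lemma ccoordK z : cplx (ccoord z) = z. Proof. by case: z. Qed.
Lemma cplxK p : ccoord (cplx p) = p. Proof. by case: p. Qed.

Lemma ccoord_cont : continuous ccoord.
Proof.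
move=> z A /nbhs_ballP [e /= e0 hA].
have e0' : (0 : C) < e%:C%C by rewrite ltcR.
have : \forall w \near z, `|z - w| < e%:C%C.
  by apply: (@cvgr_dist_lt _ _ _ (nbhs z) _ id z) => //; exact: cvg_id.
apply: (@filterS _ (nbhs z)) => w; rewrite normCE ltcR => h; apply: hA.
split; rewrite -ball_normE /=.
- apply: le_lt_trans h; rewrite -[X in `|X|]/(complex.Re z - complex.Re w).
  by rewrite -[X in `|X|](_ : complex.Re (z - w) = _) ?Re_le_cmod //; case: (z); case: (w).
- apply: le_lt_trans h; rewrite -[X in `|X|]/(complex.Im z - complex.Im w).
  by rewrite -[X in `|X|](_ : complex.Im (z - w) = _) ?Im_le_cmod //; case: (z); case: (w).
Qed.
End Coords.

Section Chart.
Variables (R : realType) (M : riemann_surface R).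
Variable c : chart R M.

Definition pt (x : M) : R * R := ccoord (cmap c x).

Lemma from_pt x : cdom c x -> from_coord c (pt x) = x.
Proof. by move=> cx; rewrite /from_coord ccoordK chart_invK. Qed.

Lemma coord_setP (U : set M) p : coord_set c U p ->
  [/\ U (from_coord c p), cdom c (from_coord c p) & pt (from_coord c p) = p].
Proof.
move=> [x [cx Ux] e]; have -> : from_coord c p = x by rewrite /from_coord -e chart_invK.
by split => //; rewrite /pt e cplxK.
Qed.

Lemma pt_coord (U : set M) x : cdom c x -> U x -> coord_set c U (pt x).
Proof. by move=> cx Ux; exists x => //; rewrite ccoordK. Qed.

Lemma near_from_coord p (P : M -> Prop) : coord_set c setT p ->
  (\forall y \near from_coord c p, P y) -> \forall q \near p, P (from_coord c q).
Proof.
move=> cp hP; have [x [cx _] e] := cp.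
have h : {for cplx p, continuous (cinv c)} by apply: chart_inv_cont; exists x.
exact: (@cplx_cont R p _ (h _ hP)).
Qed.

Lemma near_pt x (P : R * R -> Prop) : cdom c x ->
  (\forall p \near pt x, P p) -> \forall y \near x, P (pt y).
Proof.
move=> cx hP; have h := chart_cont cx.
exact: (h _ (@ccoord_cont R (cmap c x) _ hP)).
Qed.

Lemma near_dom x (U : set M) : open U -> cdom c x -> U x -> \forall y \near x, cdom c y /\ U y.
Proof.
move=> oU cx Ux; apply: filterI; apply: open_nbhs_nbhs; split => //; exact: chart_open.
Qed.

Lemma open_coord (U : set M) : open U -> open (coord_set c U).
Proof.
move=> oU; rewrite openE => p [x [cx Ux] e].
have hx : from_coord c p = x by rewrite /from_coord -e chart_invK.
have : \forall z \near cplx p, (cmap c @` cdom c) z.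
  by apply: open_nbhs_nbhs; split; [exact: chart_open_image|exists x].
move=> /(@cplx_cont R p) h0.
have h1 : \forall q \near p, (cmap c @` cdom c) (cplx q) := h0.
have h2 : \forall q \near p, U (from_coord c q).
  apply: near_from_coord; first by exists x.
  by rewrite hx; apply: open_nbhs_nbhs.
move: h1 h2; apply: filterS2 => q [y cy ey] Uy; exists y => //; split => //.
by move: Uy; rewrite /from_coord -ey chart_invK.
Qed.

Definition e1 : R * R := (1, 0).

(** A line in the chart approaches x through points other than x. *)
Lemma near_punctured x (P : M -> Prop) : cdom c x -> (\forall y \near x^', P y) ->
  \forall t \near (0 : R)^', P (from_coord c (pt x + t *: e1)).
Proof.
move=> cx hP.
have h : \forall y \near x, y != x -> P y by exact: hP.
have cp : coord_set c setT (pt x) by exact: pt_coord.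
have := near_line e1 (near_from_coord cp (P := fun y => y != x -> P y) _).
rewrite from_pt // => /(_ h) h1.
have h2 := near_line e1 (near_open (open_coord openT) cp).
have h3 : \forall t \near (0 : R)^', t != 0 by exact: nbhs_dnbhs_neq.
move: h1 h2 h3; apply: filterS3 => t k1 k2 k3.
apply: k1; apply/eqP => e; move: k3; have [_ _] := coord_setP k2.
rewrite e => /eqP; rewrite -subr_eq0 opprD addrA subrr add0r oppr_eq0 => /eqP /(congr1 fst) h'.
by move: h'; rewrite -[LHS]/(t * 1) mulr1 => ->; rewrite eqxx.
Qed.

End Chart.

Section Dk.
Variables (R : realType).
Local Notation C := (Cx R).
Local Notation V := (R * R)%type.
Local Notation mxn := (@mxnorm R _ _).

(** kappa = -i gives d/dz and kappa = i gives d/dzbar. *)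
Definition wirt (E : lmodType C) (N : E -> \bar R) (kappa : C) (f : V -> E) (p : V) (d : E) :=
  exists dx dy, [/\ is_dirderiv N f p (1, 0) dx, is_dirderiv N f p (0, 1) dy &
    d = 2^-1 *: (dx + kappa *: dy)].

Lemma comb_sym (F : comRingType) (E : lmodType F) (h k k' : F) (a b d : E) :
  h *: (h *: (a + k' *: b) + k *: (h *: (b + k' *: d))) =
  h *: (h *: (a + k *: b) + k' *: (h *: (b + k *: d))).
Proof.
rewrite !scalerDr !scalerA -!addrA [X in _ + X]addrCA.
by congr (_ + (_ *: _ + (_ *: _ + _ *: _))); ring.
Qed.

Section Generic.
Variables (E : lmodType C) (N : E -> \bar R) (qN : quasi_norm N).
Lemma wirt_near k f g p d : (\forall q \near p, f q = g q) -> wirt N k f p d -> wirt N k g p d.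
Proof.
move=> fg [dx [dy [hx hy ->]]]; exists dx, dy; split => //; exact: (dderiv_near qN fg).
Qed.
Lemma wirtD k f g p a b : wirt N k f p a -> wirt N k g p b -> wirt N k (fun q => f q + g q) p (a + b).
Proof.
move=> [dx [dy [hx hy ->]]] [dx' [dy' [hx' hy' ->]]]; exists (dx + dx'), (dy + dy').
split; [exact: dderivD|exact: dderivD|by rewrite [k *: (_ + _)]scalerDr addrACA [RHS]scalerDr].
Qed.
Lemma wirt_cst k a p : wirt N k (fun=> a) p 0.
Proof.
exists 0, 0; split; [exact: dderiv_cst|exact: dderiv_cst|by rewrite scaler0 addr0 scaler0].
Qed.
Lemma wirtZ k c f p a : wirt N k f p a -> wirt N k (fun q => c *: f q) p (c *: a).
Proof.
move=> [dx [dy [hx hy ->]]]; exists (c *: dx), (c *: dy).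
split; [exact: dderivZ|exact: dderivZ|].
by rewrite [k *: (c *: _)]scalerA [k * c]mulrC -scalerA -scalerDr !scalerA mulrC.
Qed.
End Generic.

Lemma wirt_bil (E1 E2 E3 : lmodType C) (N1 : E1 -> \bar R) (N2 : E2 -> \bar R) (N3 : E3 -> \bar R)
  (q1 : quasi_norm N1) (q2 : quasi_norm N2) (q3 : quasi_norm N3) (B : E1 -> E2 -> E3)
  (BDl : forall a a' b, B (a + a') b = B a b + B a' b)
  (BDr : forall a b b', B a (b + b') = B a b + B a b')
  (BZl : forall c a b, B (c *: a) b = c *: B a b)
  (BZr : forall c a b, B a (c *: b) = c *: B a b)
  (K : R) (K0 : 0 <= K) (BK : bounded_by N1 N2 N3 B K) k f g p a b :
  (N1 (f p) < +oo)%E -> (N2 (g p) < +oo)%E ->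
  (forall v d, is_dirderiv N1 f p v d -> (N1 d < +oo)%E) ->
  (forall v d, is_dirderiv N2 g p v d -> (N2 d < +oo)%E) ->
  wirt N1 k f p a -> wirt N2 k g p b -> wirt N3 k (fun q => B (f q) (g q)) p (B a (g p) + B (f p) b).
Proof.
move=> fp gp fd gd [dx [dy [hx hy ->]]] [dx' [dy' [hx' hy' ->]]].
exists (B dx (g p) + B (f p) dx'), (B dy (g p) + B (f p) dy').
split; [|by apply: (dderiv_bil q1 q2 q3 BDl BDr BZl BZr K0 BK); eauto..|].
  by apply: (dderiv_bil q1 q2 q3 BDl BDr BZl BZr K0 BK); eauto.
rewrite !(BZl, BZr, BDl, BDr) -scalerDr; congr (_ *: _).
by rewrite scalerDr addrACA.
Qed.

Lemma wirt_mul m l r k (f : V -> 'M[C]_(m, l)) (g : V -> 'M[C]_(l, r)) p a b :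
  wirt mxn k f p a -> wirt mxn k g p b -> wirt mxn k (fun q => f q *m g q) p (a *m g p + f p *m b).
Proof.
have K0 : 0 <= (m * r * l)%:R :> R by [].
apply: (wirt_bil (mxnorm_qn R m l) (mxnorm_qn R l r) (mxnorm_qn R m r) _ _ _ _ K0
  (@mxnorm_mul R m l r)); try (move=> *; exact: mxnorm_fin); move=> *;
  by rewrite ?mulmxDl ?mulmxDr -?scalemxAl -?scalemxAr.
Qed.

Lemma wirt_uniq m l k (f : V -> 'M[C]_(m, l)) p a b :
  wirt mxn k f p a -> wirt mxn k f p b -> a = b.
Proof.
move=> [dx [dy [hx hy ->]]] [dx' [dy' [hx' hy' ->]]].
by rewrite (mxnorm_uniq hx hx') (mxnorm_uniq hy hy').
Qed.

Lemma conj_imC : (imC R)^* = - imC R.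
Proof. by apply/eqP; rewrite eq_complex /= oppr0 !eqxx. Qed.

Lemma wirt_adj m l (f : V -> 'M[C]_(m, l)) p a :
  wirt mxn (- imC R) f p a -> wirt mxn (imC R) (fun q => (f q)^t* ) p (a^t* ).
Proof.
move=> [dx [dy [hx hy ->]]]; exists (dx^t* ), (dy^t* ); split; [exact: mxdderiv_adj|exact: mxdderiv_adj|].
apply/matrixP => i j; rewrite !mxE !(rmorphM, rmorphD, rmorphN) /= conj_imC opprK.
by rewrite fmorphV rmorph_nat.
Qed.

Lemma wirt_ex m l k (U : set V) (f : V -> 'M[C]_(m, l)) : open U -> smooth_coord mxn U f ->
  exists df, smooth_coord mxn U df /\ forall p, U p -> wirt mxn k f p (df p).
Proof.
move=> oU hf; have qn := mxnorm_qn R m l.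
have [fx [sx hx]] := sm_dd ((1, 0) : V) qn oU hf; have [fy [sy hy]] := sm_dd ((0, 1) : V) qn oU hf.
exists (fun p => 2^-1 *: (fx p + k *: fy p)); split; last first.
  by move=> p Up; exists (fx p), (fy p); split; [exact: hx|exact: hy|].
have sZ c (g : V -> 'M[C]_(m, l)) : smooth_coord mxn U g -> smooth_coord mxn U (fun p => c *: g p).
  move=> sg; apply: (sm_ext (f := fun p => c%:M *m g p)); first by move=> p _; rewrite mul_scalar_mx.
  apply: sm_mul => //; exact: (sm_cst U _ (mxnorm_qn R _ _)).
by apply: (sZ); apply: sm_add => //; exact: sZ.
Qed.

Lemma wirt_comm m l (U : set V) (f f1 f2 f12 f21 : V -> 'M[C]_(m, l)) (k k' : C) p : open U -> U p ->
  smooth_coord mxn U f ->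
  (forall q, U q -> wirt mxn k f q (f1 q)) -> (forall q, U q -> wirt mxn k' f q (f2 q)) ->
  wirt mxn k' f1 p (f12 p) -> wirt mxn k f2 p (f21 p) -> f12 p = f21 p.
Proof.
move=> oU Up hf h1 h2 h12 h21; have qn := mxnorm_qn R m l.
have [fx [sx hx]] := sm_dd ((1, 0) : V) qn oU hf; have [fy [sy hy]] := sm_dd ((0, 1) : V) qn oU hf.
have [fxx [sxx hxx]] := sm_dd ((1, 0) : V) qn oU sx; have [fxy [sxy hxy]] := sm_dd ((0, 1) : V) qn oU sx.
have [fyx [syx hyx]] := sm_dd ((1, 0) : V) qn oU sy; have [fyy [syy hyy]] := sm_dd ((0, 1) : V) qn oU sy.
have e : fxy p = fyx p.
  apply: (schwarz_sym (a := (1, 0)) (b := (0, 1)) (f := f) (fa := fx) (fb := fy) oU Up).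
  - by move=> q Uq; split; [exact: hx|exact: hy|exact: hxy|exact: hyx].
  - exact: (sm_cont qn oU sxy Up).
  - exact: (sm_cont qn oU syx Up).
have w1 kk q : U q -> wirt mxn kk f q (2^-1 *: (fx q + kk *: fy q)).
  by move=> Uq; exists (fx q), (fy q); split; [exact: hx|exact: hy|].
have wx kk : wirt mxn kk fx p (2^-1 *: (fxx p + kk *: fxy p)).
  by exists (fxx p), (fxy p); split; [exact: hxx|exact: hxy|].
have wy kk : wirt mxn kk fy p (2^-1 *: (fyx p + kk *: fyy p)).
  by exists (fyx p), (fyy p); split; [exact: hyx|exact: hyy|].
have w2 kk kk' (g : V -> 'M[C]_(m, l)) d : (forall q, U q -> wirt mxn kk f q (g q)) ->
    wirt mxn kk' g p d -> d = 2^-1 *: (2^-1 *: (fxx p + kk' *: fxy p) + kk *: (2^-1 *: (fyx p + kk' *: fyy p))).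
  move=> hg hd; apply: (wirt_uniq hd).
  have := wirtZ qn 2^-1 (wirtD qn (wx kk') (wirtZ qn kk (wy kk'))).
  apply: wirt_near => //; have := near_open oU Up; apply: filterS => q Uq.
  exact: wirt_uniq (w1 kk q Uq) (hg q Uq).
have -> := w2 _ _ _ _ h1 h12; have -> := w2 _ _ _ _ h2 h21; rewrite e.
exact: comb_sym.
Qed.
End Dk.

Section DzCoord.
Variables (R : realType) (M : riemann_surface R).
Local Notation C := (Cx R).
Variable c : chart R M.
Local Notation mxn := (@mxnorm R _ _).

Lemma is_dzE (E : lmodType C) (N : E -> \bar R) (f : M -> E) x d :
  is_dz N c f x d <-> wirt N (- imC R) (fun q => f (from_coord c q)) (pt c x) d.
Proof.
split=> [[p [dx [dy [e hx hy ->]]]]|[dx [dy [hx hy ->]]]].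
  have <- : p = pt c x by rewrite /pt -e cplxK.
  by exists dx, dy; split => //; rewrite scaleNr.
by exists (pt c x), dx, dy; split => //; [rewrite ccoordK|rewrite scaleNr].
Qed.

Lemma is_dzbarE (E : lmodType C) (N : E -> \bar R) (f : M -> E) x d :
  is_dzbar N c f x d <-> wirt N (imC R) (fun q => f (from_coord c q)) (pt c x) d.
Proof.
split=> [[p [dx [dy [e hx hy ->]]]]|[dx [dy [hx hy ->]]]].
  have <- : p = pt c x by rewrite /pt -e cplxK.
  by exists dx, dy; split.
by exists (pt c x), dx, dy; split => //; rewrite ccoordK.
Qed.

Lemma dz_eq m k (f : M -> 'M[C]_(m, k)) x d : is_dz mxn c f x d -> dz c f x = d.
Proof.
move=> h; apply: xget_unique => // y; move/is_dzE => hy; move/is_dzE: h => h.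
exact: wirt_uniq hy h.
Qed.

Lemma dzbar_eq m k (f : M -> 'M[C]_(m, k)) x d : is_dzbar mxn c f x d -> dzbar c f x = d.
Proof.
move=> h; apply: xget_unique => // y; move/is_dzbarE => hy; move/is_dzbarE: h => h.
exact: wirt_uniq hy h.
Qed.
End DzCoord.

Section MCalc.
Variables (R : realType) (M : riemann_surface R).
Local Notation C := (Cx R).
Local Notation mxn := (@mxnorm R _ _).
Variables (c : chart R M) (rc : rs_atlas c).
Local Notation Om := (coord_set c setT).
Local Notation fc := (from_coord c).

Lemma openOm : open Om. Proof. exact: open_coord openT. Qed.
Hint Resolve openOm : core.

Definition chart_smooth m k (F : M -> 'M[C]_(m, k)) := smooth_coord mxn Om (fun p => F (fc p)).

Lemma smc_ext m k (F H : M -> 'M[C]_(m, k)) : (forall x, cdom c x -> F x = H x) -> chart_smooth F -> chart_smooth H.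
Proof. by move=> FH; apply: sm_ext => p /coord_setP [_ cp _]; exact: FH. Qed.

Lemma smc_mul m k l (F : M -> 'M[C]_(m, k)) (H : M -> 'M[C]_(k, l)) :
  chart_smooth F -> chart_smooth H -> chart_smooth (fun x => F x *m H x).
Proof. exact: (sm_mul openOm). Qed.

Lemma smc_add m k (F H : M -> 'M[C]_(m, k)) : chart_smooth F -> chart_smooth H -> chart_smooth (fun x => F x + H x).
Proof. exact: (sm_add (mxnorm_qn R m k)). Qed.

Lemma smc_cst m k (A : 'M[C]_(m, k)) : chart_smooth (fun=> A).
Proof. exact: (sm_cst _ _ (mxnorm_qn R m k)). Qed.

Lemma smc_adj m k (F : M -> 'M[C]_(m, k)) : chart_smooth F -> chart_smooth (fun x => (F x)^t* ).
Proof. exact: (sm_adj openOm). Qed.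

Lemma smc_scale m k a (F : M -> 'M[C]_(m, k)) : chart_smooth F -> chart_smooth (fun x => a *: F x).
Proof.
move=> hF; apply: (@smc_ext _ _ (fun x => a%:M *m F x)) => [x _|]; first by rewrite mul_scalar_mx.
by apply: smc_mul => //; exact: smc_cst.
Qed.

Lemma smc_opp m k (F : M -> 'M[C]_(m, k)) : chart_smooth F -> chart_smooth (fun x => - F x).
Proof. by move=> /(smc_scale (-1)); apply: smc_ext => x _; rewrite scaleN1r. Qed.

Lemma smc_sub m k (F H : M -> 'M[C]_(m, k)) : chart_smooth F -> chart_smooth H -> chart_smooth (fun x => F x - H x).
Proof. by move=> hF /smc_opp hH; exact: smc_add. Qed.

Lemma pt_Om x : cdom c x -> Om (pt c x). Proof. by move=> cx; exact: pt_coord. Qed.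

Lemma dzE m k (F : M -> 'M[C]_(m, k)) x : chart_smooth F -> cdom c x ->
  wirt mxn (- imC R) (fun q => F (fc q)) (pt c x) (dz c F x).
Proof.
move=> hF cx; have [df [_ hd]] := wirt_ex (- imC R) openOm hF.
have h := hd _ (pt_Om cx).
by rewrite (@dz_eq _ _ c _ _ F x (df (pt c x))) //; exact/is_dzE.
Qed.

Lemma dzbarE m k (F : M -> 'M[C]_(m, k)) x : chart_smooth F -> cdom c x ->
  wirt mxn (imC R) (fun q => F (fc q)) (pt c x) (dzbar c F x).
Proof.
move=> hF cx; have [df [_ hd]] := wirt_ex (imC R) openOm hF.
have h := hd _ (pt_Om cx).
by rewrite (@dzbar_eq _ _ c _ _ F x (df (pt c x))) //; exact/is_dzbarE.
Qed.

Lemma dz_is m k (F : M -> 'M[C]_(m, k)) x d :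
  wirt mxn (- imC R) (fun q => F (fc q)) (pt c x) d -> dz c F x = d.
Proof. by move=> h; apply: dz_eq; exact/is_dzE. Qed.
Lemma dzbar_is m k (F : M -> 'M[C]_(m, k)) x d :
  wirt mxn (imC R) (fun q => F (fc q)) (pt c x) d -> dzbar c F x = d.
Proof. by move=> h; apply: dzbar_eq; exact/is_dzbarE. Qed.

Lemma smc_dz m k (F : M -> 'M[C]_(m, k)) : chart_smooth F -> chart_smooth (dz c F).
Proof.
move=> hF; have [df [hdf hd]] := wirt_ex (- imC R) openOm hF.
apply: sm_ext hdf => p Up; have [_ cp e] := coord_setP Up.
by apply: esym; apply: dz_is; rewrite e; exact: hd.
Qed.

Lemma smc_dzbar m k (F : M -> 'M[C]_(m, k)) : chart_smooth F -> chart_smooth (dzbar c F).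
Proof.
move=> hF; have [df [hdf hd]] := wirt_ex (imC R) openOm hF.
apply: sm_ext hdf => p Up; have [_ cp e] := coord_setP Up.
by apply: esym; apply: dzbar_is; rewrite e; exact: hd.
Qed.

Lemma near_fc x (P : M -> Prop) : cdom c x -> (\forall y \near x, P y) ->
  \forall q \near pt c x, P (fc q).
Proof.
by move=> cx hP; apply: near_from_coord; [exact: pt_Om|rewrite from_pt].
Qed.

Lemma near_cdom x : cdom c x -> \forall y \near x, cdom c y.
Proof. by move=> cx; apply: open_nbhs_nbhs; split => //; exact: chart_open. Qed.

Lemma dz_near m k (F H : M -> 'M[C]_(m, k)) x : chart_smooth F -> cdom c x ->
  (\forall y \near x, F y = H y) -> dz c H x = dz c F x.
Proof.
move=> hF cx FH; apply: dz_is; apply: (wirt_near (mxnorm_qn R m k)) (dzE hF cx).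
exact: (near_fc cx FH).
Qed.
Lemma dzbar_near m k (F H : M -> 'M[C]_(m, k)) x : chart_smooth F -> cdom c x ->
  (\forall y \near x, F y = H y) -> dzbar c H x = dzbar c F x.
Proof.
move=> hF cx FH; apply: dzbar_is; apply: (wirt_near (mxnorm_qn R m k)) (dzbarE hF cx).
exact: (near_fc cx FH).
Qed.
Lemma dz_ext m k (F H : M -> 'M[C]_(m, k)) x : chart_smooth F -> cdom c x ->
  (forall y, cdom c y -> F y = H y) -> dz c H x = dz c F x.
Proof. by move=> hF cx FH; apply: dz_near => //; have := near_cdom cx; apply: filterS. Qed.
Lemma dzbar_ext m k (F H : M -> 'M[C]_(m, k)) x : chart_smooth F -> cdom c x ->
  (forall y, cdom c y -> F y = H y) -> dzbar c H x = dzbar c F x.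
Proof. by move=> hF cx FH; apply: dzbar_near => //; have := near_cdom cx; apply: filterS. Qed.

Lemma dz_mul m k l (F : M -> 'M[C]_(m, k)) (H : M -> 'M[C]_(k, l)) x : chart_smooth F -> chart_smooth H -> cdom c x ->
  dz c (fun y => F y *m H y) x = dz c F x *m H x + F x *m dz c H x.
Proof.
move=> hF hH cx; apply: dz_is.
by have := wirt_mul (dzE hF cx) (dzE hH cx); rewrite from_pt.
Qed.
Lemma dzbar_mul m k l (F : M -> 'M[C]_(m, k)) (H : M -> 'M[C]_(k, l)) x : chart_smooth F -> chart_smooth H -> cdom c x ->
  dzbar c (fun y => F y *m H y) x = dzbar c F x *m H x + F x *m dzbar c H x.
Proof.
move=> hF hH cx; apply: dzbar_is.
by have := wirt_mul (dzbarE hF cx) (dzbarE hH cx); rewrite from_pt.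
Qed.
Lemma dz_add m k (F H : M -> 'M[C]_(m, k)) x : chart_smooth F -> chart_smooth H -> cdom c x ->
  dz c (fun y => F y + H y) x = dz c F x + dz c H x.
Proof. by move=> hF hH cx; apply: dz_is; apply: wirtD (dzE _ _) (dzE _ _) => //; exact: mxnorm_qn. Qed.
Lemma dzbar_add m k (F H : M -> 'M[C]_(m, k)) x : chart_smooth F -> chart_smooth H -> cdom c x ->
  dzbar c (fun y => F y + H y) x = dzbar c F x + dzbar c H x.
Proof. by move=> hF hH cx; apply: dzbar_is; apply: wirtD (dzbarE _ _) (dzbarE _ _) => //; exact: mxnorm_qn. Qed.
Lemma dz_scale m k a (F : M -> 'M[C]_(m, k)) x : chart_smooth F -> cdom c x ->
  dz c (fun y => a *: F y) x = a *: dz c F x.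
Proof. by move=> hF cx; apply: dz_is; apply: wirtZ (dzE _ _) => //; exact: mxnorm_qn. Qed.
Lemma dzbar_scale m k a (F : M -> 'M[C]_(m, k)) x : chart_smooth F -> cdom c x ->
  dzbar c (fun y => a *: F y) x = a *: dzbar c F x.
Proof. by move=> hF cx; apply: dzbar_is; apply: wirtZ (dzbarE _ _) => //; exact: mxnorm_qn. Qed.
Lemma dz_cst m k (A : 'M[C]_(m, k)) x : dz c (fun=> A) x = 0.
Proof. by apply: dz_is; apply: wirt_cst; exact: mxnorm_qn. Qed.
Lemma dzbar_cst m k (A : 'M[C]_(m, k)) x : dzbar c (fun=> A) x = 0.
Proof. by apply: dzbar_is; apply: wirt_cst; exact: mxnorm_qn. Qed.
Lemma dzbar_adj m k (F : M -> 'M[C]_(m, k)) x : chart_smooth F -> cdom c x ->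
  dzbar c (fun y => (F y)^t* ) x = (dz c F x)^t*.
Proof. by move=> hF cx; apply: dzbar_is; apply: wirt_adj; exact: dzE. Qed.

Lemma dz_comm m k (F : M -> 'M[C]_(m, k)) x : chart_smooth F -> cdom c x ->
  dzbar c (dz c F) x = dz c (dzbar c F) x.
Proof.
move=> hF cx.
have h1 q : Om q -> wirt mxn (- imC R) (fun p => F (fc p)) q (dz c F (fc q)).
  by move=> /coord_setP [_ cq e]; have := dzE hF cq; rewrite e.
have h2 q : Om q -> wirt mxn (imC R) (fun p => F (fc p)) q (dzbar c F (fc q)).
  by move=> /coord_setP [_ cq e]; have := dzbarE hF cq; rewrite e.
have h3 : wirt mxn (imC R) (fun p => dz c F (fc p)) (pt c x) ((fun=> dzbar c (dz c F) x) (pt c x)).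
  exact: dzbarE (smc_dz hF) cx.
have h4 : wirt mxn (- imC R) (fun p => dzbar c F (fc p)) (pt c x) ((fun=> dz c (dzbar c F) x) (pt c x)).
  exact: dzE (smc_dzbar hF) cx.
exact: (@wirt_comm R m k Om _ _ _ (fun=> dzbar c (dz c F) x) (fun=> dz c (dzbar c F) x) _ _ _ openOm (pt_Om cx) hF h1 h2 h3 h4).
Qed.

(** This extends identities proved off a discrete set to all points. *)
Lemma ext0 m k (F : M -> 'M[C]_(m, k)) x : chart_smooth F -> cdom c x -> (\forall y \near x^', F y = 0) -> F x = 0.
Proof.
move=> hF cx h; apply: frob_eq0; apply/ler_addgt0Pr => e e0; rewrite add0r.
have h1 := near_punctured cx h.
have h2 := near_line (e1 R) (sm_cont (mxnorm_qn R m k) openOm hF (pt_Om cx) e0).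
have [t [-> ]] := filter_ex (filterI h1 h2).
by rewrite from_pt // sub0r (qn_N (mxnorm_qn R m k)) /mxnorm lee_fin.
Qed.

End MCalc.

(** * Hermitian projections and Gauss images *)

Section Proj.
Variables (R : realType) (n : nat).
Local Notation C := (Cx R).

Lemma mulmx_cols m k (A B : 'M[C]_(m, k)) : (forall v : 'cV[C]_k, A *m v = B *m v) -> A = B.
Proof.
move=> h; apply/matrixP => i j; have := h (delta_mx j 0).
by rewrite -!colE => /matrixP /(_ i 0); rewrite !mxE.
Qed.

Lemma adjM m k l (A : 'M[C]_(m, k)) (B : 'M[C]_(k, l)) : (A *m B)^t* = B^t* *m A^t*.
Proof. by rewrite trmx_mul map_mxM. Qed.
Lemma adjK m k (A : 'M[C]_(m, k)) : (A^t* )^t* = A.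
Proof. by apply/matrixP => i j; rewrite !mxE conjCK. Qed.
Lemma adj1 : (1%:M : 'M[C]_n)^t* = 1%:M.
Proof. by apply/matrixP => i j; rewrite !mxE eq_sym; case: (i == j); rewrite ?conjC1 ?conjC0. Qed.
Lemma adj0 m k : (0 : 'M[C]_(m, k))^t* = 0.
Proof. by apply/matrixP => i j; rewrite !mxE conjC0. Qed.

Lemma proj_orth (P Q : 'M[C]_n) : is_proj P -> is_proj Q ->
  (forall v w, fibre P v -> fibre Q w -> v^t* *m w = 0) <-> P *m Q = 0.
Proof.
move=> [PP Pa] [QQ Qa]; split => [h|PQ v w Pv Qw].
  apply/matrixP => i j.
  have fP u : fibre P (P *m u) by rewrite /fibre /= mulmxA PP.
  have fQ u : fibre Q (Q *m u) by rewrite /fibre /= mulmxA QQ.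
  have := h _ _ (fP (delta_mx i 0)) (fQ (delta_mx j 0)); rewrite adjM Pa.
  rewrite -mulmxA [P *m (Q *m _)]mulmxA -colE (_ : (delta_mx i 0)^t* = delta_mx 0 i); last first.
    by apply/matrixP => a b; rewrite !mxE andbC; case: (_ && _); rewrite ?conjC1 ?conjC0.
  by rewrite -rowE => /matrixP /(_ 0 0); rewrite !mxE.
by rewrite -Pv -Qw adjM Pa -mulmxA [P *m (Q *m w)]mulmxA PQ mul0mx mulmx0.
Qed.

Lemma proj_sym (P Q : 'M[C]_n) : is_proj P -> is_proj Q -> P *m Q = 0 -> Q *m P = 0.
Proof. by move=> [_ Pa] [_ Qa] /(congr1 (fun A => A^t* )); rewrite adjM Pa Qa adj0. Qed.
End Proj.

Section Bundles.
Variables (R : realType) (M : riemann_surface R) (n : nat).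
Local Notation C := (Cx R).
Implicit Types (P Q : M -> 'M[C]_n) (c : chart R M).

Lemma sub_smc P c : subbundle P -> rs_atlas c -> chart_smooth c P.
Proof. by move=> [h _] rc; exact: h. Qed.

Lemma dz_proj P c x : subbundle P -> rs_atlas c -> cdom c x ->
  dz c P x = dz c P x *m P x + P x *m dz c P x.
Proof.
move=> sP rc cx; have hP := sub_smc sP rc.
rewrite -(dz_mul hP hP cx); apply: (dz_ext (smc_mul hP hP) cx).
by move=> y _; have [_ /(_ y) [-> _]] := sP.
Qed.

Lemma proj_dz_proj P c x : subbundle P -> rs_atlas c -> cdom c x ->
  P x *m dz c P x *m P x = 0.
Proof.
move=> sP rc cx; have := dz_proj sP rc cx; have [_ /(_ x) [PP _]] := sP.
move=> /(congr1 (fun A => P x *m A *m P x)); rewrite mulmxDr mulmxDl !mulmxA PP.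
rewrite -!mulmxA PP => /eqP; rewrite -subr_eq0 opprD addrA subrr sub0r oppr_eq0 => /eqP.
by [].
Qed.

Lemma dz_orth P Q c x : subbundle P -> subbundle Q -> rs_atlas c -> cdom c x ->
  (forall y, P y *m Q y = 0) -> dz c P x *m Q x + P x *m dz c Q x = 0.
Proof.
move=> sP sQ rc cx h; rewrite -(dz_mul (sub_smc sP rc) (sub_smc sQ rc) cx).
rewrite -[RHS](@dz_cst _ _ c _ _ (0 : 'M[C]_n) x).
by apply: (dz_ext (smc_cst c 0) cx).
Qed.

Lemma dzbar_proj P c x : subbundle P -> rs_atlas c -> cdom c x -> dzbar c P x = (dz c P x)^t*.
Proof.
move=> sP rc cx; have hP := sub_smc sP rc; rewrite -(dzbar_adj hP cx).
apply: (dzbar_ext (smc_adj hP) cx).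
by move=> y _; have [_ /(_ y) [_ ->]] := sP.
Qed.

(** By (d/dz P) P = (1 - P) (d/dz P), the derivative of a section of P,
    projected off P, depends on the value of the section only. *)
Lemma gauss_imageP P c x (v : 'cV[C]_n) : subbundle P -> rs_atlas c -> cdom c x ->
  gauss_image c P x v <-> exists u, v = dz c P x *m P x *m u.
Proof.
move=> sP rc cx; have hP := sub_smc sP rc; have [_ /(_ x) [PP Pa]] := sP.
have e : (1%:M - P x) *m dz c P x = dz c P x *m P x.
  by rewrite mulmxBl mul1mx {1}(dz_proj sP rc cx) addrK.
split => [[W [s [[oW Wx] ss fs ->]]]|[u ->]].
  exists (s x).
  have oOm : open (coord_set c W) by exact: open_coord.
  have [df [_ hd]] := wirt_ex (- imC R) oOm (ss c rc).
  have h1 := hd _ (pt_coord cx Wx).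
  have h2 := wirt_mul (dzE hP cx) h1; rewrite from_pt // in h2.
  have h3 : dz c s x = dz c P x *m s x + P x *m dz c s x.
    rewrite {2}(dz_is h1); apply: dz_is; apply: (wirt_near (mxnorm_qn R n 1) _ h2).
    apply: (near_fc cx (P := fun y => P y *m s y = s y)).
    have : \forall y \near x, W y by exact: open_nbhs_nbhs.
    by apply: filterS => y /fs.
  have sx : P x *m s x = s x by exact: fs.
  rewrite h3 mulmxDr mulmxA e [(1%:M - P x) *m (P x *m _)]mulmxA mulmxBl mul1mx PP subrr mul0mx addr0.
  by [].
exists setT, (fun y => P y *m u); split.
- by split; [exact: openT|].
- move=> c' rc'; apply: smc_mul; [exact: sub_smc|exact: smc_cst].
- by move=> y _; rewrite /fibre /= mulmxA; have [_ /(_ y) [-> _]] := sP.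
- by rewrite (dz_mul hP (smc_cst c u) cx) dz_cst mulmx0 addr0 mulmxA e.
Qed.
End Bundles.

(** * Orthogonality in the Gauss sequence of a harmonic map *)

(** The next four lemmas are the matrix identities behind the induction along
    the Gauss sequence. *)
Lemma sandwich0 (F : comRingType) k n (E : 'M[F]_(k, n)) (P a b : 'M[F]_n) :
  E *m P = 0 -> P *m b *m P = 0 -> a = a *m P + P *m a -> E *m a *m b *m P = 0.
Proof.
move=> EP PbP ea; rewrite ea mulmxDr !mulmxDl !mulmxA EP !mul0mx addr0.
by rewrite -!mulmxA (mulmxA P b) PbP !mulmx0.
Qed.

Lemma dzbar_shift_alg (F : comRingType) n (E P Q D X p r pb : 'M[F]_n) :
  E *m Q = 0 -> E *m p *m pb *m P = 0 -> P *m P = P ->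
  D *m (p *m P) + Q *m X = r *m P + p *m pb -> E *m D *m (p *m P) = E *m r *m P.
Proof.
move=> EQ e PP /(congr1 (fun A => E *m A *m P)).
rewrite !mulmxDr !mulmxDl !mulmxA EQ !mul0mx addr0 e addr0.
by rewrite -!(mulmxA _ P P) PP.
Qed.

Lemma backward_step_alg (F : comRingType) n (E P0 P1 X p0 p r pb : 'M[F]_n) :
  E *m P1 = 0 -> E *m P0 = P0 -> P0 *m E = P0 -> P1 *m P1 = P1 -> P0 *m P0 = P0 ->
  E *m pb *m p *m P1 = 0 -> pb *m P1 = P0 *m (pb *m P1) -> P1 *m (p0 *m P0) = p0 *m P0 ->
  X = r *m P1 + pb *m p -> p0 *m (pb *m P1) + P0 *m X = X ->
  E *m r *m P1 = P0 *m r *m P1.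
Proof.
move=> EP1 EP0 P0E P1P1 P00 e zb sh Xe hX.
have e1 : E *m X *m P1 = P0 *m X *m P1.
  rewrite -{1}hX mulmxDr zb (mulmxA p0) -sh !mulmxA EP1 !mul0mx add0r EP0.
  by [].
have e2 : E *m X *m P1 = E *m r *m P1.
  by rewrite Xe mulmxDr mulmxDl !mulmxA e addr0 -mulmxA P1P1.
by rewrite -e2 e1 -[P0 in LHS]P0E -!mulmxA (mulmxA E) e2 !mulmxA P0E.
Qed.

Lemma backward_final_alg (F : comRingType) n (E P0 P1 P2 D m r : 'M[F]_n) :
  E *m D *m m = E *m r *m P1 -> E *m r *m P1 = P0 *m r *m P1 ->
  P0 *m P0 = P0 -> P0 *m E = P0 -> P2 *m m = m -> P0 *m D *m P2 = 0 -> P0 *m r *m P1 = 0.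
Proof.
move=> h EX P00 P0E Pm PDP.
by rewrite -P00 -!mulmxA [P0 *m (r *m _)]mulmxA -EX -h -Pm !mulmxA P0E PDP mul0mx.
Qed.

Section Chain.
Variables (R : realType) (M : riemann_surface R) (n : nat).
Local Notation C := (Cx R).
Variable G : nat -> M -> 'M[C]_n.
Hypothesis sG : forall i, subbundle (G i).
Hypothesis gG : forall i, gauss_bundle (G i) (G i.+1).

(** The map M_i from G i to G i.+1. *)
Definition shiftmx (c : chart R M) i x : 'M[C]_n := dz c (G i) x *m G i x.
Local Notation Mx := shiftmx.

Definition generic i y := forall c, rs_atlas c -> cdom c y ->
  forall v : 'cV[C]_n, fibre (G i.+1 y) v <-> exists u, v = Mx c i y *m u.

Lemma generic_near i x : \forall y \near x^', generic i y.
Proof.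
have [_ /(_ x)] := gG i; apply: filterS => y h c rc cy v.
by rewrite (h c rc cy) gauss_imageP.
Qed.

Lemma projG i x : is_proj (G i x). Proof. by have [_ /(_ x)] := sG i. Qed.
Lemma idemG i x : G i x *m G i x = G i x. Proof. by have [] := projG i x. Qed.
Lemma adjG i x : (G i x)^t* = G i x. Proof. by have [] := projG i x. Qed.
Lemma smG c i : rs_atlas c -> chart_smooth c (G i). Proof. exact: sub_smc. Qed.

Lemma generic_M i c y : generic i y -> rs_atlas c -> cdom c y -> G i.+1 y *m Mx c i y = Mx c i y.
Proof.
move=> h rc cy; apply: mulmx_cols => v; rewrite -mulmxA.
by apply: (h c rc cy _).2; exists v.
Qed.

Lemma generic_P i c y k (A : 'M[C]_(k, n)) : generic i y -> rs_atlas c -> cdom c y ->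
  A *m Mx c i y = 0 -> A *m G i.+1 y = 0.
Proof.
move=> h rc cy AM; apply: mulmx_cols => v; rewrite mul0mx -mulmxA.
have : fibre (G i.+1 y) (G i.+1 y *m v) by rewrite /fibre /= mulmxA idemG.
by move=> /(h c rc cy _).1 [u ->]; rewrite mulmxA AM mul0mx.
Qed.

Lemma everywhere i c m k (F : M -> 'M[C]_(m, k)) x : rs_atlas c -> cdom c x -> chart_smooth c F ->
  (forall y, cdom c y -> generic i y -> F y = 0) -> F x = 0.
Proof.
move=> rc cx hF h; apply: (ext0 hF cx).
have h1 : \forall y \near x^', cdom c y by apply: nbhs_dnbhs; exact: near_cdom.
by move: h1 (generic_near i x); apply: filterS2.
Qed.

Lemma dzG c i x : rs_atlas c -> cdom c x ->
  dz c (G i) x = dz c (G i) x *m G i x + G i x *m dz c (G i) x.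
Proof. exact: dz_proj. Qed.

Lemma GMx c i x : rs_atlas c -> cdom c x -> G i x *m Mx c i x = 0.
Proof. by move=> rc cx; rewrite /Mx mulmxA proj_dz_proj. Qed.

Lemma smMx c i : rs_atlas c -> chart_smooth c (Mx c i).
Proof. by move=> rc; apply: smc_mul; [exact/smc_dz/smG|exact: smG]. Qed.

Lemma shiftP c i x : rs_atlas c -> cdom c x -> G i.+1 x *m Mx c i x = Mx c i x.
Proof.
move=> rc cx; apply/eqP; rewrite -subr_eq0; apply/eqP.
apply: (@everywhere i c _ _ (fun x => G i.+1 x *m Mx c i x - Mx c i x)) => //.
  by apply: smc_sub; [apply: smc_mul; [exact: smG|exact: smMx]|exact: smMx].
by move=> y cy gy; rewrite generic_M // subrr.
Qed.

Lemma orthS i x : G i x *m G i.+1 x = 0.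
Proof.
have [c rc cx] := rs_cover x.
apply: (@everywhere i c _ _ (fun x => G i x *m G i.+1 x)) => //.
  by apply: smc_mul; exact: smG.
by move=> y cy gy; apply: (generic_P gy rc cy); exact: GMx.
Qed.

Definition orth_upto k := forall i j, (i < j <= k)%N -> forall x, G i x *m G j x = 0.
(** For the projections P_i this says that P_i (d/dz P_i) sees only G i.-1;
    its adjoint says that d/dzbar maps G i to G i.-1. Harmonicity enters the
    proof through this property alone. *)
Definition backward c i x := G i x *m dz c (G i) x = G i x *m dz c (G i) x *m G i.-1 x.

(** Differentiating P_i P_k = 0 gives P_i M_k = - (d/dz P_i) P_k, which is
    - P_i (d/dz P_i) P_(i-1) P_k = 0 by the backward property of G i. *)
Lemma orth_step k : orth_upto k ->
  (forall i c x, (0 < i < k)%N -> rs_atlas c -> cdom c x -> backward c i x) ->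
  forall i, (0 < i <= k)%N -> forall x, G i x *m G k.+1 x = 0.
Proof.
move=> ok zk i /andP [i0]; rewrite leq_eqVlt => /orP [/eqP -> x|ik x]; first exact: orthS.
have [c rc cx] := rs_cover x.
apply: (@everywhere k c _ _ (fun x => G i x *m G k.+1 x)) => //.
  by apply: smc_mul; exact: smG.
move=> y cy gy; apply: (generic_P gy rc cy).
have ok' : forall z, G i z *m G k z = 0 by move=> z; apply: ok; rewrite ik /=.
have h := dz_orth (sG i) (sG k) rc cy ok'.
have z : backward c i y by apply: zk => //; rewrite i0.
have e : dz c (G i) y *m G k y = 0.
  rewrite (dzG i rc cy) mulmxDl -mulmxA ok' mulmx0 add0r z -mulmxA ok ?mulmx0 //.
  by rewrite (leq_ltn_trans (leq_pred _) ik) /=.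
by move: h; rewrite e add0r /Mx mulmxA => ->; rewrite mul0mx.
Qed.

Section Zstep.
Variables (c : chart R M) (rc : rs_atlas c) (i : nat).
Local Notation E x := (1%:M - G i x - G i.+1 x).
Local Notation p x := (dz c (G i) x).
Local Notation pb x := (dzbar c (G i) x).
Local Notation r x := (dzbar c (dz c (G i)) x).

Lemma EG x : E x *m G i x = 0.
Proof.
by rewrite !mulmxBl mul1mx idemG (proj_sym (projG _ _) (projG _ _) (orthS i x)) subrr subrr.
Qed.
Lemma EGS x : E x *m G i.+1 x = 0.
Proof. by rewrite !mulmxBl mul1mx idemG orthS subr0 subrr. Qed.

Lemma dzbarG x : cdom c x -> pb x = pb x *m G i x + G i x *m pb x.
Proof.
move=> cx; rewrite (dzbar_proj (sG i) rc cx) {1}(dzG i rc cx) adjD !adjM adjG addrC.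
by [].
Qed.
Lemma proj_dzbar_proj x : cdom c x -> G i x *m pb x *m G i x = 0.
Proof.
move=> cx; have := proj_dz_proj (sG i) rc cx => /(congr1 (fun A => A^t* )).
by rewrite !adjM adjG adj0 (dzbar_proj (sG i) rc cx) mulmxA.
Qed.

Lemma E_ppb x : cdom c x -> E x *m p x *m pb x *m G i x = 0.
Proof. by move=> cx; exact: (sandwich0 (EG x) (proj_dzbar_proj cx) (dzG i rc cx)). Qed.

Lemma E_pbp x : cdom c x -> E x *m pb x *m p x *m G i x = 0.
Proof. by move=> cx; exact: (sandwich0 (EG x) (proj_dz_proj (sG i) rc cx) (dzbarG cx)). Qed.

(** Let E project off G i and G i.+1. The d/dzbar derivative of
    P_(i+1) M_i = M_i, cut down by E, relates d/dzbar of P_(i+1) to the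
    Laplacian of P_i. *)
Lemma dzbar_shift x : cdom c x -> E x *m dzbar c (G i.+1) x *m Mx c i x = E x *m r x *m G i x.
Proof.
move=> cx; have sp : chart_smooth c (dz c (G i)) by apply: smc_dz; exact: smG.
have h : dzbar c (fun y => G i.+1 y *m Mx c i y) x = dzbar c (Mx c i) x.
  by apply: (dzbar_ext (smMx i rc) cx) => y cy; rewrite shiftP.
move: h; rewrite (dzbar_mul (smG _ rc) (smMx i rc) cx) (dzbar_mul sp (smG _ rc) cx).
exact: (dzbar_shift_alg (EGS x) (E_ppb cx) (idemG i x)).
Qed.

(** When the E-part of the Laplacian of P_i vanishes on G i, [dzbar_shift]
    says that E (d/dzbar P_(i+1)) P_(i+1) = 0, and the adjoint of this is the
    backward property. *)
Lemma backward_of_E : (forall x, cdom c x -> E x *m r x *m G i x = 0) ->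
  forall x, cdom c x -> backward c i.+1 x.
Proof.
move=> hE x cx.
have h : E x *m dzbar c (G i.+1) x *m G i.+1 x = 0.
  apply: (@everywhere i c _ _ (fun x => E x *m dzbar c (G i.+1) x *m G i.+1 x)) => //.
    apply: smc_mul; last exact: smG.
    apply: smc_mul; last by apply: smc_dzbar; exact: smG.
    by apply: smc_sub; [apply: smc_sub; [exact: smc_cst|exact: smG]|exact: smG].
  by move=> y cy gy; apply: (generic_P gy rc cy); rewrite dzbar_shift // hE.
move: h => /(congr1 (fun A => A^t* )).
rewrite !adjM adj0 !adjB adj1 !adjG (dzbar_proj (sG _) rc cx) adjK.
rewrite /backward /= !mulmxBr mulmx1 -!mulmxA.
rewrite [G i.+1 x *m (dz c (G i.+1) x *m G i.+1 x)]mulmxA proj_dz_proj // subr0.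
by rewrite !mulmxA => /eqP; rewrite subr_eq0 => /eqP.
Qed.
End Zstep.

(** The backward property of G i.+1 says that d/dzbar maps G i.+1 to G i; its
    d/dz derivative shows that the E-part of the Laplacian on G i.+1 lies in
    G i, and that part vanishes because G i is orthogonal to G i.+2. *)
Lemma backward_step c i x : rs_atlas c -> (forall y, cdom c y -> backward c i.+1 y) ->
  (forall y, G i y *m G i.+2 y = 0) -> cdom c x -> backward c i.+2 x.
Proof.
move=> rc hz o2; apply: backward_of_E => // {}x cx.
set E := 1%:M - _ - _; set r := dzbar c _ x.
set P0 := G i x; set P1 := G i.+1 x; set P2 := G i.+2 x.
set pb := dzbar c (G i.+1) x; set p := dz c (G i.+1) x.
have EP1 : E *m P1 = 0 by exact: EG.
have o1 : P1 *m P0 = 0 by exact: proj_sym (projG _ _) (projG _ _) (orthS i x).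
have o20 : P2 *m P0 = 0 by exact: proj_sym (projG _ _) (projG _ _) (o2 x).
have o21 : P2 *m P1 = 0 by exact: proj_sym (projG _ _) (projG _ _) (orthS i.+1 x).
have EP0 : E *m P0 = P0 by rewrite /E !mulmxBl mul1mx -/P1 -/P2 o1 o20 !subr0.
have P0E : P0 *m E = P0 by rewrite /E !mulmxBr mulmx1 -/P1 -/P2 orthS o2 !subr0.
have zb y : cdom c y -> dzbar c (G i.+1) y *m G i.+1 y = G i y *m (dzbar c (G i.+1) y *m G i.+1 y).
  move=> cy; have := hz y cy => /(congr1 (fun A => A^t* )).
  by rewrite !adjM !adjG (dzbar_proj (sG _) rc cy).
have s1 : chart_smooth c (dzbar c (G i.+1)) by apply: smc_dzbar; exact: smG.
have s2 : chart_smooth c (fun y => dzbar c (G i.+1) y *m G i.+1 y) by apply: smc_mul => //; exact: smG.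
have s0 := smG i rc.
have h : dz c (fun y => G i y *m (dzbar c (G i.+1) y *m G i.+1 y)) x =
         dz c (fun y => dzbar c (G i.+1) y *m G i.+1 y) x.
  by apply: (dz_ext s2 cx) => y cy; exact: zb.
have EX : E *m r *m P1 = P0 *m r *m P1.
  rewrite (dz_mul s0 s2 cx) in h.
  have hX : dz c (fun y => dzbar c (G i.+1) y *m G i.+1 y) x = r *m P1 + pb *m p.
    by rewrite (dz_mul s1 (smG _ rc) cx) -(dz_comm (smG _ rc) cx).
  exact: (backward_step_alg EP1 EP0 P0E (idemG _ _) (idemG _ _) (E_pbp rc i.+1 cx) (zb x cx) (shiftP i rc cx) hX h).
have PDP : P0 *m dzbar c (G i.+2) x *m P2 = 0.
  have z0 : P2 *m dz c (G i) x = 0.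
    rewrite (dzG i rc cx) mulmxDr !mulmxA o20 mul0mx addr0.
    by rewrite -mulmxA -/(Mx c i x) -(shiftP i rc cx) mulmxA o21 mul0mx.
  have z1 : dzbar c (G i) x *m P2 = 0.
    by move: z0 => /(congr1 (fun A => A^t* )); rewrite adjM adj0 adjG -(dzbar_proj (sG i) rc cx).
  have := dzbar_mul (smG i rc) (smG i.+2 rc) cx; rewrite z1 add0r => <-.
  have -> : dzbar c (fun y => G i y *m G i.+2 y) x = 0; last by rewrite mul0mx.
  rewrite -[RHS](@dzbar_cst _ _ c _ _ (0 : 'M[C]_n) x).
  by apply: (dzbar_ext (smc_cst c 0) cx) => y _; rewrite o2.
have zero := backward_final_alg (dzbar_shift rc i.+1 cx) EX (idemG i x) P0E (shiftP i.+1 rc cx) PDP.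
by rewrite -[LHS]/(E *m r *m P1) EX.
Qed.
End Chain.

Lemma double_split (F : comRingType) (V : lmodType F) (a b w : V) :
  2 *: (a + b + w) = 2 *: b + w + (2 *: a + w).
Proof. by rewrite [RHS]addrACA [2 *: b + _]addrC !scalerDr [2 *: w]scaler_nat mulr2n. Qed.

Lemma cancel_mid (V : zmodType) (q s r : V) : q - s = r - s - q + (q + q - r).
Proof. by rewrite -[q + q - r]addrA [RHS]addrA subrK [RHS]addrC subrKA. Qed.

Section Conclude.
Variables (R : realType) (M : riemann_surface R) (n : nat).
Local Notation C := (Cx R).

Lemma cartanK (P : M -> 'M[C]_n) x : is_proj (P x) -> cartan P x *m cartan P x = 1%:M.
Proof.
move=> [PP _]; rewrite /cartan; set Q := 1%:M - P x.
have PQ : P x *m Q = 0 by rewrite mulmxBr mulmx1 PP subrr.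
have QP : Q *m P x = 0 by rewrite mulmxBl mul1mx PP subrr.
have QQ : Q *m Q = Q by rewrite mulmxBl mul1mx PQ subr0.
have PQ1 : P x + Q = 1%:M by rewrite addrC subrK.
by clearbody Q; rewrite mulmxBl !mulmxBr PP PQ QP QQ subr0 sub0r opprK.
Qed.

Lemma cartanV (P : M -> 'M[C]_n) x : is_proj (P x) -> invmx (cartan P x) = cartan P x.
Proof.
move=> hP; have h := cartanK hP; have [u _] := mulmx1_unit h.
by rewrite -[LHS]mulmx1 -h mulmxA mulVmx // mul1mx.
Qed.

Lemma cartan2 (P : M -> 'M[C]_n) x : cartan P x = 2 *: P x - 1%:M.
Proof. by rewrite /cartan opprB addrA scaler_nat mulr2n. Qed.

Lemma smc_cartan (P : M -> 'M[C]_n) c : subbundle P -> rs_atlas c -> chart_smooth c (cartan P).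
Proof.
move=> sP rc; have hP := sub_smc sP rc.
by apply: smc_sub => //; apply: smc_sub => //; exact: smc_cst.
Qed.

Lemma dz_cartan (P : M -> 'M[C]_n) c x : subbundle P -> rs_atlas c -> cdom c x ->
  dz c (cartan P) x = 2 *: dz c P x.
Proof.
move=> sP rc cx; have hP := sub_smc sP rc.
rewrite -(dz_scale 2 hP cx) -[RHS]addr0 -(@dz_cst _ _ c _ _ (- 1%:M : 'M[C]_n) x).
rewrite -(dz_add (smc_scale 2 hP) (smc_cst c _) cx).
apply: (dz_ext (smc_add (smc_scale 2 hP) (smc_cst c _)) cx) => y _.
by rewrite cartan2.
Qed.

Lemma dzbar_cartan (P : M -> 'M[C]_n) c x : subbundle P -> rs_atlas c -> cdom c x ->
  dzbar c (cartan P) x = 2 *: dzbar c P x.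
Proof.
move=> sP rc cx; have hP := sub_smc sP rc.
rewrite -(dzbar_scale 2 hP cx) -[RHS]addr0 -(@dzbar_cst _ _ c _ _ (- 1%:M : 'M[C]_n) x).
rewrite -(dzbar_add (smc_scale 2 hP) (smc_cst c _) cx).
apply: (dzbar_ext (smc_add (smc_scale 2 hP) (smc_cst c _)) cx) => y _.
by rewrite cartan2.
Qed.

Lemma Az_cartan (P : M -> 'M[C]_n) c x : subbundle P -> rs_atlas c -> cdom c x ->
  Az c (cartan P) x = cartan P x *m dz c P x.
Proof.
move=> sP rc cx; rewrite /Az cartanV; last by have [_] := sP.
by rewrite dz_cartan // -scalemxAr scalerA mulVf ?scale1r // pnatr_eq0.
Qed.

Lemma Azbar_cartan (P : M -> 'M[C]_n) c x : subbundle P -> rs_atlas c -> cdom c x ->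
  Azbar c (cartan P) x = cartan P x *m dzbar c P x.
Proof.
move=> sP rc cx; rewrite /Azbar cartanV; last by have [_] := sP.
by rewrite dzbar_cartan // -scalemxAr scalerA mulVf ?scale1r // pnatr_eq0.
Qed.

(** For the Cartan embedding 2 P - 1 the harmonic map equation says that the
    Laplacian of P commutes with P. *)
Lemma harmonic_comm (P : M -> 'M[C]_n) c x : subbundle P -> harmonic_map (cartan P) ->
  rs_atlas c -> cdom c x ->
  dzbar c (dz c P) x *m P x = P x *m dzbar c (dz c P) x.
Proof.
move=> sP [_ _ harm] rc cx; have hP := sub_smc sP rc; have hu := smc_cartan sP rc.
have sp := smc_dz hP; have sb := smc_dzbar hP.
have := harm c x rc cx.
have -> : dzbar c (Az c (cartan P)) x = dzbar c (fun y => cartan P y *m dz c P y) x.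
  by apply: (dzbar_ext (smc_mul hu sp) cx) => y cy; rewrite Az_cartan.
have -> : dz c (Azbar c (cartan P)) x = dz c (fun y => cartan P y *m dzbar c P y) x.
  by apply: (dz_ext (smc_mul hu sb) cx) => y cy; rewrite Azbar_cartan.
rewrite (dzbar_mul hu sp cx) (dz_mul hu sb cx) -(dz_comm hP cx) dz_cartan // dzbar_cartan //.
have e1 : dzbar c (dz c P) x = dzbar c (dz c P) x *m P x + dz c P x *m dzbar c P x +
   (dzbar c P x *m dz c P x + P x *m dzbar c (dz c P) x).
  rewrite -(dzbar_mul sp hP cx) -(dzbar_mul hP sp cx) -(dzbar_add (smc_mul sp hP) (smc_mul hP sp) cx).
  apply: (dzbar_ext (smc_add (smc_mul sp hP) (smc_mul hP sp)) cx) => y cy.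
  by rewrite -dz_proj.
move: e1; rewrite cartan2.
set r := dzbar c (dz c P) x; set p := dz c P x; set b := dzbar c P x; set Q := P x.
clearbody r p b Q => e1 e2.
have e3 : p *m b + b *m p = r - r *m Q - Q *m r.
  by rewrite [X in _ = X - _ - _]e1 -[RHS]addrA -opprD [r *m Q + _]addrC addrACA addrK.
have e4 : 2 *: (p *m b + b *m p + (2 *: (Q *m r) - r)) = 0.
  by rewrite -[RHS]e2 -!scalemxAl mulmxBl mul1mx -scalemxAl double_split.
move/eqP: e4; rewrite scaler_eq0 pnatr_eq0 /= e3 scaler_nat mulr2n => /eqP e4.
apply/eqP; rewrite eq_sym -subr_eq0 -[X in _ == X]e4; apply/eqP.
exact: cancel_mid.
Qed.
End Conclude.

(** * The cyclic frame of a superconformal map *)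

Section Frame.
Variables (R : realType) (M : riemann_surface R) (n : nat).
Local Notation C := (Cx R).
Variable phi : M -> 'M[C]_n.
Hypothesis phi_CP : map_to_CP phi.
Hypothesis phi_harmonic : harmonic_map (cartan phi).
Variable G : nat -> M -> 'M[C]_n.
Hypothesis G0 : G 0%N = phi.
Hypothesis gG : forall i, gauss_bundle (G i) (G i.+1).
Hypothesis n1 : (0 < n.-1)%N.
Hypothesis horth : forall i, (0 < i <= n.-1)%N -> orthogonal_bundles phi (G i).
Hypothesis hmax : forall t, (forall i, (0 < i <= t)%N -> orthogonal_bundles phi (G i)) -> (t <= n.-1)%N.

Lemma gauss_subbundle i : subbundle (G i).
Proof. by case: i => [|i]; [rewrite G0; case: phi_CP|case: (gG i)]. Qed.

Lemma orth0 i x : (0 < i <= n.-1)%N -> G 0%N x *m G i x = 0.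
Proof.
move=> hi; apply/(proj_orth (projG gauss_subbundle 0 x) (projG gauss_subbundle i x)) => v w hv hw.
by apply: (horth hi (x := x)) => //; rewrite -G0.
Qed.

Lemma orth_all k : (k <= n.-1)%N -> orth_upto G k /\
  forall i c x, (0 < i <= k)%N -> rs_atlas c -> cdom c x -> backward G c i x.
Proof.
elim: k => [|k IH] kn.
  split => [i j /andP [ij]|i c x].
    by rewrite leqn0 => /eqP j0; move: ij; rewrite j0 ltn0.
  by case: i.
have [ok zk] := IH (ltnW kn).
have ok1 : orth_upto G k.+1.
  move=> i j /andP [ij]; rewrite leq_eqVlt => /orP [/eqP ej|jk] x; last first.
    by apply: ok; rewrite ij.
  subst j; case: i ij => [|i] ij; first by apply: orth0; rewrite /= kn.
  apply: (orth_step gauss_subbundle gG ok) => // i' c y /andP [i0 ik].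
  by apply: zk; rewrite i0 ltnW.
split => // i c x /andP [i0]; rewrite leq_eqVlt => /orP [/eqP ->|ik] rc cx; last first.
  by apply: zk; rewrite ?i0.
case: k kn IH ok zk ok1 {i i0} => [|k] kn IH ok zk ok1.
  apply: (backward_of_E gauss_subbundle gG rc) => // y cy.
  have := harmonic_comm (gauss_subbundle 0) _ rc cy; rewrite {1}G0 => /(_ phi_harmonic) h.
  by rewrite -mulmxA h mulmxA (EG gauss_subbundle gG) mul0mx.
apply: (backward_step gauss_subbundle gG rc) => // [y cy|y]; first by apply: zk => //=.
by apply: ok1; rewrite leqnSn /=.
Qed.

Lemma gauss_orth i j x : (i < n)%N -> (j < n)%N -> i != j -> G i x *m G j x = 0.
Proof.
move=> hi hj; rewrite neq_ltn => /orP [ij|ij].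
  by apply: (orth_all (leqnn _)).1; rewrite ij /= -ltnS (ltn_predK hi).
apply: (proj_sym (projG gauss_subbundle _ _) (projG gauss_subbundle _ _)).
by apply: (orth_all (leqnn _)).1; rewrite ij /= -ltnS (ltn_predK hi).
Qed.

Lemma gauss_orth_last i x : (0 < i < n)%N -> G i x *m G n x = 0.
Proof.
move=> /andP [i0 ni]; have e := ltn_predK ni.
have -> : G n = G n.-1.+1 by congr G; rewrite e.
have [ok zk] := orth_all (leqnn n.-1).
apply: (orth_step gauss_subbundle gG ok) => [j c y /andP [j0 jn] rc cy|]; last by rewrite i0 -ltnS e.
by apply: zk => //; rewrite j0 ltnW.
Qed.

(** A nonzero projection equals its square, so its norm is bounded below:
    vanishing is an open and closed condition. *)
Lemma near_zero_or (i : nat) (x : M) : \forall y \near x, (G i y == 0) = (G i x == 0).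
Proof.
have [c rc cx] := rs_cover x.
have cont e : 0 < e -> \forall y \near x, frobenius (G i y - G i x) <= e.
  move=> e0; have h := sm_cont (mxnorm_qn R n n) (@openOm _ _ c) (smG gauss_subbundle i rc) (pt_Om cx) e0.
  move: (near_pt cx h) (near_cdom cx); apply: filterS2 => y; rewrite /mxnorm lee_fin.
  by move=> + cy; rewrite !from_pt.
have big y : G i y != 0 -> 1 <= (n * n * n)%:R * frobenius (G i y).
  move=> nz; have f0 : 0 < frobenius (G i y).
    rewrite lt_neqAle frob_ge0 andbT eq_sym; apply/eqP => e.
    by move: nz; rewrite (frob_eq0 (A := G i y)) ?eqxx // e.
  by have := frobM (G i y) (G i y); rewrite (idemG gauss_subbundle) mulrA -{1}[frobenius _]mul1r ler_pM2r.
have K0 : 0 <= (n * n * n)%:R :> R by [].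
set K := (n * n * n)%:R in K0 big; have K1 : 0 < 2 * (K + 1) by rewrite mulr_gt0 // ltr_wpDl.
have [z|nz] := eqVneq (G i x) 0.
  have d0 : 0 < (K + 1)^-1 by rewrite invr_gt0 ltr_wpDl.
  have := cont _ d0; apply: filterS => y; rewrite z subr0 => hy; apply/negP => /negP /big h.
  have : K * frobenius (G i y) <= K * (K + 1)^-1 by rewrite ler_wpM2l.
  have : K * (K + 1)^-1 < 1 by rewrite ltr_pdivrMr ?ltr_wpDl // mul1r ltrDl.
  lra.
have f0 : 0 < frobenius (G i x).
  rewrite lt_neqAle frob_ge0 andbT eq_sym; apply/eqP => e.
  by move: nz; rewrite (frob_eq0 (A := G i x)) ?eqxx // e.
have := cont _ (divr_gt0 f0 (ltr0Sn _ 1)); apply: filterS => y hy; apply/negP => /eqP z.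
by move: hy; rewrite z sub0r -scaleN1r frobZ cmodN (cmod_rcst 1) normr1 mul1r; lra.
Qed.

Lemma all_zero i x0 x : G i x0 = 0 -> G i x = 0.
Proof.
move=> z.
have e : [set y | G i y = 0] = setT.
  apply: (@rs_connected _ M); first by exists x0.
  - exists [set y | G i y = 0]; last by rewrite setTI.
    rewrite openE => y /= zy; have := near_zero_or i y.
    by apply: filterS => w; rewrite zy eqxx => /eqP.
  - exists [set y | G i y = 0]; last by rewrite setTI.
    rewrite -openC openE => y /= /eqP zy; have := near_zero_or i y.
    by apply: filterS => w; rewrite (negbTE zy) => /negbT /eqP.
by have : [set y | G i y = 0] x by rewrite e.
Qed.

Lemma zeroS i : (forall x, G i x = 0) -> forall x, G i.+1 x = 0.
Proof.
move=> z x; have [c rc cx] := rs_cover x.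
apply: (everywhere gauss_subbundle gG (i := i) (F := G i.+1) rc cx (smG gauss_subbundle _ rc)).
move=> y cy gy; rewrite -[G i.+1 y]mul1mx; apply: (generic_P gauss_subbundle gy rc cy).
by rewrite /shiftmx z mulmx0 mulmx0.
Qed.

(** If G i vanished, so would G n, and phi would be orthogonal to its first n
    successors. *)
Lemma G_neq0 i x : (i <= n)%N -> G i x != 0.
Proof.
move=> hi; apply/eqP => z.
have zn x' : G n x' = 0.
  have -> : G n = G (i + (n - i))%N by congr G; rewrite subnKC.
  elim: (n - i)%N x' => [|k IH] x'; first by rewrite addn0; exact: all_zero z.
  by rewrite addnS; apply: zeroS.
have /hmax : forall i, (0 < i <= n)%N -> orthogonal_bundles phi (G i).
  move=> j /andP [j0]; rewrite leq_eqVlt => /orP [/eqP ->|jn].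
    by move=> y v w hv hw; rewrite -hw zn mul0mx mulmx0.
  by apply: horth; rewrite j0 -ltnS (ltn_predK jn).
by case: (n) n1 => // k _; rewrite ltnn.
Qed.

Lemma proj_vec (P : 'M[C]_n) : P != 0 -> exists v : 'cV[C]_n, P *m v != 0.
Proof.
move=> nz; apply: contrapT => h; move: nz => /eqP; apply; apply: mulmx_cols => v.
by rewrite mul0mx; apply/eqP; apply: contrapT => /negP hv; apply: h; exists v.
Qed.

(** Nonzero vectors, one in each line, form an invertible matrix that the sum
    of the projections fixes. *)
Lemma sum_gauss x : \sum_(a < n) G a x = 1%:M.
Proof.
have [f [GF fnz]] : exists f : 'I_n -> 'cV[C]_n,
    (forall a b, G (a : 'I_n) x *m f b = if a == b then f b else 0) /\ forall a, f a != 0.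
  have hv (a : 'I_n) : {v : 'cV[C]_n | G a x *m v != 0}.
    by apply: cid; apply: proj_vec; apply: G_neq0; exact: ltnW.
  exists (fun a : 'I_n => G a x *m sval (hv a)); split => [a b|a]; last exact: (svalP (hv a)).
  rewrite mulmxA; case: eqP => [->|/eqP ab]; first by rewrite (idemG gauss_subbundle).
  by rewrite gauss_orth // mul0mx.
pose F : 'M[C]_n := \matrix_(i, j) f j i 0.
have colF a : col a F = f a by apply/matrixP => i j; rewrite ord1 mxE mxE.
have SF : (\sum_(a < n) G a x) *m F = F.
  apply/matrixP => i j; have : (\sum_(a < n) G a x) *m f j = f j.
    by rewrite mulmx_suml (bigD1 j) //= GF eqxx big1 ?addr0 // => a /negbTE aj; rewrite GF aj.
  rewrite -colF colE mulmxA -colE -colE => /matrixP /(_ i 0).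
  by rewrite [col j _ _ _]mxE [in RHS]mxE.
have FF : F^t* *m F = diag_mx (\row_j ((f j)^t* *m f j) 0 0).
  apply/matrixP => i j.
  have -> : (F^t* *m F) i j = ((f i)^t* *m f j) 0 0.
    rewrite [LHS]mxE [RHS]mxE; apply: eq_bigr => k _; congr (_ * _); last by rewrite mxE.
    by rewrite mxE mxE [F _ _]mxE [in RHS]mxE [in RHS]mxE.
  rewrite [RHS]mxE; case: eqP => [->|/eqP ij]; first by rewrite mulr1n [RHS]mxE.
  rewrite mulr0n; have -> : (f i)^t* *m f j = 0; last by rewrite mxE.
  have -> : f i = G i x *m f i by rewrite GF eqxx.
  by rewrite adjM (adjG gauss_subbundle) -mulmxA GF (negbTE ij) mulmx0.
have uF : F \in unitmx.
  have : F^t* *m F \in unitmx.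
    rewrite FF unitmxE det_diag unitfE; apply/prodf_neq0 => j _; rewrite mxE.
    apply/eqP => z; move: (fnz j) => /eqP; apply.
    apply/matrixP => i k; rewrite ord1 [RHS]mxE; apply: cmod_eq0.
    have h0 : \sum_r (f j r 0)^* * f j r 0 = 0.
      by rewrite -[RHS]z mxE; apply: eq_bigr => r _; rewrite mxE mxE.
    have : (f j i 0)^* * f j i 0 = 0.
      move: h0 => /eqP; rewrite psumr_eq0 => [/allP /(_ i (mem_index_enum i)) /eqP //|r _].
      by rewrite mulrC -normCK exprn_ge0.
    by rewrite mulrC -normCK => /eqP; rewrite expf_eq0 normCE /= eq_complex /= eqxx andbT => /eqP.
  by rewrite unitmx_mul => /andP [].
by rewrite -[LHS]mulmx1 -(mulmxV uF) mulmxA SF.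
Qed.

(** G n is orthogonal to G 1, ..., G n.-1, so it lies in the line G 0, and it
    does not vanish. *)
Lemma gauss_periodic x : G n x = G 0%N x.
Proof.
have n0 : (0 < n)%N by case: (n) n1.
have e1 : G 0%N x *m G n x = G n x.
  have := sum_gauss x => /(congr1 (fun A => A *m G n x)); rewrite mul1mx mulmx_suml.
  rewrite (bigD1 (Ordinal n0)) //= big1 ?addr0 // => a a0; apply: gauss_orth_last.
  by rewrite ltn_ord andbT lt0n.
have e2 : G n x *m G 0%N x = G n x.
  by move: e1 => /(congr1 (fun A => A^t* )); rewrite adjM !(adjG gauss_subbundle).
have r1 : \rank (G 0%N x) = 1%N by rewrite G0; case: phi_CP.
have sub : (G n x <= G 0%N x)%MS by apply/submxP; exists (G n x); rewrite e2.
have /eqmxP e : (G n x == G 0%N x)%MS.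
  rewrite -(geq_leqif (mxrank_leqif_eq sub)) r1 lt0n mxrank_eq0; exact: G_neq0.
have /submxP [D h] : (G 0%N x <= G n x)%MS by rewrite e.
by rewrite -[LHS]e1 {1}h -mulmxA (idemG gauss_subbundle) -h.
Qed.
End Frame.

(** * Levels *)

Section Levels.
Local Open Scope int_scope.

(** lambda^k G a lies in S_i exactly when lev n k a <= i. The formula counts
    steps along the cycle of lines, where the steps leaving the lines 0 and
    n.-1 also lower k by one. *)
Definition lev (n : nat) (k : int) (a : nat) : int :=
  let m := - k - (0 < a)%N%:Z in (m %/ 2)%Z * n%:Z + a%:Z + (m %% 2)%Z.

(** The power of lambda lost on the step that leaves line b. *)
Definition eps (n b : nat) : int := ((b == 0) || (b == n.-1))%N%:Z.
Definition succ_mod (n b : nat) : nat := if b.+1 == n then 0%N else b.+1.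

Lemma levE n k a q r : (0 <= r < 2)%R -> - k - (0 < a)%N%:Z = q * 2 + r -> lev n k a = q * n%:Z + a%:Z + r.
Proof.
move=> hr; rewrite /lev => ->; rewrite divzMDl // modzMDl divz_small // modz_small //.
by rewrite addr0.
Qed.

Lemma lev_dec k a : exists q r, (0 <= r < 2)%R /\ - k - (0 < a)%N%:Z = q * 2 + r :> int.
Proof.
set m := _ - _; exists (m %/ 2)%Z, (m %% 2)%Z; split; last exact: divz_eq.
by rewrite modz_ge0 //= ltz_pmod.
Qed.

Lemma lev_shift n k a : lev n (k - 2) a = lev n k a + n%:Z.
Proof.
have [q [r [hr e]]] := lev_dec k a.
rewrite (levE n hr e) (levE n (q := q + 1) hr); first by rewrite mulrDl mul1r; lia.
by rewrite mulrDl mul1r; lia.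
Qed.

Lemma lev_shiftn n k a j : lev n (k - (2 * j)%N%:Z) a = lev n k a + (j * n)%N%:Z.
Proof.
elim: j => [|j IH]; first by rewrite muln0 subr0 mul0n addr0.
have -> : k - (2 * j.+1)%N%:Z = k - (2 * j)%N%:Z - 2 by lia.
by rewrite lev_shift IH mulSn; lia.
Qed.

Lemma lev_pos n k a : (a < n)%N -> (0 < lev n k a)%R = (k < 0)%R.
Proof.
move=> an; have [q [r [hr e]]] := lev_dec k a; rewrite (levE n hr e).
have h : (0 < q -> n%:Z <= q * n%:Z)%R by nia.
have h' : (q < 0 -> q * n%:Z <= - n%:Z)%R by nia.
have h0 : q = 0 -> q * n%:Z = 0 by nia.
move: h h' h0; set qn := q * n%:Z => h h' h0; apply/idP/idP; lia.
Qed.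

Lemma lev_inj n k k' a : (1 < n)%N -> lev n k a = lev n k' a -> k = k'.
Proof.
move=> n1; have [q [r [hr e]]] := lev_dec k a; have [q' [r' [hr' e']]] := lev_dec k' a.
rewrite (levE n hr e) (levE n hr' e') => h.
have : q = q' by nia.
by move=> qq; move: h; rewrite qq; lia.
Qed.

(** The step of T from lambda^(k + eps n b) G b arrives at lambda^k G a, where
    a is the line after b. *)
Lemma lev_step n k b : (1 < n)%N -> (b < n)%N ->
  lev n (k + eps n b) b + 1 = lev n k (succ_mod n b).
Proof.
move=> n1 bn; have [q [r [hr e]]] := lev_dec (k + eps n b) b; rewrite (levE n hr e).
rewrite /succ_mod; case: eqP => [bn1|bn1].
  rewrite (levE n (q := q + 1) hr); first by rewrite mulrDl mul1r; lia.
  have e1 : eps n b = 1 by rewrite /eps; case: eqP; case: eqP; lia.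
  by move: e; rewrite e1; lia.
rewrite (levE n (q := q) hr); first by lia.
move: e; rewrite /eps; case: eqP; case: eqP; lia.
Qed.

Lemma succ_mod_lt n b : (b < n)%N -> (succ_mod n b < n)%N.
Proof. by rewrite /succ_mod; case: eqP; lia. Qed.

Lemma succ_mod_surj n a : (1 < n)%N -> (a < n)%N -> exists2 b, (b < n)%N & succ_mod n b = a.
Proof.
move=> n1 an; case: a an => [|a] an.
  by exists n.-1; [lia|rewrite /succ_mod prednK ?eqxx //; lia].
by exists a; [lia|rewrite /succ_mod ifN_eq //; lia].
Qed.
End Levels.

(** * Multiplication by smooth families of matrix loops *)

Section Families.
Variables (R : realType).
Local Notation C := (Cx R).
Local Notation mxn := (@mxnorm R _ _).
Local Notation arc := (`[0, 2 * pi]%classic : set R).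

Lemma dderiv_fin (V : normedModType R) (E : lmodType C) (N : E -> \bar R) (f : V -> E) p v d :
  quasi_norm N -> (\forall q \near p, (N (f q) < +oo)%E) -> is_dirderiv N f p v d -> (N d < +oo)%E.
Proof.
move=> qN hf /(dderivP qN) h.
have h1 : \forall t \near (0 : R)^', (N (f (p + t *: v)%R) < +oo)%E by exact: (near_line v hf).
have [t [ft ht]] := filter_ex (filterI h1 (h 1 ltr01)).
have -> : d = diffq f p v t + (- (diffq f p v t - d)) by rewrite opprB addrCA subrr addr0.
apply: (qn_fin qN).
  apply: (qn_finZ qN); apply: (qn_fin qN) => //.
  by rewrite (qn_N qN); exact: nbhs_singleton hf.
by rewrite (qn_N qN); apply: le_lt_trans ht (ltry _).
Qed.

Lemma open_snd (V V' : normedModType R) (U : set V) : open U -> open [set q : V' * V | U q.2].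
Proof.
move=> oU; rewrite openE => -[t p] /= Up.
exact: (@cvg_snd _ _ (nbhs t) (nbhs p) _ _ (near_open oU Up)).
Qed.

(** The bound comes from the compactness of the circle. *)
Lemma joint_fin (V : normedModType R) m k (U : set V) (Psi : S1 R -> V -> 'M[C]_(m, k)) p :
  open U -> smooth_coord mxn [set q : R * V | U q.2] (fun q : R * V => Psi (circle q.1) q.2) ->
  U p -> (supnorm (Psi^~ p) < +oo)%E.
Proof.
move=> oU hP Up; have qn := mxnorm_qn R m k.
have /compact_near_coveringP cov : compact arc by exact: segment_compact.
have cD t : null (nbhs (t, p)) (fun q : R * V => mxn (Psi (circle q.1) q.2 - Psi (circle t) p)).
  exact: (sm_cont qn (open_snd oU) hP).
have near_fst (P : R * V -> Prop) t : (\forall q \near ((t, p) : R * V), P q) -> \forall t' \near t, P (t', p).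
  by move=> [[A B] /= [hA hB] hAB]; move: hA; apply: filterS => t' At; apply: hAB; split => //=; exact: nbhs_singleton.
have hc (t : R) : arc t -> \forall t' \near t & y \near +oo, frobenius (Psi (circle t') p) <= y.
  move=> _; have h := near_fst _ _ (cD t 1 ltr01).
  set m0 := 2 * (1 + frobenius (Psi (circle t) p)).
  exists ([set t' | frobenius (Psi (circle t') p - Psi (circle t) p) <= 1], [set y | m0 <= y]).
    split => /=; first by move: h; apply: filterS => t'; rewrite /mxnorm lee_fin.
    by exists m0; split; [exact: num_real|move=> y; exact: ltW].
  move=> -[t' y] /= [ht hy]; apply: le_trans hy.
  rewrite -[Psi (circle t') p](subrK (Psi (circle t) p)); apply: (le_trans (frobD _ _)).
  by rewrite ler_pM2l // lerD2r.
have h : \forall y \near +oo, arc `<=` (fun t => frobenius (Psi (circle t) p) <= y).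
  exact: (cov R +oo%R (fun y t => frobenius (Psi (circle t) p) <= y) _ hc).
have h0 : \forall y \near (+oo : set_system R), 0 <= y by exact: nbhs_pinfty_ge.
have [y [hy y0]] := filter_ex (filterI h h0).
apply: (@le_lt_trans _ _ y%:E); last exact: ltry.
apply/supnormP; split => // [i j|l]; last by rewrite -(argK l); apply: hy; exact: arg_itv.
have mt (rho : 'M[C]_(m, k) -> R) : rlin rho -> measurable_fun arc (fun t => rho (Psi (circle t) p)).
  move=> [rB _ rM]; apply: measurable_funTS; apply: continuous_measurable_fun => t.
  apply/cvgrPdist_le => e e0; have := near_fst _ _ (cD t e e0); apply: filterS => t'.
  rewrite /mxnorm lee_fin => ht.
  by rewrite distrC -rB; exact: le_trans (rM _) ht.
by split; apply: (mt (fun A => _ (A i j))); [exact: rlin_Re|exact: rlin_Im].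
Qed.

Section Lmul.
Variable n : nat.
Local Notation loop := (loop R n).
Local Notation l2n := (@l2norm R n).
Local Notation sup := (@supnorm R n n).

Definition lmul (A : S1 R -> 'M[C]_n) (f : loop) : loop := fun l => A l *m f l.

Lemma lmulDr A f g : lmul A (f + g) = lmul A f + lmul A g.
Proof. by apply/funext => l; rewrite /lmul [LHS]mulmxDr. Qed.
Lemma lmulZr A c f : lmul A (c *: f) = c *: lmul A f.
Proof. by apply/funext => l; rewrite /lmul [RHS](scalemxAr c (A l) (f l)). Qed.
Lemma lmulNr A f : lmul A (- f) = - lmul A f.
Proof. by rewrite -scaleN1r lmulZr scaleN1r. Qed.
Lemma lmulM A B f : lmul A (lmul B f) = lmul (fun l => A l *m B l) f.
Proof. by apply/funext => l; rewrite /lmul mulmxA. Qed.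

Lemma lmul_fin A f : (sup A < +oo)%E -> L2 f -> L2 (lmul A f).
Proof.
move=> /(qn_finP (supnorm_qn R n n)) [a _ ha] /L2P [x hx]; apply/L2P.
exists ((n * 1 * n)%:R * (a * x)); exact: (l2norm_mul ha hx).
Qed.

Lemma lmul_l2eq A f g : (sup A < +oo)%E -> l2eq f g -> l2eq (lmul A f) (lmul A g).
Proof.
move=> /(qn_finP (supnorm_qn R n n)) [a _ ha] /l2norm0P fg; apply/l2norm0P.
have := l2norm_mul ha fg; rewrite !mulr0.
by rewrite -[X in l2norm X]/(lmul A (f - g)) lmulDr lmulNr.
Qed.

Lemma opnorm_le (A : loop -> loop) (x : R) : 0 <= x ->
  (forall f (y : R), (l2n f <= y%:E)%E -> (l2n (A f) <= (x * y)%:E)%E) ->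
  (opnorm A <= x%:E)%E.
Proof.
move=> x0 h; apply: ereal_inf_lbound; exists x => //; split => // f /L2P [y hy].
have := qn_ge0 (l2norm_qn R n) f; move: hy; case e : (l2n f) => [r| |] // _ _.
by rewrite -EFinM; apply: h; rewrite e.
Qed.

Lemma lmul_opnorm A (x : R) : (sup A <= x%:E)%E -> (opnorm (lmul A) <= ((n * 1 * n)%:R * x)%:E)%E.
Proof.
move=> hx; have [x0 _ _] := (supnormP _ _).1 hx.
by apply: opnorm_le => [|f y hy]; [rewrite mulr_ge0|rewrite -mulrA; exact: (l2norm_mul hx hy)].
Qed.

Lemma lmul_bounded A : (sup A < +oo)%E -> bounded_operator (lmul A).
Proof.
move=> hA; split.
  have [a _ /lmul_opnorm ha] := qn_finP (supnorm_qn R n n) hA.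
  by apply: le_lt_trans ha (ltry _).
by move=> c f g _ _; rewrite lmulDr lmulZr; exact: l2eq_refl.
Qed.

Lemma opnorm_ge0 (A : loop -> loop) : (0 <= opnorm A)%E.
Proof. by apply: le_ereal_inf_tmp => _ [w [w0 _] <-]; rewrite lee_fin. Qed.

(** The slack e is there because opnorm is an infimum. *)
Lemma opnorm_bound (A : loop -> loop) f (x y : R) : (opnorm A <= x%:E)%E -> (l2n f <= y%:E)%E ->
  forall e : R, 0 < e -> (l2n (A f) <= ((x + e) * y)%:E)%E.
Proof.
move=> hA hf e e0.
have : (opnorm A < (x + e)%:E)%E by apply: le_lt_trans hA _; rewrite lte_fin ltrDl.
move=> /ereal_inf_lt [_ [w [w0 hw] <-]]; rewrite lte_fin => wx.
have /hw h : L2 f by apply/L2P; exists y.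
apply: (le_trans h); rewrite EFinM; apply: lee_pmul => //.
- exact: (qn_ge0 (l2norm_qn R n)).
- by rewrite lee_fin ltW.
Qed.

Lemma sm_op (V : normedModType R) (U : set V) (F : V -> S1 R -> 'M[C]_n) :
  smooth_coord sup U F -> smooth_coord (@opnorm R n) U (fun p => lmul (F p)).
Proof.
apply: (sm_lin (K := (n * 1 * n)%:R) (supnorm_qn R n n) opnorm_ge0) => // [c A B|A x].
  by apply/funext => f; apply/funext => l; rewrite /lmul [LHS]mulmxDl -[X in X + _]scalemxAl.
exact: lmul_opnorm.
Qed.
End Lmul.
End Families.

Section JointCharts.
Variables (R : realType) (M : riemann_surface R).
Local Notation C := (Cx R).
Local Notation mxn := (@mxnorm R _ _).
Variables (c : chart R M) (rc : rs_atlas c).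
Local Notation fc := (from_coord c).
Local Notation sup := (@supnorm R _ _).

Definition joint_smooth m k (U : set M) (Psi : S1 R -> M -> 'M[C]_(m, k)) :=
  smooth_coord mxn [set q : R * (R * R) | coord_set c U q.2]
    (fun q : R * (R * R) => Psi (circle q.1) (fc q.2)).

Lemma jsm_open U : open U -> open [set q : R * (R * R) | coord_set c U q.2].
Proof. by move=> oU; apply: open_snd; exact: open_coord. Qed.

Lemma jsm_mul m k r U (A : S1 R -> M -> 'M[C]_(m, k)) (B : S1 R -> M -> 'M[C]_(k, r)) : open U ->
  joint_smooth U A -> joint_smooth U B -> joint_smooth U (fun l x => A l x *m B l x).
Proof. by move=> oU; apply: sm_mul; exact: jsm_open. Qed.

Lemma jsm_adj m k U (A : S1 R -> M -> 'M[C]_(m, k)) : open U ->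
  joint_smooth U A -> joint_smooth U (fun l x => (A l x)^t* ).
Proof. by move=> oU; apply: sm_adj; exact: jsm_open. Qed.

Lemma jsm_cst m k U (F : M -> 'M[C]_(m, k)) :
  smooth_coord mxn (coord_set c U) (fun p => F (fc p)) -> joint_smooth U (fun=> F).
Proof. by move=> h; exact: (@sm_snd R (R * R)%type R _ mxn _ _ (mxnorm_qn R m k) h). Qed.

Lemma jsm_sub m k U U' (A : S1 R -> M -> 'M[C]_(m, k)) : U' `<=` U -> joint_smooth U A -> joint_smooth U' A.
Proof. by move=> UU; apply: sm_sub => q [x [cx /UU Ux] e]; exists x. Qed.

Lemma jsm_sup m k U (A : S1 R -> M -> 'M[C]_(m, k)) : open U -> joint_smooth U A ->
  smooth_coord sup (coord_set c U) (fun p l => A l (fc p)).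
Proof. by move=> oU; apply: (sm_joint (Psi := fun l p => A l (fc p))); exact: open_coord. Qed.

Lemma jsm_fin m k U (A : S1 R -> M -> 'M[C]_(m, k)) x : open U -> cdom c x -> U x -> joint_smooth U A ->
  (sup (A^~ x) < +oo)%E.
Proof.
move=> oU cx Ux hA; rewrite -{1}(from_pt cx).
exact: (joint_fin (Psi := fun l p => A l (fc p)) (open_coord oU) hA (pt_coord cx Ux)).
Qed.

Lemma jsm_wirt m k U (A : S1 R -> M -> 'M[C]_(m, k)) x : open U -> cdom c x -> U x -> joint_smooth U A ->
  wirt sup (- imC R) (fun q l => A l (fc q)) (pt c x) (fun l => dz c (A l) x).
Proof.
move=> oU cx Ux hA; have oU' := open_coord (c := c) oU; have pU := pt_coord cx Ux.
have qs := supnorm_qn R m k; have hs := jsm_sup oU hA.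
have [fx [_ hx]] := sm_dd ((1, 0) : R * R) qs oU' hs.
have [fy [_ hy]] := sm_dd ((0, 1) : R * R) qs oU' hs.
exists (fx (pt c x)), (fy (pt c x)); split; [exact: hx|exact: hy|].
apply/funext => l; rewrite -[RHS]/(2^-1 *: (fx (pt c x) l + - imC R *: fy (pt c x) l)).
apply: dz_is; exists (fx (pt c x) l), (fy (pt c x) l); split => //.
- exact: (supnorm_eval l (hx _ pU)).
- exact: (supnorm_eval l (hy _ pU)).
Qed.

Lemma jsm_dz m k U (A : S1 R -> M -> 'M[C]_(m, k)) x l : open U -> cdom c x -> U x -> joint_smooth U A ->
  wirt mxn (- imC R) (fun q => A l (fc q)) (pt c x) (dz c (A l) x).
Proof.
move=> oU cx Ux /(jsm_wirt oU cx Ux) [dx [dy [hx hy e]]]; exists (dx l), (dy l).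
by split; [exact: supnorm_eval hx|exact: supnorm_eval hy|exact: (congr1 (fun f => f l) e)].
Qed.
End JointCharts.

Section WirtLin.
Variable R : realType.
Local Notation C := (Cx R).
Local Notation V := (R * R)%type.

Lemma wirt_fin (E : lmodType C) (N : E -> \bar R) k (f : V -> E) p d : quasi_norm N ->
  (\forall q \near p, (N (f q) < +oo)%E) -> wirt N k f p d -> (N d < +oo)%E.
Proof.
move=> qN hf [dx [dy [hx hy ->]]]; apply: (qn_finZ qN); apply: (qn_fin qN); last apply: (qn_finZ qN).
  exact: (dderiv_fin qN hf hx).
exact: (dderiv_fin qN hf hy).
Qed.

Lemma wirt_map (E E' : lmodType C) (N : E -> \bar R) (N' : E' -> \bar R) (L : E -> E') (K : R)
  k (f : V -> E) p d : quasi_norm N -> quasi_norm N' ->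
  (forall c a b, (N a < +oo)%E -> (N b < +oo)%E -> L (c *: a + b) = c *: L a + L b) -> 0 <= K ->
  (forall a (x : R), (N a <= x%:E)%E -> (N' (L a) <= (K * x)%:E)%E) ->
  (\forall q \near p, (N (f q) < +oo)%E) -> wirt N k f p d -> wirt N' k (fun q => L (f q)) p (L d).
Proof.
move=> qN qN' LP K0 LK hf [dx [dy [hx hy ->]]].
have fx := dderiv_fin qN hf hx; have fy := dderiv_fin qN hf hy.
exists (L dx), (L dy); split.
- exact: (dderiv_lin qN qN' LP K0 LK hf fx hx).
- exact: (dderiv_lin qN qN' LP K0 LK hf fy hy).
have L0 : L 0 = 0.
  have z : (N 0%R < +oo)%E by rewrite (qn_0 qN) ltry.
  have := LP (- 1) 0 0 z z; rewrite scaler0 add0r scaleN1r addNr.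
  by [].
have LZ c a : (N a < +oo)%E -> L (c *: a) = c *: L a.
  by move=> fa; rewrite -[c *: a]addr0 LP ?L0 ?addr0 // (qn_0 qN) ltry.
rewrite LZ; last by apply: (qn_fin qN) => //; exact: (qn_finZ qN).
by rewrite -[dx + _]addrC LP // addrC.
Qed.
End WirtLin.

Section LoopCalculus.
Variables (R : realType) (n : nat).
Local Notation C := (Cx R).
Local Notation mxn := (@mxnorm R _ _).
Local Notation V := (R * R)%type.

Lemma l2eqD (f f' g g' : loop R n) : l2eq f f' -> l2eq g g' -> l2eq (f + g) (f' + g').
Proof.
move=> /l2norm0P hf /l2norm0P hg; apply/l2norm0P.
have := qn_D (l2norm_qn R n) hf hg; rewrite addr0 mulr0.
by rewrite addrACA -opprD.
Qed.

Lemma fourier_closed (P : int -> 'M[C]_n -> Prop) :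
  closed_subspace [set f : loop R n | L2 f /\ forall k B, P k B -> B *m fourier f k = 0].
Proof.
split => [f [] //|||f hf h].
- by split => [|k B _]; [exact: L2_0|rewrite fourier0 mulmx0].
- move=> z f g [hf sf] [hg sg]; split => [|k B PB]; first exact: L2_comb.
  by rewrite fourierP // mulmxDr -scalemxAr (sf k B PB) (sg k B PB) scaler0 addr0.
split => // k B PB; apply: frob_eq0; apply/ler_addgt0Pr => e e0; rewrite add0r.
have K0 : 0 <= (n * 1 * n)%:R * (frobenius B * fourier_const R n).
  by apply: mulr_ge0; [exact: ler0n|apply: mulr_ge0; [exact: frob_ge0|exact: fourier_const_ge0]].
set K := _ * _ in K0.
have K1 : 0 < K + 1 by rewrite ltr_wpDl.
have [g [hg sg] fg] := h (e / (K + 1)) (divr_gt0 e0 K1).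
have -> : B *m fourier f k = B *m fourier (f - g) k.
  by rewrite (fourierB k hf hg) mulmxBr (sg k B PB) subr0.
apply: (le_trans (frobM _ _)).
have h1 := fourier_bound k (ltW fg).
apply: (@le_trans _ _ (K * (e / (K + 1)))).
  have -> t : K * t = (n * 1 * n)%:R * (frobenius B * (fourier_const R n * t)) by rewrite /K !mulrA.
  by apply: ler_wpM2l; [exact: ler0n|apply: ler_wpM2l h1; exact: frob_ge0].
by rewrite mulrCA ler_piMr ?(ltW e0) // ler_pdivrMr // mul1r lerDl.
Qed.

Lemma wirt_fourier k (s : V -> loop R n) j p d : (\forall q \near p, L2 (s q)) ->
  wirt (@l2norm R n) k s p d -> wirt mxn k (fun q => fourier (s q) j) p (fourier d j).
Proof.
move=> hs; apply: (wirt_map (L := fun f => fourier f j) (l2norm_qn R n) (mxnorm_qn R n 1) _ (fourier_const_ge0 R n) _ hs).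
  by move=> c a b; exact: fourierP.
by move=> a x ha; rewrite /mxnorm lee_fin; exact: fourier_bound.
Qed.

Lemma wirt_lmul k (A : V -> S1 R -> 'M[C]_n) (s : V -> loop R n) p a d :
  (\forall q \near p, (supnorm (A q) < +oo)%E) -> (\forall q \near p, L2 (s q)) ->
  wirt (@supnorm R n n) k A p a -> wirt (@l2norm R n) k s p d ->
  wirt (@l2norm R n) k (fun q => lmul (A q) (s q)) p (lmul a (s p) + lmul (A p) d).
Proof.
move=> hA hs; have K0 : 0 <= (n * 1 * n)%:R :> R by [].
apply: (wirt_bil (supnorm_qn R n n) (l2norm_qn R n) (l2norm_qn R n) (B := @lmul R n) _ _ _ _ K0 (@l2norm_mul R n)).
- by move=> B B' f; apply/funext => l; rewrite /lmul [LHS]mulmxDl.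
- exact: lmulDr.
- by move=> c B f; apply/funext => l; rewrite /lmul [RHS]scalemxAl.
- by move=> c B f; exact: lmulZr.
- exact: nbhs_singleton hA.
- exact: nbhs_singleton hs.
- by move=> v e; exact: (dderiv_fin (supnorm_qn R n n) hA).
- by move=> v e; exact: (dderiv_fin (l2norm_qn R n) hs).
Qed.
End LoopCalculus.

(** * Smooth subbundles and their limits *)

Section Subbundles.
Variables (R : realType) (M : riemann_surface R) (n : nat).
Local Notation C := (Cx R).
Local Notation loop := (loop R n).
Local Notation l2n := (@l2norm R n).
Local Notation qn := (l2norm_qn R n).

Lemma closed_l2eq (V : set loop) f g : closed_subspace V -> l2eq f g -> V g -> V f.
Proof.
move=> [V2 _ _ Vc] e Vg; apply: Vc; first by apply: (L2_eq e); exact: V2.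
by move=> r r0; exists g => //; rewrite (e : l2norm _ = 0%E) lte_fin.
Qed.

Lemma bounded_fin (A : loop -> loop) f : bounded_operator A -> L2 f -> L2 (A f).
Proof.
move=> [hA _] /L2P [y hy].
have : exists x : R, (opnorm A <= x%:E)%E.
  move: hA (opnorm_ge0 A); case e : (opnorm A) => [x| |] // _ _.
  by exists x.
move=> [x hx]; apply/L2P; exists ((x + 1) * y); exact: (opnorm_bound hx hy).
Qed.

Lemma bounded_sub (A : loop -> loop) f g : bounded_operator A -> L2 f -> L2 g ->
  l2eq (A (f + g)) (A f + A g).
Proof. by move=> [_ h] hf hg; have := h 1 f g hf hg; rewrite !scale1r. Qed.

Lemma bounded_l2eq (A : loop -> loop) f g : bounded_operator A -> L2 g ->
  l2eq f g -> l2eq (A f) (A g).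
Proof.
move=> bA hg e; have hf := L2_eq e hg; have hd : L2 (f - g) by exact: L2B.
have h := bounded_sub bA hd hg; rewrite subrK in h; apply: (l2eq_trans h).
apply/l2norm0P; rewrite addrK.
have : exists x : R, (opnorm A <= x%:E)%E.
  move: bA.1 (opnorm_ge0 A); case ea : (opnorm A) => [x| |] // _ _.
  by exists x.
move=> [x hx]; have e0 : (l2n (f - g)%R <= 0%:E)%E by rewrite (e : l2norm _ = 0%E).
by have := opnorm_bound hx e0 ltr01; rewrite mulr0.
Qed.

Lemma op_cont (U : set M) (g : M -> loop -> loop) x : open U -> U x -> smooth_on (@opnorm R n) U g ->
  null (nbhs x) (fun y => opnorm (g y - g x)).
Proof.
move=> oU Ux sg; have [c rc cx] := rs_cover x.
have [D [D0 hD]] := sg c rc; have pU := pt_coord cx Ux.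
have [h _] := hD [::] _ pU; have {}h : null (nbhs (pt c x)) (fun q => opnorm (D [::] q - D [::] (pt c x))).
  by apply: (iffLR (cvg_null _) h) => q; exact: opnorm_ge0.
move=> e e0; have := near_pt cx (h e e0); have := near_dom oU cx Ux.
apply: filterS2 => y [cy Uy]; rewrite !D0 ?(from_pt cx) ?(from_pt cy) //.
exact: pt_coord.
Qed.

Lemma punctured_ex (x : M) (P : M -> Prop) : (\forall y \near x^', P y) -> exists y, P y.
Proof.
move=> hP; have [c rc cx] := rs_cover x.
have [t Pt] := filter_ex (near_punctured cx hP).
by exists (from_coord c (pt c x + t *: (e1 R))).
Qed.

Lemma op_null (U : set M) (g : M -> loop -> loop) x v : open U -> U x -> smooth_on (@opnorm R n) U g ->
  L2 v -> null (nbhs x) (fun y => l2n (g y v - g x v)).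
Proof.
move=> oU Ux sg /L2P [b hb] e e0; have c := op_cont oU Ux sg.
have b0 : 0 <= b by have := le_trans (qn_ge0 qn v) hb; rewrite lee_fin.
set k := e / (2 * (b + 1)); have k0 : 0 < k by rewrite divr_gt0 // mulr_gt0 // ltr_wpDl.
have := c k k0; apply: filterS => y hy.
rewrite -[X in l2n X]/((g y - g x) v); apply: (le_trans (opnorm_bound hy hb k0)).
have kE : k * (2 * (b + 1)) = e by rewrite /k mulfVK // lt0r_neq0 // mulr_gt0 // ltr_wpDl.
by rewrite lee_fin; move: kE k0; lra.
Qed.

(** Write f in W x as g x v. For y near x the vector g y v lies in W' y, so
    that h' y (g y v) lies in the fixed closed space V'; as y tends to x, so
    does its limit h' x (g x v). *)
Lemma subbundle_limit (U : set M) (W W' : M -> set loop) x : smooth_subbundle U W -> smooth_subbundle U W' ->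
  U x -> (\forall y \near x^', W y `<=` W' y) -> W x `<=` W' x.
Proof.
move=> sW sW' Ux sub; have [N [V [g [h [[oN Nx] cV [sg sh] bd Weq]]]]] := sW x Ux.
have [N' [V' [g' [h' [[oN' Nx'] cV' [sg' sh'] bd' Weq']]]]] := sW' x Ux.
rewrite (Weq x Nx) (Weq' x Nx') => f /= [v Vv fv].
have L2v : L2 v by have [V2 _ _ _] := cV; exact: V2.
have [bg _ _] := bd x Nx; have [bg' bh' mi'] := bd' x Nx'.
have L2u : L2 (g x v) by exact: bounded_fin.
exists (h' x (g x v)); last first.
  by apply: (l2eq_trans fv); apply: l2eq_sym; have [] := mi' _ L2u.
have cl : forall e : R, 0 < e -> exists2 w, V' w & (l2n (h' x (g x v) - w)%R < e%:E)%E; last first.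
  by have [_ _ _ Vc] := cV'; apply: (Vc _ (bounded_fin bh' L2u)).
move=> e e0.
have nN : \forall y \near x, N y /\ N' y by apply: filterI; exact: open_nbhs_nbhs.
have n1 := op_null oN Nx sg L2v; have n2 := op_null oN' Nx' sh' L2u; have n3 := op_cont oN' Nx' sh'.
have [B hB] : exists x0 : R, (opnorm (h' x) <= x0%:E)%E.
  move: bh'.1 (opnorm_ge0 (h' x)); case ea : (opnorm (h' x)) => [x0| |] // _ _.
  by exists x0.
have B0 : 0 <= B by have := le_trans (opnorm_ge0 (h' x)) hB; rewrite lee_fin.
have stepA : null (nbhs x) (fun y => l2n (h' y (g y v - g x v))).
  (* h' y - h' x contributes the factor 1 + 1, and h' x the factor B + 1 *)
  move=> r r0; set k2 := r / (2 * (B + 3)).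
  have k20 : 0 < k2 by rewrite divr_gt0 // mulr_gt0 // ltr_wpDl.
  move: (n1 k2 k20) (n3 1 ltr01); apply: filterS2 => y hd ho.
  set d := g y v - g x v in hd *.
  have -> : h' y d = (h' y - h' x) d + h' x d by rewrite -[(h' y - h' x) d]/(h' y d - h' x d) subrK.
  apply: (le_trans (qn_D qn (opnorm_bound ho hd ltr01) (opnorm_bound hB hd ltr01))).
  have kE : k2 * (2 * (B + 3)) = r by rewrite /k2 mulfVK // lt0r_neq0 // mulr_gt0 // ltr_wpDl.
  by rewrite lee_fin; move: kE k20; lra.
have stepB := null_qnD qn stepA n2.
have e4 : 0 < e / 8 by rewrite divr_gt0.
have near_e : \forall y \near x^', (l2n (h' y (g y v - g x v) + (h' y (g x v) - h' x (g x v)))%R <= (e / 8)%:E)%E.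
  by apply: nbhs_dnbhs; exact: stepB e4.
have nN' : \forall y \near x^', N y /\ N' y by exact: nbhs_dnbhs.
have [y [[hy suby] [Ny Ny']]] := punctured_ex (filterI (filterI near_e sub) nN').
have [bgy _ _] := bd y Ny; have [bgy' bhy' miy'] := bd' y Ny'.
have L2gy : L2 (g y v) by exact: bounded_fin.
have : W' y (g y v) by apply: suby; rewrite (Weq y Ny); exists v; [exact: Vv|exact: l2eq_refl].
rewrite (Weq' y Ny') => -[v' Vv' gv'].
have L2v' : L2 v' by have [V2 _ _ _] := cV'; exact: V2.
exists (h' y (g y v)).
  apply: (closed_l2eq cV' _ Vv'); apply: l2eq_trans (miy' _ L2v').2.
  by apply: (bounded_l2eq bhy' _ gv'); exact: (bounded_fin bgy' L2v').
have L2d : L2 (g y v - g x v) by exact: L2B.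
have := bounded_sub bhy' L2d L2u; rewrite subrK => /l2norm0P lin.
have := qn_D qn lin hy; rewrite add0r => fin_.
rewrite -(qn_N qn) opprB; apply: (@le_lt_trans _ _ (2 * (e / 8))%:E); last by rewrite lte_fin; lra.
have tel (Z : zmodType) (p q r s : Z) : p - (q + r) + (q + (r - s)) = p - s by rewrite [q + (r - s)]addrA subrKA.
by rewrite tel in fin_.
Qed.

Lemma derived_local (U : set M) c (K : S1 R -> M -> 'M[C]_n) (W W' : M -> set loop) y f :
  open U -> U y -> (forall z, U z -> W z = W' z) ->
  derived_fibre c K W y f -> derived_fibre c K W' y f.
Proof.
move=> oU Uy WW [N [s [d [g [[oN Ny] ss sW [ds gW] fe]]]]]; exists (N `&` U), s, d, g; split.
- by split; [exact: openI|].
- by move=> b rb; apply: sm_sub (ss b rb) => p [z [bz [Nz _]] e]; exists z.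
- by move=> z [Nz Uz]; rewrite -WW //; exact: sW.
- by split => //; rewrite -WW.
exact: fe.
Qed.

Lemma derived_bundle_sub (U : set M) (K : chart R M -> S1 R -> M -> 'M[C]_n) (W W' V V' : M -> set loop) x :
  open U -> (forall z, U z -> W z = V z) -> derived_bundle U K W W' -> derived_bundle U K V V' ->
  U x -> W' x `<=` V' x.
Proof.
move=> oU WV [sW dW] [sV dV] Ux; apply: (subbundle_limit sW sV Ux).
have nU : \forall y \near x^', U y by apply: nbhs_dnbhs; exact: open_nbhs_nbhs.
move: nU (dW x Ux) (dV x Ux); apply: filterS3 => y Uy hW hV f.
have [c rc cy] := rs_cover y; rewrite (hW c rc cy) (hV c rc cy).
exact: (derived_local oU Uy WV).
Qed.

(** Off a discrete set the next bundle is the derived fibre of the previous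
    one; on that set it is determined by continuity. *)
Lemma derived_sequence_unique (U : set M) (K : chart R M -> S1 R -> M -> 'M[C]_n) (W V : nat -> M -> set loop) :
  open U -> (forall x, U x -> W 0%N x = V 0%N x) ->
  (forall i, derived_bundle U K (W i) (W i.+1)) -> (forall i, derived_bundle U K (V i) (V i.+1)) ->
  forall i x, U x -> W i x = V i x.
Proof.
move=> oU WV0 dW dV; elim => [|i IH] x Ux; first exact: WV0.
apply/seteqP; split; first exact: (derived_bundle_sub oU IH (dW i) (dV i) Ux).
by apply: (derived_bundle_sub oU _ (dV i) (dW i) Ux) => z Uz; rewrite IH.
Qed.

Definition bounded_below (m : int) : set loop := [set f | L2 f /\ forall k, k < m -> fourier f k = 0].

Lemma bounded_below_closed m : closed_subspace (bounded_below m).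
Proof.
have := @fourier_closed R n (fun k B => k < m /\ B = 1%:M); congr closed_subspace.
apply/seteqP; split => f [hf h]; split => //.
  by move=> k km; rewrite -[LHS]mul1mx; apply: h.
by move=> k B [km ->]; rewrite h // mulmx0.
Qed.

Lemma smooth_subbundle_cst (U : set M) (V : set loop) : closed_subspace V -> smooth_subbundle U (fun=> V).
Proof.
move=> cV x Ux; pose I : S1 R -> 'M[C]_n := fun=> 1%:M.
have IE f : lmul I f = f by apply/funext => l; rewrite /lmul mul1mx.
have fI : (supnorm I < +oo)%E.
  apply: (@le_lt_trans _ _ (frobenius (1%:M : 'M[C]_n))%:E); last exact: ltry.
  by apply/supnormP; split => [||l]; [exact: frob_ge0|exact: cst_meas|exact: lexx].
have sI : smooth_on (@opnorm R n) setT (fun _ : M => lmul I).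
  by move=> c rc; apply: (sm_op (F := fun=> I)); exact: (sm_cst _ _ (supnorm_qn R n n)).
have bI := lmul_bounded fI.
exists setT, V, (fun=> lmul I), (fun=> lmul I); split.
- by split => //; exact: openT.
- exact: cV.
- by split; exact: sI.
- by move=> y _; split; [exact: bI|exact: bI|move=> f _; rewrite !IE; split; exact: l2eq_refl].
move=> y _; apply/seteqP; split => [f Vf|f [v Vv]].
  by exists f; [exact: Vf|rewrite IE; exact: l2eq_refl].
by rewrite IE => e; exact: (closed_l2eq cV e Vv).
Qed.
End Subbundles.

(** * The levelled subbundles *)

Section Levelled.
Variables (R : realType) (M : riemann_surface R) (n : nat).
Local Notation C := (Cx R).
Local Notation mxn := (@mxnorm R _ _).
Variable G : nat -> M -> 'M[C]_n.
Hypothesis sG : forall i, subbundle (G i).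
Hypothesis gG : forall i, gauss_bundle (G i) (G i.+1).
Hypothesis n2 : (1 < n)%N.
Hypothesis orth : forall i j x, (i < n)%N -> (j < n)%N -> i != j -> G i x *m G j x = 0.
Hypothesis sumG : forall x, \sum_(a < n) G a x = 1%:M.
Hypothesis Gn : forall x, G n x = G 0%N x.
Local Notation Mx := (shiftmx G).
Local Notation nxt := (succ_mod n).

Lemma G_nxt b x : G (nxt b) x = G b.+1 x.
Proof. by rewrite /succ_mod; case: eqP => // ->. Qed.

Lemma nxt_inj a b : (a < n)%N -> (b < n)%N -> nxt a = nxt b -> a = b.
Proof. by rewrite /succ_mod => an bn; case: eqP; case: eqP; lia. Qed.

Lemma nxt_neq a : (a < n)%N -> nxt a != a.
Proof. by rewrite /succ_mod => an; case: (eqVneq a.+1 n); lia. Qed.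

Lemma G_shift c a b x : rs_atlas c -> cdom c x -> (a < n)%N -> (b < n)%N ->
  G a x *m Mx c b x = if a == nxt b then Mx c b x else 0.
Proof.
move=> rc cx an bn; rewrite -(shiftP sG gG b rc cx) mulmxA -G_nxt; case: eqP => [->|/eqP ab].
  by rewrite (idemG sG).
by rewrite orth ?succ_mod_lt // mul0mx.
Qed.

Lemma shift_G c a b x : (a < n)%N -> (b < n)%N ->
  Mx c b x *m G a x = if a == b then Mx c b x else 0.
Proof.
move=> an bn; rewrite /shiftmx -mulmxA; case: eqP => [->|/eqP ab]; first by rewrite (idemG sG).
by rewrite orth // 1?eq_sym // mulmx0.
Qed.

(** Differentiating P_a P_j = 0 gives P_a (d/dz P_a) P_j = - P_a M_j, and M_j
    has its values in the line after j. *)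
Lemma frenet c b x : rs_atlas c -> cdom c x -> (b < n)%N ->
  dz c (G (nxt b)) x = Mx c (nxt b) x - Mx c b x.
Proof.
move=> rc cx bn; set a := nxt b; have an : (a < n)%N by exact: succ_mod_lt.
rewrite {1}(dzG sG a rc cx); congr (_ + _).
rewrite -[LHS]mulmx1 -(sumG x) mulmx_sumr (bigD1 (Ordinal bn)) //= big1 ?addr0 => [|j jb].
- have := dz_orth (sG a) (sG b) rc cx (fun y => orth y an bn (nxt_neq bn)).
  move=> /(congr1 (fun A => G a x *m A)); rewrite mulmx0 mulmxDr !mulmxA (idemG sG).
  move=> /eqP; rewrite addr_eq0 => /eqP ->; congr (- _).
  have := G_shift rc cx an bn; rewrite eqxx => h; rewrite -[RHS]h /shiftmx.
  have := dz_proj (sG b) rc cx.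
  move=> {1}->; rewrite mulmxDr [G a x *m (G b x *m _)]mulmxA orth // ?mul0mx ?addr0 ?mulmxA //.
  exact: nxt_neq.
have [ja|ja] := eqVneq (j : nat) a; first by rewrite ja (proj_dz_proj (sG a) rc cx).
have := dz_orth (sG a) (sG j) rc cx (fun y => orth y an (ltn_ord j) _); rewrite eq_sym => /(_ ja).
move=> /(congr1 (fun A => G a x *m A)); rewrite mulmx0 mulmxDr !mulmxA (idemG sG).
move=> /eqP; rewrite addr_eq0 => /eqP ->; apply/eqP; rewrite oppr_eq0; apply/eqP.
have := G_shift rc cx an (ltn_ord j); rewrite ifN; last first.
  by apply: contra jb => /eqP h; apply/eqP/val_inj; exact: (nxt_inj (ltn_ord j) bn (esym h)).
rewrite /shiftmx mulmxA => h; have := dz_proj (sG j) rc cx.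
move=> ->; rewrite mulmxDr mulmxA h [G a x *m (G j x *m _)]mulmxA orth ?mul0mx ?addr0 //.
by rewrite eq_sym.
Qed.

(** A_z = (2 P_0 - 1) (M_0 - M_(n-1)), where P_0 kills M_0 and fixes M_(n-1). *)
Lemma Az_shift c x : rs_atlas c -> cdom c x ->
  Az c (cartan (G 0%N)) x = - (Mx c 0%N x + Mx c n.-1 x).
Proof.
move=> rc cx; have n1 : (n.-1 < n)%N by lia.
have e : nxt n.-1 = 0%N by rewrite /succ_mod prednK ?eqxx //; lia.
have := frenet rc cx n1; rewrite e (Az_cartan (sG 0) rc cx) cartan2 => ->.
have n0 : (0 < n)%N by lia.
have h0 := G_shift rc cx n0 n0; have h1 := G_shift rc cx n0 n1.
move: h0 h1; rewrite e eqxx ifN; last by rewrite /succ_mod; case: (eqVneq 1%N n); lia.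
move: (Mx c 0 x) (Mx c n.-1 x) (G 0 x) => m0 m1 P h0 h1.
rewrite mulmxBl mul1mx -scalemxAl mulmxBr h0 h1 sub0r scalerN scaler_nat mulr2n !opprD opprK.
by rewrite addrCA subrK.
Qed.

Lemma G_Az c b x : rs_atlas c -> cdom c x -> (b < n)%N ->
  G (nxt b) x *m Az c (cartan (G 0%N)) x = - ((eps n b)%:~R *: Mx c b x).
Proof.
move=> rc cx bn; have n1 : (n.-1 < n)%N by lia.
have n0 : (0 < n)%N by lia.
rewrite (Az_shift rc cx) mulmxN mulmxDr !(G_shift rc cx (succ_mod_lt bn)) //; congr (- _).
have h a : (a < n)%N -> (nxt b == nxt a) = (b == a).
  by move=> an; apply/eqP/eqP => [/nxt_inj ->|->].
rewrite !h // /eps; case: (eqVneq b 0%N) => [->|b0]; case: (eqVneq _ n.-1) => [e|b1] /=.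
- by lia.
- by rewrite scale1r addr0.
- by rewrite scale1r add0r e.
- by rewrite scale0r addr0.
Qed.

Lemma Az_G c b x : rs_atlas c -> cdom c x -> (b < n)%N ->
  Az c (cartan (G 0%N)) x *m G b x = - ((eps n b)%:~R *: Mx c b x).
Proof.
move=> rc cx bn; have n1 : (n.-1 < n)%N by lia.
have n0 : (0 < n)%N by lia.
rewrite (Az_shift rc cx) mulNmx mulmxDl !shift_G //; congr (- _).
rewrite /eps; case: (eqVneq b 0%N) => [->|b0]; case: (eqVneq _ n.-1) => [e|b1] /=.
- by lia.
- by rewrite scale1r addr0.
- by rewrite scale1r add0r e.
- by rewrite scale0r addr0.
Qed.

(** The closed span of the lambda^k G a of level at most i. *)
Definition Slev (i : nat) (x : M) : set (loop R n) :=
  [set f | L2 f /\ forall k (a : 'I_n), i%:Z < lev n k a -> G a x *m fourier f k = 0].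

Lemma Slev_closed i x : closed_subspace (Slev i x).
Proof.
have := @fourier_closed R n (fun k B => exists2 a : 'I_n, i%:Z < lev n k a & B = G a x).
congr closed_subspace; apply/seteqP; split => f [hf h]; split => //.
  by move=> k a ik; apply: h; exists a.
by move=> k B [a ik ->]; exact: h.
Qed.

Lemma Slev_l2eq i x f g : l2eq f g -> Slev i x g -> Slev i x f.
Proof.
move=> e [hg sg]; split => [|k a ik]; first exact: L2_eq e hg.
by rewrite (fourier_l2eq k hg e) sg.
Qed.

Lemma Slev_periodic j x : Slev (j * n) x = lambda_shift (2 * j) (hardy R n).
Proof.
apply/seteqP; split => f.
  move=> [hf sf]; exists (lshift (2 * j)%N%:Z f).
    split => [|k k0]; first exact: L2_shift.
    rewrite fourier_shift -[LHS]mul1mx -(sumG x) mulmx_suml big1 // => a _.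
    by apply: sf; rewrite lev_shiftn ltrDr lev_pos.
  by apply/funext => l; rewrite /lshift scalerA mulVf ?scale1r // expf_neq0 ?sval_neq0.
move=> [h [hh h0] ->].
have -> : (fun l : S1 R => (sval l) ^- (2 * j) *: h l) = lshift (- (2 * j)%N%:Z) h.
  by apply/funext => l; rewrite /lshift exprnN.
split => [|k a]; first exact: L2_shift.
rewrite fourier_shift opprK => ik; rewrite h0 ?mulmx0 //.
rewrite -(lev_pos _ (ltn_ord a)).
have := lev_shiftn n (k + (2 * j)%N%:Z) a j; rewrite addrK => e.
by move: ik; rewrite e ltrDr.
Qed.

Lemma Slev0 x : Slev 0 x = hardy R n.
Proof.
have := Slev_periodic 0 x; rewrite mul0n muln0 => ->.
apply/seteqP; split => [f [h hh ->]|f hf].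
  have -> : (fun l : S1 R => (sval l) ^- 0 *: h l) = h; last by [].
  by apply/funext => l; rewrite expr0 invr1 scale1r.
by exists f => //; apply/funext => l; rewrite expr0 invr1 scale1r.
Qed.

Lemma Slev_cst i x k (a : 'I_n) (v : 'cV[C]_n) : lev n k a <= i%:Z ->
  Slev i x (lshift k (fun=> G a x *m v)).
Proof.
move=> h; split => [|k' a' ik]; first by apply: L2_shift; exact: cst_L2.
rewrite fourier_cst; case: eqP => [ek|]; last by rewrite mulmx0.
rewrite mulmxA orth ?mul0mx //; apply/eqP => ea; have := val_inj ea => ea'.
by move: ik; rewrite ek ea' ltNge h.
Qed.

(** Matches the splittings of C^n at x and at y line by line. *)
Definition transport x y : 'M[C]_n := \sum_(a < n) G a y *m G a x.

Lemma transport_id x : transport x x = 1%:M.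
Proof. by rewrite -(sumG x); apply: eq_bigr => a _; rewrite (idemG sG). Qed.

Lemma transport_sm c x : rs_atlas c -> chart_smooth c (transport x).
Proof.
move=> rc; apply: (sm_sum (I := 'I_n) (mxnorm_qn R n n)) => a.
exact: (sm_mul (@openOm _ _ c) (smG sG a rc) (smc_cst c (G a x))).
Qed.

Lemma G_transport (a : 'I_n) x y : G a y *m transport x y = transport x y *m G a x.
Proof.
transitivity (G a y *m G a x).
  rewrite mulmx_sumr (bigD1 a) //= mulmxA (idemG sG) big1 ?addr0 // => b ba.
  by rewrite mulmxA orth ?mul0mx // eq_sym.
rewrite mulmx_suml (bigD1 a) //= -mulmxA (idemG sG) big1 ?addr0 // => b ba.
by rewrite -mulmxA orth ?mulmx0.
Qed.

(** A vector v of the kernel satisfies v = (B - 1) (- v). *)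
Lemma unit_near1 (B : 'M[C]_n) : (n * 1 * n)%:R * frobenius (B - 1%:M) < 1 -> B \in unitmx.
Proof.
move=> h; rewrite -unitmx_tr -row_free_unit -kermx_eq0; apply/eqP/row_matrixP => i.
have e : B *m (row i (kermx B^T))^T = 0.
  have := mulmx_ker B^T => /(congr1 (row i)); rewrite row_mul row0 => /(congr1 trmx).
  by rewrite trmx_mul trmxK trmx0.
rewrite row0 -[LHS]trmxK -[RHS]trmxK; congr (_^T); rewrite trmx0.
move: (_ ^T) e => v Bv; apply: frob_eq0; rewrite leNgt; apply/negP => v0.
have ev : v = (B - 1%:M) *m - v by rewrite mulmxBl mulmxN Bv mul1mx oppr0 opprK add0r.
have := frobM (B - 1%:M) (- v); rewrite -ev.
rewrite (_ : frobenius (- v) = frobenius v); last first.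
  by rewrite -scaleN1r frobZ cmodN (cmod_rcst 1) normr1 mul1r.
rewrite mulrA => h1.
by move: h; rewrite ltNge -(ler_pM2r v0) mul1r h1.
Qed.

Lemma transport_near x : \forall y \near x, transport x y \in unitmx.
Proof.
have [c rc cx] := rs_cover x.
have K0 : 0 < (n * 1 * n)%:R + 1 :> R by rewrite ltr_wpDl.
set K := (n * 1 * n)%:R in K0.
have h := sm_cont (mxnorm_qn R n n) (@openOm _ _ c) (transport_sm x rc) (pt_Om cx).
have d0 : 0 < (K + 1)^-1 by rewrite invr_gt0.
move: (near_pt cx (h _ d0)) (near_cdom cx); apply: filterS2 => y.
rewrite /mxnorm lee_fin => + cy; rewrite !from_pt // transport_id => hy.
apply: unit_near1; apply: (@le_lt_trans _ _ (K * (K + 1)^-1)); first by rewrite ler_wpM2l.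
by rewrite ltr_pdivrMr // mul1r ltrDl.
Qed.

(** Phi conjugates d/dz + K to T. This is used twice: for an extended solution,
    with K = 0, and for Phi = 1, with K the potential of T. *)
Section Solution.
Variables (U : set M) (oU : open U).
Variables (Phi : S1 R -> M -> 'M[C]_n) (K : chart R M -> S1 R -> M -> 'M[C]_n).
Hypothesis Phi_unitary : forall l x, U x -> Phi l x \is unitarymx.
Hypothesis Phi_smooth : smooth_loops U Phi.
Hypothesis Phi_eq : forall c x l, rs_atlas c -> cdom c x -> U x ->
  K c l x *m Phi l x + dz c (Phi l) x = Phi l x *m T_potential (cartan (G 0%N)) c l x.
Local Notation Phia := (fun l x => (Phi l x)^t* ).

Lemma PhiK l x : U x -> Phi l x *m (Phi l x)^t* = 1%:M.
Proof. by move=> Ux; apply/unitarymxP; exact: Phi_unitary. Qed.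
Lemma PhiaK l x : U x -> (Phi l x)^t* *m Phi l x = 1%:M.
Proof. by move=> Ux; apply: mulmx1C; exact: PhiK. Qed.

Lemma Phi_jsm c : rs_atlas c -> joint_smooth c U Phi. Proof. exact: Phi_smooth. Qed.
Lemma Phia_jsm c : rs_atlas c -> joint_smooth c U Phia.
Proof. by move=> rc; apply: jsm_adj => //; exact: Phi_jsm. Qed.

Lemma Phi_fin x : U x -> (supnorm (Phi^~ x) < +oo)%E.
Proof. by move=> Ux; have [c rc cx] := rs_cover x; exact: (jsm_fin oU cx Ux (Phi_jsm rc)). Qed.
Lemma Phia_fin x : U x -> (supnorm (Phia^~ x) < +oo)%E.
Proof. by move=> Ux; have [c rc cx] := rs_cover x; exact: (jsm_fin oU cx Ux (Phia_jsm rc)). Qed.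

Lemma lmul_PhiK x f : U x -> lmul (Phi^~ x) (lmul (Phia^~ x) f) = f.
Proof. by move=> Ux; apply/funext => l; rewrite /lmul mulmxA PhiK // mul1mx. Qed.
Lemma lmul_PhiaK x f : U x -> lmul (Phia^~ x) (lmul (Phi^~ x) f) = f.
Proof. by move=> Ux; apply/funext => l; rewrite /lmul mulmxA PhiaK // mul1mx. Qed.

Definition Wlev i x : set (loop R n) := loop_mul (Phi^~ x) (Slev i x).

Lemma WlevP i x f : U x -> Wlev i x f <-> Slev i x (lmul (Phia^~ x) f).
Proof.
move=> Ux; split => [[h hh ->]|h]; first by rewrite -[X in lmul _ X]/(lmul (Phi^~ x) h) lmul_PhiaK.
by exists (lmul (Phia^~ x) f) => //; rewrite -{1}(lmul_PhiK f Ux).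
Qed.

Lemma Wlev_closed i x : U x -> closed_subspace (Wlev i x).
Proof.
move=> Ux; have [S2 S0 Sl Sc] := Slev_closed i x; split.
- move=> f /(WlevP i f Ux) /S2 h; rewrite -(lmul_PhiK f Ux).
  by apply: lmul_fin => //; exact: Phi_fin.
- apply/(WlevP i _ Ux); rewrite (_ : lmul _ 0 = 0) //.
  by apply/funext => l; rewrite /lmul [LHS]mulmx0.
- move=> a f g /(WlevP i f Ux) hf /(WlevP i g Ux) hg; apply/(WlevP i _ Ux).
  by rewrite lmulDr lmulZr; exact: Sl.
move=> f hf h; apply/(WlevP i f Ux); apply: Sc; first by apply: lmul_fin => //; exact: Phia_fin.
have [a a0 ha] := qn_finP (supnorm_qn R n n) (Phia_fin Ux).
move=> e e0; set k : R := (n * 1 * n)%:R * a + 1.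
have k0 : 0 < k by rewrite ltr_wpDl // mulr_ge0 // ltW.
have [g /(WlevP i g Ux) hg fg] := h (e / k) (divr_gt0 e0 k0).
exists (lmul (Phia^~ x) g) => //; rewrite -lmulNr -lmulDr.
apply: (le_lt_trans (l2norm_mul ha (ltW fg))); rewrite lte_fin mulrA mulrCA gtr_pMr //.
by rewrite ltr_pdivrMr // mul1r ltrDl.
Qed.

Lemma Wlev_l2eq i x f g : U x -> l2eq f g -> Wlev i x g -> Wlev i x f.
Proof.
move=> Ux e /(WlevP i g Ux) hg; apply/(WlevP i f Ux); apply: Slev_l2eq hg.
by apply: lmul_l2eq => //; exact: Phia_fin.
Qed.

Lemma Slev_transport i x y f : transport x y \in unitmx -> L2 f ->
  Slev i y (lmul (fun=> transport x y) f) <-> Slev i x f.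
Proof.
move=> tu hf; have e k (a : 'I_n) : G a y *m fourier (lmul (fun=> transport x y) f) k =
    transport x y *m (G a x *m fourier f k).
  by rewrite fourier_mx // mulmxA G_transport mulmxA.
split => [[_ h]|[_ h]]; split => //; [|exact: mx_L2|] => k a ik.
- by have := h k a ik; rewrite e => /(congr1 (mulmx (invmx (transport x y)))); rewrite mulKmx // mulmx0.
- by rewrite e h // mulmx0.
Qed.

(** Near x the fibre is the image of the fixed space Slev i x under Phi
    composed with the transport from x. *)
Lemma Wlev_smooth i : smooth_subbundle U (Wlev i).
Proof.
move=> x Ux; pose O1 := [set y | U y /\ transport x y \in unitmx].
have nO : \forall y \near x, O1 y.
  by apply: filterI; [apply: open_nbhs_nbhs|exact: transport_near].
pose N := interior O1.
have oN : open N by exact: open_interior.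
have NU y : N y -> U y by move=> /interior_subset [].
have Nu y : N y -> transport x y \in unitmx by move=> /interior_subset [].
have NU' : N `<=` U by move=> y; exact: NU.
pose g l y := Phi l y *m transport x y; pose h l y := invmx (transport x y) *m (Phi l y)^t*.
have sg c : rs_atlas c -> joint_smooth c N g.
  move=> rc; apply: jsm_mul => //; first by apply: jsm_sub (Phi_jsm rc).
  apply: jsm_cst; apply: sm_sub (transport_sm x rc).
  by move=> p [y [cy _] e]; exists y.
have sh c : rs_atlas c -> joint_smooth c N h.
  move=> rc; apply: jsm_mul => //; last by apply: jsm_sub (Phia_jsm rc).
  apply: jsm_cst; apply: sm_inv.
  - exact: open_coord.
  - by move=> p /coord_setP [Np _ _]; exact: Nu.
  - by apply: sm_sub (transport_sm x rc) => p [y [cy _] e]; exists y.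
have fin A y : N y -> (forall c, rs_atlas c -> joint_smooth c N A) -> (supnorm (A^~ y) < +oo)%E.
  by move=> Ny hA; have [c rc cy] := rs_cover y; exact: (jsm_fin oN cy Ny (hA c rc)).
exists N, (Slev i x), (fun y => lmul (g^~ y)), (fun y => lmul (h^~ y)); split.
- by split.
- exact: Slev_closed.
- by split => c rc; apply: sm_op; apply: jsm_sup => //; [exact: sg|exact: sh].
- move=> y Ny; split; [by apply: lmul_bounded; exact: fin|by apply: lmul_bounded; exact: fin|].
  move=> f _; rewrite !lmulM; split.
  + rewrite (_ : lmul _ f = f); first exact: l2eq_refl.
    apply/funext => l; rewrite /lmul /g /h -!mulmxA [transport x y *m _]mulmxA mulmxV ?Nu // mul1mx.
    by rewrite mulmxA PhiK ?mul1mx //; exact: NU.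
  + rewrite (_ : lmul _ f = f); first exact: l2eq_refl.
    apply/funext => l; rewrite /lmul /g /h -!mulmxA [_^t* *m (_ *m _)]mulmxA PhiaK ?mul1mx; last exact: NU.
    by rewrite mulmxA mulVmx ?mul1mx // Nu.
move=> y Ny; have Uy := NU y Ny.
apply/seteqP; split => f /=.
  move=> [e Se ->]; exists (lmul (fun=> invmx (transport x y)) e).
    have L2e : L2 (lmul (fun=> invmx (transport x y)) e) by apply: mx_L2; have [] := Se.
    apply/(Slev_transport i (Nu y Ny) L2e); rewrite lmulM; move: Se; congr (Slev i y _).
    by apply/funext => l; rewrite /lmul mulmxV ?mul1mx // Nu.
  rewrite lmulM (_ : lmul _ e = (fun l => Phi l y *m e l)); first exact: l2eq_refl.
  by apply/funext => l; rewrite /lmul /g -(mulmxA (Phi l y)) mulmxV ?mulmx1 // Nu.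
move=> [v Sv e]; apply: (Wlev_l2eq Uy e); exists (lmul (fun=> transport x y) v).
  by apply/Slev_transport => //; [exact: Nu|have [] := Sv].
by apply/funext => l; rewrite /lmul /g mulmxA.
Qed.

(** * The derived fibres of the levelled subbundles *)

Lemma dz_PhiPhia c l y : rs_atlas c -> cdom c y -> U y ->
  dz c (Phi l) y *m (Phi l y)^t* + Phi l y *m dz c (Phia l) y = 0.
Proof.
move=> rc cy Uy.
have := wirt_mul (jsm_dz l oU cy Uy (Phi_jsm rc)) (jsm_dz l oU cy Uy (Phia_jsm rc)); rewrite (from_pt cy) => h.
apply: (wirt_uniq h); apply: (wirt_near (mxnorm_qn R n n) _ (wirt_cst (mxnorm_qn R n n) _ 1%:M _)).
apply: (near_fc cy (P := fun z => 1%:M = Phi l z *m (Phi l z)^t* )).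
have : \forall z \near y, U z by exact: open_nbhs_nbhs.
by apply: filterS => z Uz; rewrite PhiK.
Qed.

Lemma solution_alg (F : comRingType) k (P Pa Pz Pz' Kl T : 'M[F]_n) (s d g : 'M[F]_(n, k)) :
  P *m Pa = 1%:M -> Pz *m Pa + P *m Pz' = 0 -> Kl *m P + Pz = P *m T ->
  P *m (Pz' *m s + Pa *m d + T *m (Pa *m s) + Pa *m g) = d + Kl *m s + g.
Proof.
move=> PPa e1 e2; rewrite !mulmxDr !mulmxA PPa !mul1mx -e2 [(_ + Pz) *m Pa]mulmxDl -(mulmxA Kl) PPa mulmx1.
move/eqP: e1; rewrite addrC addr_eq0 => /eqP ->; rewrite mulmxDl mulNmx; congr (_ + g).
by rewrite [- _ + d]addrC -!addrA; congr (d + _); rewrite addrCA addNr addr0.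
Qed.

(** Put sigma = Phi^-1 s, a section of Slev i, and let a be the line after b.
    If lev n k a > i + 1 then P_a sigma_k = 0 near y, so P_a maps the k-th
    coefficient of d/dz sigma to M_b sigma_k by [frenet]. The potential turns
    this into M_b sigma_(k + eps n b), which is 0 by [lev_step]. *)
Lemma derived_sub i c y f : rs_atlas c -> cdom c y -> U y ->
  derived_fibre c (K c) (Wlev i) y f -> Wlev i.+1 y f.
Proof.
move=> rc cy Uy [N [s [d [g [[oN Ny] ss sW [/is_dzE ds gW] fe]]]]].
pose sigma z := lmul (Phia^~ z) (s z).
have nU : \forall z \near y, [/\ N z, U z & cdom c z].
  have h1 : \forall z \near y, N z by exact: open_nbhs_nbhs.
  have h2 : \forall z \near y, U z by exact: open_nbhs_nbhs.
  by move: h1 h2 (near_cdom cy); apply: filterS3.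
have nS : \forall z \near y, Slev i z (sigma z).
  by move: nU; apply: filterS => z [Nz Uz _]; apply/(WlevP i _ Uz); exact: sW.
have nL : \forall q \near pt c y, L2 (s (from_coord c q)).
  apply: (near_fc cy (P := fun z => L2 (s z))).
  by move: nU; apply: filterS => z [Nz Uz _]; have [S2 _ _ _] := Wlev_closed i Uz; apply: S2; exact: sW.
have nLs : \forall q \near pt c y, L2 (sigma (from_coord c q)).
  by apply: (near_fc cy (P := fun z => L2 (sigma z))); move: nS; apply: filterS => z [].
have nP : \forall q \near pt c y, (supnorm (Phia^~ (from_coord c q)) < +oo)%E.
  apply: (near_fc cy (P := fun z => (supnorm (Phia^~ z) < +oo)%E)).
  by move: nU; apply: filterS => z [_ Uz _]; exact: Phia_fin.
have dsig := wirt_lmul nP nL (jsm_wirt oU cy Uy (Phia_jsm rc)) ds.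
rewrite (from_pt cy) in dsig.
move: dsig; set dS := _ + _ => dsig.
have dSE : dS = lmul (fun l => dz c (fun z => (Phi l z)^t* ) y) (s y) + lmul (Phia^~ y) d by [].
clearbody dS.
pose g' := lmul (Phia^~ y) g.
have Sy : Slev i y (sigma y) by exact: nbhs_singleton nS.
have [L2s Ss] := Sy.
have [L2g Sg] : Slev i y g' by apply/(WlevP i g Uy).
have L2d : L2 dS by exact: (wirt_fin (l2norm_qn R n) nLs dsig).
set A := Az c (cartan (G 0%N)) y.
have [Tsig [TE L2T FT]] : exists Tsig : loop R n, [/\ forall l, Tsig l = T_potential (cartan (G 0%N)) c l y *m sigma y l,
    L2 Tsig & forall k, fourier Tsig k = A *m fourier (sigma y) k - A *m fourier (sigma y) (k + 1)].
  have L2A : L2 (lmul (fun=> A) (sigma y)) by exact: mx_L2.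
  exists (lmul (fun=> A) (sigma y) - lshift (-1) (lmul (fun=> A) (sigma y))); split => [l||k].
  - by rewrite /T_potential -/A -[RHS]scalemxAl scalerBl scale1r.
  - exact: (L2B L2A (L2_shift (-1) L2A)).
  rewrite (fourierB k L2A (L2_shift (-1) L2A)) fourier_shift opprK.
  by rewrite !(fourier_mx _ _ L2s).
apply: (Wlev_l2eq Uy fe); exists (dS + Tsig + g'); last first.
  apply/funext => l; rewrite [LHS]/(d l + K c l y *m s y l + g l).
  rewrite -[RHS]/(Phi l y *m (dS l + Tsig l + g' l)) TE dSE.
  apply: esym; exact: (solution_alg (s y l) (d l) (g l) (PhiK l Uy) (dz_PhiPhia l rc cy Uy) (Phi_eq l rc cy Uy)).
have lti k (a : 'I_n) : i.+1%:Z < lev n k a -> i%:Z < lev n k a.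
  by apply: lt_trans; rewrite ltz_nat.
split => [|k a ik]; first by exact: (L2D (L2D L2d L2T) L2g).
rewrite (fourierD k (L2D L2d L2T) L2g) (fourierD k L2d L2T) !mulmxDr (Sg k a (lti k a ik)) addr0.
have [b bn ba] := succ_mod_surj n2 (ltn_ord a).
have ak : G a y *m fourier (sigma y) k = 0 by exact: (Ss k a (lti k a ik)).
have h1 : G a y *m fourier dS k = Mx c b y *m fourier (sigma y) k.
  have := wirt_mul (dzE (smG sG a rc) cy) (wirt_fourier k nLs dsig); rewrite (from_pt cy) => h.
  have z : wirt mxn (- imC R) (fun q => G a (from_coord c q) *m fourier (sigma (from_coord c q)) k) (pt c y) 0.
    apply: (wirt_near (mxnorm_qn R n 1) _ (wirt_cst (mxnorm_qn R n 1) _ 0 _)).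
    apply: (near_fc cy (P := fun z => 0 = G a z *m fourier (sigma z) k)).
    by move: nS; apply: filterS => z [_ Sz]; rewrite (Sz k a (lti k a ik)).
  have := wirt_uniq h z; rewrite -{1}ba (frenet rc cy bn) ba mulmxBl.
  rewrite {1}/shiftmx -mulmxA ak mulmx0 sub0r addrC => /eqP; rewrite subr_eq0 => /eqP.
  by [].
have h2 : Mx c b y *m fourier (sigma y) (k + eps n b) = 0.
  have -> : Mx c b y = Mx c b y *m G b y by rewrite shift_G // eqxx.
  rewrite -mulmxA (Ss _ (Ordinal bn)) ?mulmx0 //=.
  by have := lev_step k n2 bn; rewrite ba => e; move: ik; rewrite -e; lia.
rewrite h1 FT mulmxBr !mulmxA -ba (G_Az rc cy bn) !mulNmx -!scalemxAl opprK.
move: h2; rewrite /eps; case: (_ || _) => /=.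
  by move=> ->; rewrite !scale1r addr0 subrr.
by rewrite addr0 => ->; rewrite !scale0r oppr0 !addr0.
Qed.

Lemma WlevD i x f g : Wlev i x f -> Wlev i x g -> Wlev i x (f + g).
Proof.
move=> [e Se ->] [e' Se' ->]; have [_ _ h _] := Slev_closed i x.
exists (1 *: e + e'); first exact: h.
by rewrite scale1r; apply/funext => l; apply: esym; exact: mulmxDr.
Qed.

Lemma affineD (F : comRingType) k (A : 'M[F]_n) (d d' s s' : 'M[F]_(n, k)) :
  d + A *m s + (d' + A *m s') = d + d' + A *m (s + s').
Proof. by rewrite mulmxDr addrACA. Qed.

Lemma affine0 (F : comRingType) k (A : 'M[F]_n) (f : 'M[F]_(n, k)) : 0 + A *m 0 + f = f.
Proof. by rewrite mulmx0 !add0r. Qed.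

Lemma derivedD i c y f f' : derived_fibre c (K c) (Wlev i) y f -> derived_fibre c (K c) (Wlev i) y f' ->
  derived_fibre c (K c) (Wlev i) y (f + f').
Proof.
move=> [N [s [d [g [[oN Ny] ss sW [/is_dzE ds gW] fe]]]]].
move=> [N' [s' [d' [g' [[oN' Ny'] ss' sW' [/is_dzE ds' gW'] fe']]]]].
exists (N `&` N'), (fun z => s z + s' z), (d + d'), (g + g'); split.
- by split; [exact: openI|].
- move=> b rb; apply: (sm_add (l2norm_qn R n)); [apply: sm_sub (ss b rb)|apply: sm_sub (ss' b rb)].
    by move=> p [z [bz [Nz _]] e]; exists z.
  by move=> p [z [bz [_ Nz]] e]; exists z.
- by move=> z [Nz Nz']; apply: WlevD; [exact: sW|exact: sW'].
- by split; [apply/is_dzE; exact: (wirtD (l2norm_qn R n) ds ds')|exact: WlevD].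
apply: l2eq_trans (l2eqD fe fe') _.
rewrite addrACA (_ : _ + (fun l => d' l + _) = (fun l => (d + d') l + K c l y *m (s y + s' y) l)).
  exact: l2eq_refl.
by apply/funext => l; exact: (affineD (K c l y) (d l) (d' l) (s y l) (s' y l)).
Qed.

Lemma derived_base i c y f : Wlev i y f -> derived_fibre c (K c) (Wlev i) y f.
Proof.
move=> Wf; exists setT, (fun=> 0), 0, f; split.
- by split; [exact: openT|].
- by move=> b rb; exact: (sm_cst _ _ (l2norm_qn R n)).
- move=> z _; exists 0; first by have [_] := Slev_closed i z.
  by apply/funext => l; rewrite [RHS]mulmx0.
- by split => //; apply/is_dzE; exact: (wirt_cst (l2norm_qn R n)).
rewrite (_ : _ + f = f); first exact: l2eq_refl.
by apply/funext => l; exact: (affine0 (K c l y) (f l)).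
Qed.

Lemma shift_alg (F : comRingType) k (P T Kl Pz Gb p Mb Mb' Az : 'M[F]_n) (v : 'M[F]_(n, k)) (li e : F) :
  Kl *m P + Pz = P *m T -> T = (1 - li) *: Az -> Az *m Gb = - (e *: Mb) -> p = Mb - Mb' ->
  Pz *m (Gb *m v) + P *m (p *m v) + Kl *m (P *m (Gb *m v)) + P *m (Mb' *m v) =
  (1 - e + e * li) *: (P *m (Mb *m v)).
Proof.
move=> e1 eT eA ep.
have h : Pz *m (Gb *m v) + Kl *m (P *m (Gb *m v)) = ((li - 1) * e) *: (P *m (Mb *m v)).
  rewrite !mulmxA -!mulmxDl addrC e1 eT -scalemxAr -scalemxAl.
  rewrite -(mulmxA P Az) eA mulmxN -scalemxAr scalerN scalerA -scaleNr -mulNr opprB.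
  by rewrite -!scalemxAl.
have hp : P *m (p *m v) = P *m (Mb *m v) - P *m (Mb' *m v) by rewrite ep mulmxBl mulmxBr.
rewrite hp -[X in X + _]addrA [_ - _ + _]addrAC addrA -[LHS]addrA addNr addr0.
rewrite addrA addrAC h; move: (P *m (Mb *m v)) => X.
by rewrite -{2}[X]scale1r -scalerDl; congr (_ *: _); ring.
Qed.

(** This is the derivative of the section lambda^(k + eps n b) Phi P_b v, up
    to an element of Wlev i y. *)
Lemma derived_shift i c b k y (v : 'cV[C]_n) : rs_atlas c -> cdom c y -> U y -> (b < n)%N ->
  lev n k (nxt b) = i.+1%:Z ->
  derived_fibre c (K c) (Wlev i) y (lmul (Phi^~ y) (lshift k (fun=> Mx c b y *m v))).
Proof.
move=> rc cy Uy bn hk.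
pose k' : int := k + eps n b.
have hk' : lev n k' b = i%:Z by apply: (addIr 1); rewrite (lev_step k n2 bn) hk -addn1 PoszD.
have sc z (u : 'cV[C]_n) : Slev i z (lshift k' (fun=> G b z *m u)).
  by have := @Slev_cst i z k' (Ordinal bn) u; apply; rewrite /= hk'.
pose Psi (l : S1 R) z := Phi l z *m (G b z *m v).
have sv c' : rs_atlas c' -> chart_smooth c' (fun z => G b z *m v).
  by move=> rc'; exact: (sm_mul (@openOm _ _ c') (smG sG b rc') (smc_cst c' v)).
have jPsi c' : rs_atlas c' -> joint_smooth c' U Psi.
  move=> rc'; apply: jsm_mul => //; first exact: Phi_jsm.
  by apply: jsm_cst; apply: sm_sub (sv c' rc') => p [z [cz _] e]; exists z.
have lsB (g : S1 R -> 'cV[C]_n) (x : R) : (supnorm g <= x%:E)%E ->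
    (l2norm (lshift k' g) <= ((2 * pi + 1) * x)%:E)%E.
  by move=> hg; apply: l2norm_shift; exact: l2norm_sup.
have p0 : (0 : R) <= 2 * pi + 1 by rewrite addr_ge0 // mulr_ge0 // ltW // pi_gt0.
have [b' bn' bb'] := succ_mod_surj n2 bn.
exists U, (fun z => lshift k' (Psi^~ z)), (lshift k' (fun l => dz c (Psi l) y)),
  (lmul (Phi^~ y) (lshift k' (fun=> Mx c b' y *m v))); split.
- by split.
- move=> c' rc'; apply: (sm_lin (supnorm_qn R n 1) (qn_ge0 (l2norm_qn R n)) (lshift_lin k') p0 lsB).
  exact: (jsm_sup oU (jPsi c' rc')).
- move=> z Uz; exists (lshift k' (fun=> G b z *m v)).
    exact: sc.
  by apply/funext => l; rewrite /lshift /Psi scalemxAr.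
- split; last first.
    exists (lshift k' (fun=> Mx c b' y *m v)) => //.
    have -> : Mx c b' y = G b y *m Mx c b' y by rewrite G_shift // bb' eqxx.
    by rewrite -mulmxA; exact: sc.
  apply/is_dzE; apply: (wirt_map (supnorm_qn R n 1) (l2norm_qn R n) _ p0 lsB _ (jsm_wirt oU cy Uy (jPsi c rc))).
    by move=> z f g _ _; exact: lshift_lin.
  apply: (near_fc cy (P := fun z => (supnorm (Psi^~ z) < +oo)%E)).
  have h1 : \forall z \near y, U z by exact: open_nbhs_nbhs.
  move: h1 (near_cdom cy); apply: filterS2 => z Uz cz.
  exact: (jsm_fin oU cz Uz (jPsi c rc)).
set rhs := _ + _; suff -> : rhs = lmul (Phi^~ y) (lshift k (fun=> Mx c b y *m v)) by exact: l2eq_refl.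
apply/funext => l; pose li := (sval l)^-1 : C.
have dPsi : dz c (Psi l) y = dz c (Phi l) y *m (G b y *m v) + Phi l y *m (dz c (G b) y *m v).
  have h := wirt_mul (dzE (smG sG b rc) cy) (wirt_cst (mxnorm_qn R n 1) (- imC R) v (pt c y)).
  rewrite mulmx0 addr0 in h.
  have := wirt_mul (jsm_dz l oU cy Uy (Phi_jsm rc)) h; rewrite (from_pt cy) => h'.
  exact: (dz_is h').
have fr := frenet rc cy bn'; rewrite bb' in fr.
have alg := shift_alg v (Phi_eq l rc cy Uy) (erefl _) (Az_G rc cy bn) fr.
have e : (sval l) ^ k' * (1 - (eps n b)%:~R + (eps n b)%:~R * (sval l)^-1) = (sval l) ^ k :> C.
  rewrite /k' /eps; case: (_ || _) => /=; last by rewrite mul0r !addr0 subr0 mulr1.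
  by rewrite subrr add0r mul1r -exprN1 -expfzDr ?sval_neq0 // addrK.
have col (F : comRingType) (z w : F) (D P K0 : 'M[F]_n) (A B B' X : 'cV[F]_n) :
    A + K0 *m B + P *m B' = w *: (P *m X) -> z *: A + K0 *m (z *: B) + P *m (z *: B') = P *m ((z * w) *: X).
  by move=> h; rewrite -!scalemxAr -!scalerDr h scalerA.
rewrite -[RHS]/(Phi l y *m ((sval l) ^ k *: (Mx c b y *m v))) -e.
apply: (col _ _ _ (Phi l y)); rewrite dPsi; exact: alg.
Qed.

Lemma derived_sum i c y (I : finType) (F : I -> loop R n) :
  (forall j, derived_fibre c (K c) (Wlev i) y (F j)) ->
  derived_fibre c (K c) (Wlev i) y (\sum_j F j).
Proof.
move=> h; elim: (index_enum I) => [|j s IH].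
  rewrite big_nil; apply: derived_base; exists 0; first by have [_] := Slev_closed i y.
  by apply/funext => l; rewrite [RHS]mulmx0.
by rewrite big_cons; exact: derivedD.
Qed.

Lemma lmul_sum (A : S1 R -> 'M[C]_n) (I : finType) (F : I -> loop R n) :
  lmul A (\sum_j F j) = \sum_j lmul A (F j).
Proof.
elim: (index_enum I) => [|j s IH]; last by rewrite !big_cons lmulDr IH.
by rewrite !big_nil; apply/funext => l; rewrite [LHS]mulmx0.
Qed.

(** By [lev_inj] there is at most one frequency of level i + 1 on each line a.
    Its coefficient is in the image of M_b, b the line before a, and is
    produced by [derived_shift]; the remainder is in Wlev i y. *)
Lemma derived_sup i c y f : rs_atlas c -> cdom c y -> U y -> (forall b, (b < n)%N -> generic G b y) ->
  Wlev i.+1 y f -> derived_fibre c (K c) (Wlev i) y f.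
Proof.
move=> rc cy Uy gy [e [L2e Se] ->].
have /choice [w hw] : forall a : 'I_n, exists w : loop R n, [/\ L2 w,
    derived_fibre c (K c) (Wlev i) y (lmul (Phi^~ y) w) &
    forall k (a' : 'I_n), i%:Z < lev n k a' ->
      G a' y *m fourier w k = if a' == a then G a y *m fourier e k else 0].
  move=> a; have [[k hk]|nk] := pselect (exists k, lev n k a = i.+1%:Z); last first.
    exists 0; split => [||k a' ik]; first exact: L2_0.
      apply: derived_base; exists 0; first by have [_] := Slev_closed i y.
      by [].
    rewrite fourier0 mulmx0; case: eqP => // ea; rewrite Se // -ea.
    have lk : lev n k a' != i.+1%:Z by apply/eqP => h; apply: nk; exists k; rewrite -h ea.
    by move: ik lk; lia.
  have [b bn ba] := succ_mod_surj n2 (ltn_ord a).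
  have [v hv] : exists v, G a y *m fourier e k = Mx c b y *m v.
    apply/(gy b bn c rc cy _); rewrite /fibre /= mulmxA -G_nxt ba.
    by rewrite (idemG sG).
  exists (lshift k (fun=> G a y *m fourier e k)); split => [||k' a' ik].
  - by apply: L2_shift; exact: cst_L2.
  - rewrite hv; apply: (derived_shift v rc cy Uy bn); by rewrite ba.
  rewrite fourier_cst; case: (eqVneq a' a) ik => [-> ik|aa _].
    case: (eqVneq k' k) => [->|kk]; first by rewrite mulmxA (idemG sG).
    have lk : lev n k' a != i.+1%:Z by apply: contra kk => /eqP h; apply/eqP/(lev_inj n2 (a := a)); rewrite h hk.
    by rewrite mulmx0 Se //; move: ik lk; lia.
  by case: (k' == k); rewrite ?mulmx0 // mulmxA orth ?mul0mx.
have [L2w fw] : L2 (\sum_a w a) /\ forall k, fourier (\sum_a w a) k = \sum_a fourier (w a) k.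
  have h a : L2 (w a) by have [] := hw a.
  by split => [|k]; [exact: (fourier_sum 0 h).1|exact: (fourier_sum k h).2].
have -> : (fun l => Phi l y *m e l) = \sum_a lmul (Phi^~ y) (w a) + lmul (Phi^~ y) (e - \sum_a w a).
  by rewrite -lmul_sum -lmulDr addrC subrK.
apply: derivedD; first by apply: derived_sum => a; have [] := hw a.
apply: derived_base; exists (e - \sum_a w a); last by [].
split => [|k a ik]; first exact: (L2B L2e L2w).
rewrite (fourierB k L2e L2w) fw mulmxBr mulmx_sumr (bigD1 a) //= big1 ?addr0.
  by have [_ _ h] := hw a; rewrite (h k a ik) eqxx subrr.
by move=> b ba; have [_ _ h] := hw b; rewrite (h k a ik) ifN // eq_sym.
Qed.

Lemma generic_all x : \forall y \near x^', forall b, (b < n)%N -> generic G b y.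
Proof.
suff h m : \forall y \near x^', forall b, (b < m)%N -> generic G b y by exact: h.
elim: m => [|m IH]; first by apply: nearW.
move: IH (generic_near sG gG m x); apply: filterS2 => y h1 h2 b.
by rewrite ltnS leq_eqVlt => /orP [/eqP ->|/h1].
Qed.

Lemma Wlev_derived i : derived_bundle U K (Wlev i) (Wlev i.+1).
Proof.
split; first exact: Wlev_smooth.
move=> x Ux; have nU : \forall y \near x^', U y.
  by apply: nbhs_dnbhs; exact: open_nbhs_nbhs.
move: nU (generic_all x); apply: filterS2 => y Uy gy c rc cy.
apply/seteqP; split => f; first exact: derived_sup.
exact: derived_sub.
Qed.

End Solution.
End Levelled.

(** * Polynomial solutions *)

Section Uniton.
Variables (R : realType) (M : riemann_surface R) (n : nat).
Local Notation C := (Cx R).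
Local Notation loop := (loop R n).

(** Fourier coefficients commute with d/dz. *)
Lemma bounded_below_derived (U : set M) (W : nat -> M -> set loop) m :
  open U -> (forall x, U x -> W 0%N x `<=` @bounded_below R n m) ->
  (forall i, derived_bundle U (fun _ _ _ => 0) (W i) (W i.+1)) ->
  forall i x, U x -> W i x `<=` @bounded_below R n m.
Proof.
move=> oU W0 dW; elim => [|i IH] x Ux; first exact: W0.
have [sW hW] := dW i.
suff h : \forall y \near x^', W i.+1 y `<=` @bounded_below R n m.
  exact (subbundle_limit sW (@smooth_subbundle_cst R M n U _ (@bounded_below_closed R n m)) Ux h).
have nU : \forall y \near x^', U y by apply: nbhs_dnbhs; exact: open_nbhs_nbhs.
move: nU (hW x Ux); apply: filterS2 => y Uy {}hW f.
have [c rc cy] := rs_cover y; rewrite (hW c rc cy).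
move=> [N [s [d [g [[oN Ny] ss sW' [/is_dzE ds gW] fe]]]]].
have nS : \forall z \near y, @bounded_below R n m (s z).
  have h1 : \forall z \near y, N z by exact: open_nbhs_nbhs.
  have h2 : \forall z \near y, U z by exact: open_nbhs_nbhs.
  by move: h1 h2; apply: filterS2 => z Nz Uz; apply: (IH z Uz); exact: sW'.
have nL : \forall q \near pt c y, L2 (s (from_coord c q)).
  by apply: (near_fc cy (P := fun z => L2 (s z))); move: nS; apply: filterS => z [].
have L2d : L2 d by exact: (wirt_fin (l2norm_qn R n) nL ds).
have [L2g Fg] := IH y Uy g gW.
apply: (closed_l2eq (@bounded_below_closed R n m) fe).
have -> : (fun l => d l + 0 *m s y l) = d by apply/funext => l; rewrite mul0mx addr0.
split => [|k km]; first exact: (L2D L2d L2g).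
rewrite (fourierD k L2d L2g) Fg // addr0.
apply: (wirt_uniq (wirt_fourier k nL ds)).
apply: (wirt_near (mxnorm_qn R n 1) _ (wirt_cst (mxnorm_qn R n 1) _ 0 _)).
apply: (near_fc cy (P := fun z => 0 = fourier (s z) k)).
by move: nS; apply: filterS => z [_ ->].
Qed.

Lemma polynomial_mul (N r : nat) (coef : nat -> 'M[C]_n) (f g : loop) : L2 f ->
  (forall l, g l = (\sum_(i < N) sval l ^ (i%:Z - r%:Z) *: coef i) *m f l) ->
  L2 g /\ forall k, fourier g k = \sum_(i < N) coef i *m fourier f (k - (i%:Z - r%:Z)).
Proof.
move=> hf gdef.
have gE : g = \sum_(i < N) lshift (i%:Z - r%:Z) (fun l => coef i *m f l).
  apply/funext => l; rewrite gdef mulmx_suml.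
  elim: (index_enum _) => [|i s IH]; first by rewrite !big_nil.
  by rewrite !big_cons IH -scalemxAl.
have h (i : 'I_N) : L2 (lshift (i%:Z - r%:Z) (fun l => coef i *m f l)).
  by apply: L2_shift; exact: mx_L2.
rewrite gE; split => [|k]; first exact: (fourier_sum 0 h).1.
rewrite (fourier_sum k h).2; apply: eq_bigr => i _.
by rewrite fourier_shift (fourier_mx _ _ hf).
Qed.
End Uniton.

(** * Superconformal maps *)

Section Final.
Variables (R : realType) (M : riemann_surface R) (n : nat).
Local Notation C := (Cx R).
Variables (phi : M -> 'M[C]_n) (phi_CP : map_to_CP phi).
Hypothesis phi_harmonic : harmonic_map (cartan phi).
Variable G : nat -> M -> 'M[C]_n.
Hypothesis G0 : G 0%N = phi.
Hypothesis gG : forall i, gauss_bundle (G i) (G i.+1).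
Hypothesis n1 : (0 < n.-1)%N.
Hypothesis horth : forall i, (0 < i <= n.-1)%N -> orthogonal_bundles phi (G i).
Hypothesis hmax : forall t, (forall i, (0 < i <= t)%N -> orthogonal_bundles phi (G i)) -> (t <= n.-1)%N.

Let sG' := gauss_subbundle phi_CP G0 gG.
Let n2 : (1 < n)%N. Proof. by case: (n) n1 => [|[]]. Qed.
Let orth' i j x := @gauss_orth R M n phi phi_CP phi_harmonic G G0 gG horth i j x.
Let sumG' x := @sum_gauss R M n phi phi_CP phi_harmonic G G0 gG n1 horth hmax x.
Let Gn' x := @gauss_periodic R M n phi phi_CP phi_harmonic G G0 gG n1 horth hmax x.

(** The case Phi = 1 of [Wlev_derived]. *)
Lemma S_derived i : derived_bundle setT (T_potential (cartan phi)) (Slev G i) (Slev G i.+1).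
Proof.
pose P1 (_ : S1 R) (_ : M) : 'M[C]_n := 1%:M.
have u1 l x : setT x -> P1 l x \is unitarymx by move=> _; apply/unitarymxP; rewrite /P1 adj1 mulmx1.
have s1 : smooth_loops setT P1.
  by move=> c rc; apply: (jsm_cst (F := fun=> 1%:M)); exact: (sm_cst _ _ (mxnorm_qn R n n)).
have e1 c x l : rs_atlas c -> cdom c x -> setT x ->
    T_potential (cartan phi) c l x *m P1 l x + dz c (P1 l) x = P1 l x *m T_potential (cartan (G 0%N)) c l x.
  by move=> rc cx _; rewrite /P1 dz_cst addr0 mulmx1 mul1mx G0.
have e i' : Wlev G P1 i' = Slev G i'.
  apply/funext => x; apply/seteqP; split => [f [h hh ->]|f hf].
    by rewrite (_ : (fun l => _) = h) //; apply/funext => l; rewrite mul1mx.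
  by exists f => //; apply/funext => l; rewrite mul1mx.
have := @Wlev_derived R M n G sG' gG n2 orth' sumG' Gn' setT openT P1 (T_potential (cartan phi)) u1 s1 e1 i.
by rewrite !e.
Qed.

Lemma solution_eq U Phi c x l : extended_solution U (cartan phi) Phi -> rs_atlas c -> cdom c x -> U x ->
  0 *m Phi l x + dz c (Phi l) x = Phi l x *m T_potential (cartan (G 0%N)) c l x.
Proof.
move=> [uP _ _ eP] rc cx Ux; rewrite mul0mx add0r G0 /T_potential.
have [<- _] := eP c x l rc cx Ux.
by rewrite mulKVmx // unitarymx_unit // uP.
Qed.

Lemma W_derived U Phi i : open U -> extended_solution U (cartan phi) Phi ->
  derived_bundle U (fun _ _ _ => 0) (Wlev G Phi i) (Wlev G Phi i.+1).
Proof.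
move=> oU eP; have [uP sP _ _] := eP.
apply: (@Wlev_derived R M n G sG' gG n2 orth' sumG' Gn' U oU Phi (fun _ _ _ => 0) uP sP).
by move=> c x l; exact: solution_eq.
Qed.

(** The frequencies of a polynomial times H_+ are bounded below, whereas those
    of W_(jn) go down by 2 with each j. *)
Lemma not_finite_uniton : ~ finite_uniton_number (cartan phi).
Proof.
move=> [Phi eP [r [s [coef [_ PhiE]]]]]; have [uP _ _ _] := eP.
have [x _] := rs_nonempty M.
pose m : int := - r%:Z.
have PE l y : Phi l y = \sum_(i < (r + s).+1) sval l ^ (i%:Z - r%:Z) *: coef (i%:Z - r%:Z) y by exact: PhiE.
have base y : setT y -> Wlev G Phi 0 y `<=` @bounded_below R n m.
  move=> _ f [h]; rewrite (Slev0 sumG') => -[hh h0] ->.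
  have [L2g Fg] := @polynomial_mul R n (r + s).+1 r (fun i => coef (i%:Z - r%:Z) y) h
    (fun l => Phi l y *m h l) hh (fun l => congr1 (fun A => A *m h l) (PE l y)).
  split => // k km; rewrite Fg big1 // => i _.
  rewrite h0 ?mulmx0 //; move: km; rewrite /m; lia.
have := bounded_below_derived openT base (fun i => W_derived i openT eP).
move=> /(_ ((r + s).+1 * n)%N x I) sub.
have cv (v : 'cV[C]_n) : forall i : 'I_(r + s).+1, coef (i%:Z - r%:Z) x *m v = 0.
  (* far enough down for all frequencies of lambda^q Phi v to be below - r *)
  move=> i; set q : int := - (2 * (r + s).+1)%N%:Z.
  have Sv : Slev G ((r + s).+1 * n) x (lshift q (fun=> v)).
    rewrite (Slev_periodic sumG'); exists (lshift 0 (fun=> v)); last first.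
      by apply/funext => l; rewrite lshift0 /lshift /q exprnN.
    split => [|k k0]; first by apply: L2_shift; exact: cst_L2.
    by rewrite fourier_cst ifN // lt_eqF.
  have /sub : Wlev G Phi ((r + s).+1 * n) x (fun l => Phi l x *m lshift q (fun=> v) l).
    by exists (lshift q (fun=> v)).
  have L2v : L2 (lshift q (fun=> v)) by have [] := Sv.
  have [_ Fg] := @polynomial_mul R n (r + s).+1 r (fun i => coef (i%:Z - r%:Z) x) _
    (fun l => Phi l x *m lshift q (fun=> v) l) L2v (fun l => congr1 (fun A => A *m lshift q (fun=> v) l) (PE l x)).
  move=> [_ /(_ (q + (i%:Z - r%:Z)))].
  rewrite Fg (bigD1 i) //= big1 ?addr0 => [|j ji].
    rewrite addrK fourier_cst eqxx; apply.
    by have := ltn_ord i; rewrite /q /m; lia.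
  rewrite fourier_cst ifN ?mulmx0 //; apply: contra ji => /eqP h; apply/eqP/val_inj => /=.
  by move: h; lia.
have P0 l : Phi l x = 0.
  apply: mulmx_cols => v; rewrite PE mulmx_suml mul0mx big1 // => i _.
  by rewrite -scalemxAl cv scaler0.
have /unitarymxP := uP (one_S1 R) x I; rewrite P0 mul0mx => /matrixP /(_ (Ordinal (ltnW n2)) (Ordinal (ltnW n2))).
by rewrite !mxE eqxx => /eqP; rewrite eq_sym oner_eq0.
Qed.
End Final.

Theorem proposition4p14 (R : realType) (M : riemann_surface R) (n : nat)
    (phi : M -> 'M[Cx R]_n) (phi_CP : map_to_CP phi)
    (phi_harmonic : harmonic_map (cartan phi))
    (phi_superconformal : superconformal phi) :
  [/\ ~ finite_uniton_number (cartan phi),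
      (exists S, S_sequence (cartan phi) S) /\
      (forall S, S_sequence (cartan phi) S ->
         forall (j : nat) (x : M), S (j * n)%N x = lambda_shift (2 * j)%N (hardy R n)) &
      (forall (U : set M) (Phi : S1 R -> M -> 'M[Cx R]_n),
         open U -> extended_solution U (cartan phi) Phi ->
         (exists W, W_sequence U Phi W) /\
         (forall W, W_sequence U Phi W ->
            forall (j : nat) (x : M), U x ->
              W (j * n)%N x = lambda_shift (2 * j)%N (W 0%N x)))].
Proof.
have [G [G0 gG] [n1 horth hmax]] := phi_superconformal.
have n2 : (1 < n)%N by case: (n) n1 => [|[]].
have sumG x := @sum_gauss R M n phi phi_CP phi_harmonic G G0 gG n1 horth hmax x.
have S0 x : Slev G 0 x = hardy R n by exact: (Slev0 sumG).
have Sj j x : Slev G (j * n) x = lambda_shift (2 * j) (hardy R n) by exact: (Slev_periodic sumG).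
have dS i := @S_derived R M n phi phi_CP phi_harmonic G G0 gG n1 horth hmax i.
split; first exact: (@not_finite_uniton R M n phi phi_CP phi_harmonic G G0 gG n1 horth hmax).
  split => [|S [hS0 hS] j x]; first by exists (Slev G).
  rewrite -(Sj j x); apply: (derived_sequence_unique openT _ hS dS) => // y _.
  by rewrite hS0 S0.
move=> U Phi oU eP.
have dW i := @W_derived R M n phi phi_CP phi_harmonic G G0 gG n1 horth hmax U Phi i oU eP.
have W0 x : Wlev G Phi 0 x = loop_mul (Phi^~ x) (hardy R n) by rewrite /Wlev S0.
split => [|W [hW0 hW] j x Ux]; first by exists (Wlev G Phi).
have e i y : U y -> W i y = Wlev G Phi i y.
  by apply: (derived_sequence_unique oU _ hW dW) => z Uz; rewrite hW0 // W0.
rewrite !e // W0 /Wlev Sj; apply/seteqP; split => f.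
  move=> [_ [h hh ->] ->]; exists (fun l => Phi l x *m h l); first by exists h.
  by apply/funext => l; rewrite scalemxAr.
move=> [_ [h hh ->] ->]; exists (fun l => (sval l) ^- (2 * j) *: h l); first by exists h.
by apply/funext => l; rewrite scalemxAr.
Qed.
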